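(* There exist universal constants $C_8, C_9>0$ such that the following holds. Let $n,p$ be positive integers, let $m\ge n$ and $2\le s\le np$ be integers, and let $0<\delta_s\le 1$. Let $\Phi$ be the random $m\times np$ matrix defined in the context. If \[ m\ \ge\ C_9\,\delta_s^{-2}\, s\,\log^6(np), \] then \[ \mathbb{P}\big\{\|I-\Phi^*\Phi\|_s>\delta_s\big\}\ \le\ C_8\,(np)^{-1}. \]
   Context: Probe signals: for $i=1,\dots,p$ and $t=1,\dots,m$, the entries $\phi_i(t)$ are independent Gaussian random variables with mean $0$ and variance $1/m$. For each $i$, $\Phi_i$ is the $m\times n$ matrix with entries $\Phi_i(r,c)=\phi_i\big(((n+r-c-1)\bmod m)+1\big)$ for $1\le r\le m$, $1\le c\le n$; these are the first $n$ columns of an $m\times m$ circulant matrix. The matrix $\Phi=[\Phi_1\ \cdots\ \Phi_p]$ is their horizontal concatenation, of size $m\times np$. For an $N\times N$ matrix $A$, define \[ \|A\|_s=\sup\{|y^*Ax| : |\Gamma|\le s,\ x,y\text{ supported on }\Gamma\subset\{1,\dots,N\},\ \|x\|_2=\|y\|_2=1\}. \] $I$ is the $np\times np$ identity matrix. *)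

(* Defs.v *)
(* MathComp + MathComp-Analysis, with the concrete Stdlib reals R
   (a realType via Rstruct), so that the constants are genuinely universal. *)
From HB Require Import structures.
From mathcomp Require Import all_boot all_order all_algebra.
From mathcomp Require Import all_classical all_reals all_analysis.
From mathcomp Require Import Rstruct Rstruct_topology.
From Stdlib Require Rdefinitions.
Notation R := Rdefinitions.R.
Set Implicit Arguments. Unset Strict Implicit. Unset Printing Implicit Defensive.
Import Order.TTheory GRing.Theory Num.Theory.
Local Open Scope classical_set_scope.
Local Open Scope ring_scope.

Lemma ord_pos (m : nat) (r : 'I_m) : (0 < m)%N.
Proof. by case: m r => [[]|]. Qed.

(* 0-based version of the circulant index ((n + r - c - 1) mod m) + 1
   (1-based r, c, t): with r0 = r-1, c0 = c-1, t0 = t-1 we get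
   t0 = (n + r0 - (c0+1)) mod m; note c0 + 1 <= n so no truncation. *)
Definition circ_idx (n m : nat) (r : 'I_m) (c : 'I_n) : 'I_m :=
  Ordinal (ltn_pmod (n + r - c.+1) (ord_pos r)).

(* Entry of Phi = [Phi_1 ... Phi_p] in row r and in column c of block i;
   columns of Phi are indexed by pairs (i, c) : 'I_p * 'I_n
   (block i, column c inside Phi_i). *)
Definition Phi_entry {T : Type} (n m p : nat) (phi : 'I_p -> 'I_m -> T -> R)
  (r : 'I_m) (k : 'I_p * 'I_n) (w : T) : R :=
  phi k.1 (circ_idx r k.2) w.

Definition IminusGram {T : Type} (n m p : nat) (phi : 'I_p -> 'I_m -> T -> R)
  (w : T) (k l : 'I_p * 'I_n) : R :=
  (k == l)%:R - \sum_(r < m) Phi_entry phi r k w * Phi_entry phi r l w.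

(* ||A||_s = sup { |y^* A x| : |Gamma| <= s, x, y supported on Gamma,
   ||x||_2 = ||y||_2 = 1 }, computed in the extended reals (real vectors:
   A is real here). *)
Definition snorm {K : finType} (s : nat) (A : K -> K -> R) : \bar R :=
  ereal_sup [set e : \bar R | exists (Gamma : {set K}) (x y : K -> R),
    [/\ (#|Gamma| <= s)%N /\
        (forall k, k \notin Gamma -> x k = 0),
        (forall k, k \notin Gamma -> y k = 0),
        \sum_(k : K) x k ^+ 2 = 1, \sum_(k : K) y k ^+ 2 = 1 &
        e = (`| \sum_(k : K) \sum_(l : K) y k * A k l * x l |)%:E]].

(* Mutual independence of a finite family of real random variables:
   the product rule for every choice of Borel sets (taking B i = setT for
   the indices outside a subfamily gives the rule for every subfamily). *)
Definition mutually_independent (d : measure_display) (T : measurableType d)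
  (P : probability T R) (I : finType) (X : I -> T -> R) : Prop :=
  forall B : I -> set R, (forall i, measurable (B i : set (measurableTypeR R))) ->
    P [set w | forall i, B i (X i w)] = (\prod_(i : I) P (X i @^-1` B i))%E.

(* Main.v *)
(** Let g, g' be independent copies of the probe and put q_g(x) = |Phi_g x|^2.
    With u = g + g' and v = g - g', the difference q_g(x) - q_g'(x) equals
    sum_j v_j h_j(x), where h(x) is the correlation of x with Phi_u x. Exchanging
    g_j and g'_j on a random set of indices preserves u and flips signs of the v_j,
    so that conditionally the difference is a Rademacher sum, and a chaining
    argument bounds it uniformly in x.

    The chaining uses that a sparse unit vector is, up to rounding, an average of
    2^L vectors 0, +/- sqrt(s) e_k. Such an average is repeatedly halved: in each
    pair of letters one is dropped, according to signs chosen greedily against an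
    exponential potential over the frequencies. The resulting approximations are
    good in an Orlicz norm which is adapted to the discrete Fourier transform of u
    and which controls |h(x) - h(y)|; the Gaussian tails of the transform and of v
    enter through truncations only.

    For a fixed x, q_g(x) concentrates around |x|^2 by a second moment bound; a
    median argument then replaces q_g'(x) by |x|^2. Rounding towards zero keeps
    supports and decreases norms, so the quadratic form of I - Phi^* Phi on s-sparse
    vectors is controlled by its values on the grid through a contraction argument,
    and polarization gives the bilinear form in the definition of the norm. *)

Require Import Defs.
From HB Require Import structures.
From mathcomp Require Import all_boot all_order all_algebra.
From mathcomp Require Import all_classical all_reals all_analysis.
From mathcomp Require Import Rstruct Rstruct_topology.
From mathcomp Require Import normal_distribution measurable_realfun complex exp trigo zify ring lra.
Import Order.TTheory GRing.Theory Num.Theory.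
Local Open Scope classical_set_scope.
Local Open Scope ring_scope.

Set Implicit Arguments.
Unset Strict Implicit.
Unset Printing Implicit Defensive.

(** * Sparsification by signs *)

(** The bound involves n p only, while m may be arbitrarily large compared with n p. A supremum over
    the m frequencies would bring in log m. Hence approximation errors are measured by an
    exponential mean over the frequencies, and the truncations are estimated by Markov inequalities
    in which the number of frequencies or rows cancels.

    The deviation bound is also self-referential: the variance of the Rademacher sum contains D, the
    maximum of |Phi_u x|^2, which is itself to be controlled. This is resolved by a descent: if
    deviations above t + 1 have probability at most 1/4, then deviations above t have small
    probability, down to t = delta.

    The six logarithms: two from the squared number of chaining levels, one from the size of the
    alphabet, one from the truncation of v, one from the truncation of the transform of u, and one
    from the passage from the exponential mean to a mean square.

    Of the Gaussian law only the moment generating function is used. *)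

Section ExpInequalities.
Variable R : realType.
Implicit Types x y : R.

(** Weaker than cosh y <= exp (y^2 / 2); the loss affects constants only. For |y| > 1 each term is
    at most exp (y^2); otherwise a rational bound at y / 2 is carried to y by the duplication
    formula. *)
Lemma sum_expR_le y : expR y + expR (- y) <= 2 * expR (y ^+ 2).
Proof.
have [y1|y1] := lerP `|y| 1; last first.
  have h (z : R) : `|z| = `|y| -> expR z <= expR (y ^+ 2).
    move=> zy; rewrite ler_expR (le_trans (ler_norm z))// zy.
    by rewrite -real_normK ?num_real// expr2 ler_peMr// ltW.
  have := h y erefl; have := h (- y) (normrN y); lra.
have base (h : R) : `|h| <= 1 / 2 -> expR h + expR (- h) <= 2 + 2 * h ^+ 2.
  rewrite ler_norml => /andP[h1 h2].
  have e1 (z : R) : -1 < z -> expR (- z) <= (1 + z)^-1.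
    by move=> z1; rewrite expRN lef_pV2 ?posrE ?expR_gt0 ?expR_ge1Dx//; lra.
  have eN : expR (- h) <= ((1 + h / 2)^-1) ^+ 2.
    have -> : - h = - (h / 2) + - (h / 2) :> R by field.
    rewrite expRD expr2 ler_pM ?expR_ge0 ?e1//; lra.
  have eP : expR h <= ((1 - h / 2)^-1) ^+ 2.
    have -> : expR h = expR (- (- h / 2) + - (- h / 2)) by congr expR; field.
    rewrite expRD expr2; have e3 := e1 (- h / 2).
    have -> : 1 - h / 2 = 1 + - h / 2 by field.
    by rewrite ler_pM ?expR_ge0 ?e3//; lra.
  apply: (le_trans (lerD eP eN)).
  have p1 : 0 < 1 - h / 2 by lra.
  have p2 : 0 < 1 + h / 2 by lra.
  have -> : ((1 - h / 2)^-1) ^+ 2 + ((1 + h / 2)^-1) ^+ 2 =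
    (2 + h ^+ 2 / 2) / ((1 - h / 2) * (1 + h / 2)) ^+ 2.
    by field; rewrite ?gt_eqF//; lra.
  rewrite ler_pdivrMr ?exprn_gt0 ?mulr_gt0//.
  have h3 : h ^+ 2 <= 1 / 4 by nra.
  have h4 : 0 <= h ^+ 2 by apply: sqr_ge0.
  have -> : ((1 - h / 2) * (1 + h / 2)) ^+ 2 = (1 - h ^+ 2 / 4) ^+ 2 by field.
  set w := h ^+ 2 in h3 h4 *.
  nra.
have hy : `|y / 2| <= 1 / 2.
  by rewrite normrM [`|2^-1|]ger0_norm//; lra.
have b := base _ hy.
have d : expR y + expR (- y) = (expR (y / 2) + expR (- (y / 2))) ^+ 2 - 2.
  have -> : expR y = expR (y / 2) ^+ 2 by rewrite [RHS]expr2 -expRD; congr expR; field.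
  have -> : expR (- y) = expR (- (y / 2)) ^+ 2.
    by rewrite [RHS]expr2 -expRD; congr expR; field.
  have ab : expR (y / 2) * expR (- (y / 2)) = 1 by rewrite -expRD subrr expR0.
  have -> : (expR (y / 2) + expR (- (y / 2))) ^+ 2 = expR (y / 2) ^+ 2 +
    expR (- (y / 2)) ^+ 2 + 2 * (expR (y / 2) * expR (- (y / 2))) by ring.
  by rewrite ab; ring.
have e2 : (1 + y ^+ 2 / 2) ^+ 2 <= expR (y ^+ 2).
  have -> : expR (y ^+ 2) = expR (y ^+ 2 / 2) ^+ 2.
    by rewrite [RHS]expr2 -expRD; congr expR; field.
  have := sqr_ge0 y => y0.
  by rewrite lerXn2r ?nnegrE ?expR_ge0 ?expR_ge1Dx//; lra.
rewrite d.
have := sqr_ge0 y => y0.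
have y3 : y ^+ 2 <= 1 by rewrite -(expr1n _ 2) -real_normK ?num_real// lerXn2r ?nnegrE.
have yw : y ^+ 2 = 4 * (y / 2) ^+ 2 by field.
move: b e2 y3; rewrite yw; set w := (y / 2) ^+ 2; have : 0 <= w by apply: sqr_ge0.
set a := expR (y / 2) + _; move=> w0 b e2 y3.
have a0 : 0 <= a by rewrite addr_ge0 ?expR_ge0.
nra.
Qed.

Lemma expR_convex (t x y : R) : 0 <= t <= 1 ->
  expR (t * x + (1 - t) * y) <= t * expR x + (1 - t) * expR y.
Proof.
move=> /andP[t0 t1]; set z := t * x + _.
have h (u : R) : expR z * (1 + (u - z)) <= expR u.
  have -> : expR u = expR z * expR (u - z) by rewrite -expRD; congr expR; ring.
  by rewrite ler_wpM2l ?expR_ge0 ?expR_ge1Dx.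
have h1 := ler_wpM2l t0 (h x).
have t1' : 0 <= 1 - t by lra.
have h2 := ler_wpM2l t1' (h y).
apply: le_trans (lerD h1 h2).
have -> : t * (expR z * (1 + (x - z))) + (1 - t) * (expR z * (1 + (y - z))) =
  expR z * (1 + (t * x + (1 - t) * y - z)) by ring.
by rewrite -/z subrr addr0 mulr1.
Qed.

End ExpInequalities.

(** * Orlicz smallness over the frequencies and greedy signs *)

Section Entropy.
Variables (R : realType) (K Om E : finType).
Variables (c : Om -> E -> K -> R) (kap : Om -> R).
Hypothesis kap0 : forall om, 0 <= kap om.
Implicit Types z : K -> R.

(** For each om, later a frequency, the rows [c om e] are real linear functionals; a complex
    functional will occupy two rows. *)
Definition coord om e z : R := \sum_(k : K) c om e k * z k.

Definition energy z om : R := \sum_(e : E) coord om e z ^+ 2.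

(* [small lam z] says that an Orlicz norm of [z] is at most [lam]. *)
Definition small (lam : R) z : Prop :=
  \sum_om kap om * expR (energy z om / lam ^+ 2) <= 2 * \sum_om kap om.

Lemma energy_ge0 z om : 0 <= energy z om.
Proof. by apply: sumr_ge0 => e _; apply: sqr_ge0. Qed.

Lemma coordD om e z1 z2 :
  coord om e (fun k => z1 k + z2 k) = coord om e z1 + coord om e z2.
Proof. by rewrite /coord -big_split; apply: eq_bigr => k _; rewrite mulrDr. Qed.

Lemma coordZ om e a z : coord om e (fun k => a * z k) = a * coord om e z.
Proof. by rewrite /coord mulr_sumr; apply: eq_bigr => k _; rewrite mulrCA. Qed.

Lemma coordB om e z1 z2 :
  coord om e (fun k => z1 k - z2 k) = coord om e z1 - coord om e z2.
Proof. by rewrite /coord -sumrB; apply: eq_bigr => k _; rewrite mulrBr. Qed.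

Lemma coord0 om e : coord om e (fun _ => 0) = 0.
Proof. by rewrite /coord big1// => k _; rewrite mulr0. Qed.

Lemma energyZ a z om : energy (fun k => a * z k) om = a ^+ 2 * energy z om.
Proof.
by rewrite /energy mulr_sumr; apply: eq_bigr => e _; rewrite coordZ exprMn.
Qed.

Lemma energy0 om : energy (fun _ => 0) om = 0.
Proof. by rewrite /energy big1// => e _; rewrite coord0 expr0n. Qed.

Lemma small0 lam : small lam (fun _ => 0).
Proof.
rewrite /small mulr_sumr; apply: ler_sum => om _.
by rewrite energy0 mul0r expR0 mulr1; have := kap0 om; lra.
Qed.

Lemma small_le (l1 l2 : R) z : 0 < l1 -> l1 <= l2 -> small l1 z -> small l2 z.
Proof.
move=> l10 l12; have l20 := lt_le_trans l10 l12.
apply: le_trans; apply: ler_sum => om _.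
rewrite ler_wpM2l// ler_expR ler_wpM2l ?energy_ge0// lef_pV2 ?posrE ?exprn_gt0//.
by rewrite lerXn2r// nnegrE ltW.
Qed.

(** Triangle inequality of the Orlicz norm: convexity of exp with weights l1 / (l1 + l2) and l2 /
    (l1 + l2). *)
Lemma smallD (l1 l2 : R) z1 z2 : 0 < l1 -> 0 < l2 ->
  small l1 z1 -> small l2 z2 -> small (l1 + l2) (fun k => z1 k + z2 k).
Proof.
move=> l10 l20 s1 s2; have l120 : 0 < l1 + l2 by rewrite addr_gt0.
set t := l1 / (l1 + l2).
have t01 : 0 <= t <= 1.
  apply/andP; split; first by rewrite /t divr_ge0// ltW.
  by rewrite /t ler_pdivrMr// mul1r lerDl ltW.
have t1E : 1 - t = l2 / (l1 + l2) by rewrite /t; field; rewrite gt_eqF.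
have h (om : Om) : kap om * expR (energy (fun k => z1 k + z2 k) om / (l1 + l2) ^+ 2) <=
    t * (kap om * expR (energy z1 om / l1 ^+ 2)) +
    (1 - t) * (kap om * expR (energy z2 om / l2 ^+ 2)).
  rewrite mulrCA [X in _ <= _ + X]mulrCA -mulrDr ler_wpM2l//.
  apply: (le_trans _ (expR_convex _ _ t01)); rewrite ler_expR.
  rewrite /energy !mulr_suml !mulr_sumr -big_split; apply: ler_sum => e _.
  rewrite /= coordD t1E /t; set a := coord om e z1; set b := coord om e z2.
  (* The defect in this convexity inequality is an explicit square. *)
  have -> : l1 / (l1 + l2) * (a ^+ 2 / l1 ^+ 2) + l2 / (l1 + l2) * (b ^+ 2 / l2 ^+ 2)
    = (a + b) ^+ 2 / (l1 + l2) ^+ 2 + (l2 * a - l1 * b) ^+ 2 / (l1 * l2 * (l1 + l2) ^+ 2).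
    by field; rewrite !gt_eqF.
  by rewrite lerDl divr_ge0 ?sqr_ge0// !mulr_ge0 ?exprn_ge0 ?ltW.
apply: le_trans (ler_sum _ (fun om _ => h om)) _.
rewrite big_split /= -!mulr_sumr.
have t0 : 0 <= t by case/andP: t01.
have t1 : 0 <= 1 - t by rewrite subr_ge0; case/andP: t01.
have := ler_wpM2l t0 s1; have := ler_wpM2l t1 s2.
set A := \sum_om _; set B := \sum_om _; set C := \sum_om _; lra.
Qed.

Lemma smallN lam z : small lam z -> small lam (fun k => - z k).
Proof.
apply: le_trans; apply: ler_sum => om _.
suff -> : energy (fun k => - z k) om = energy z om by [].
have -> : (fun k => - z k) = (fun k => -1 * z k) by apply/funext => k; rewrite mulN1r.
by rewrite energyZ sqrrN expr1n mul1r.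
Qed.

(* Signs are chosen one at a time so as not to increase a potential
   [sum_om kap om * exp (theta_k * energy S_k om)], where [theta_k] decreases
   just fast enough to absorb the growth of the energy. *)
Lemma greedy_signs (I : finType) (b : I -> K -> R) (M : nat) (beta : R) (s : seq I) :
  (0 < M)%N -> 0 < beta -> (forall i om, energy (b i) om <= beta) ->
  uniq s ->
  exists eps : I -> bool,
    \sum_om kap om * expR (energy (fun k => \sum_(i <- s) (-1) ^+ eps i * b i k) om
        / (4 * beta * (M + size s)%:R))
    <= expR ((size s)%:R / (4 * M%:R)) * \sum_om kap om.
Proof.
move=> M0 beta0 hb.
elim: s => [_|i s IH /=/andP[nis us]].
  exists (fun _ => false) => /=; rewrite mul0r expR0 mul1r; apply: ler_sum => om _.
  have -> : (fun k => \sum_(i <- [::]) (-1) ^+ false * b i k) = (fun=> 0).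
    by apply/funext => k; rewrite big_nil.
  by rewrite energy0 mul0r expR0 mulr1.
have [eps heps] := IH us.
pose S k := \sum_(i0 <- s) (-1) ^+ eps i0 * b i0 k.
have [N NE] : exists N : R, N = (M + size s)%:R by eexists.
rewrite -NE in heps.
have N0 : 0 < N by rewrite NE ltr0n addn_gt0 M0.
have NM : M%:R <= N :> R by rewrite NE ler_nat leq_addr.
have M0' : 0 < M%:R :> R by rewrite ltr0n.
pose S' (e : bool) k := (-1) ^+ e * b i k + S k.
have key om : expR (energy (S' false) om / (4 * beta * (N + 1))) +
    expR (energy (S' true) om / (4 * beta * (N + 1))) <=
    2 * (expR (1 / (4 * M%:R)) * expR (energy S om / (4 * beta * N))).
  pose d := \sum_(e : E) coord om e (b i) * coord om e S.
  have en e : energy (S' e) om = energy S om + energy (b i) om + 2 * (-1) ^+ e * d.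
    rewrite /energy -big_split /d mulr_sumr -big_split; apply: eq_bigr => x _ /=.
    rewrite coordD coordZ; case: e => /=; ring.
  have d2 : d ^+ 2 <= energy (b i) om * energy S om.
    have h (t : R) : 0 <= energy (b i) om * t ^+ 2 + 2 * d * t + energy S om.
      have -> : energy (b i) om * t ^+ 2 + 2 * d * t + energy S om =
         \sum_(e : E) (coord om e (b i) * t + coord om e S) ^+ 2.
        rewrite /energy /d mulr_sumr !mulr_suml -!big_split; apply: eq_bigr => x _ /=; ring.
      by apply: sumr_ge0 => e _; apply: sqr_ge0.
    have := energy_ge0 (b i) om; have := energy_ge0 S om.
    set p := energy (b i) om in h *; set q := energy S om in h * => q0 p0.
    have [p00|p1] := eqVneq p 0.
      have [->|d0] := eqVneq d 0; first by rewrite p00 mul0r expr0n.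
      have := h (- (q + 1) / (2 * d)); rewrite p00.
      have -> : 0 * (- (q + 1) / (2 * d)) ^+ 2 + 2 * d * (- (q + 1) / (2 * d)) + q = -1.
        by field.
      by lra.
    have p2 : 0 < p by rewrite lt0r p1 p0.
    have := h (- d / p).
    have -> : p * (- d / p) ^+ 2 + 2 * d * (- d / p) + q = (p * q - d ^+ 2) / p by field.
    by rewrite pmulr_lge0 ?invr_gt0// subr_ge0.
  pose y := 2 * d / (4 * beta * (N + 1)).
  have -> : energy (S' false) om / (4 * beta * (N + 1)) =
      (energy S om + energy (b i) om) / (4 * beta * (N + 1)) + y.
    by rewrite en /y /= expr0; ring.
  have -> : energy (S' true) om / (4 * beta * (N + 1)) =
      (energy S om + energy (b i) om) / (4 * beta * (N + 1)) + - y.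
    by rewrite en /y /= expr1; ring.
  rewrite !expRD -mulrDr.
  have e0 : 0 <= expR ((energy S om + energy (b i) om) / (4 * beta * (N + 1))).
    exact: expR_ge0.
  apply: le_trans (ler_wpM2l e0 (sum_expR_le y)) _.
  rewrite mulrCA ler_wpM2l// -!expRD ler_expR /y.
  have hbi := hb i om; have b0 := energy_ge0 (b i) om; have S0 := energy_ge0 S om.
  set B := energy (b i) om in hbi d2 b0 *; set Q := energy S om in d2 S0 *.
  have d3 : d ^+ 2 <= beta * Q by apply: le_trans d2 _; rewrite ler_wpM2r.
  have N1 : 0 < N + 1 by lra.
  have h1 : B / (4 * beta * (N + 1)) <= 1 / (4 * M%:R).
    rewrite ler_pdivrMr ?mulr_gt0// mulrAC ler_pdivlMr ?mulr_gt0//.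
    nra.
  (* Since d^2 <= beta * Q, this reduces to 1 / (N + 1) + 1 / (N + 1)^2 <= 1 / N: the change from N
     to N + 1 pays for the cross term. *)
  have h2 : Q / (4 * beta * (N + 1)) + (2 * d / (4 * beta * (N + 1))) ^+ 2 <=
       Q / (4 * beta * N).
    apply: (@le_trans _ _ (Q / (4 * beta * (N + 1)) + 4 * (beta * Q) / (4 * beta * (N + 1)) ^+ 2)).
      rewrite lerD2l exprMn exprVn ler_wpM2r ?invr_ge0 ?sqr_ge0// exprMn; lra.
    have -> : Q / (4 * beta * (N + 1)) + 4 * (beta * Q) / (4 * beta * (N + 1)) ^+ 2 =
       Q / (4 * beta * N) - Q / (4 * beta * N * (N + 1) ^+ 2).
      by field; rewrite !gt_eqF.
    by rewrite gerBl divr_ge0// !mulr_ge0 ?exprn_ge0// ltW.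
  rewrite mulrDl; lra.
(* The two potentials add up to at most twice the bound, so one of the signs respects it. *)
have [e he] : exists e, \sum_om kap om * expR (energy (S' e) om / (4 * beta * (N + 1)))
   <= expR (1 / (4 * M%:R)) * \sum_om kap om * expR (energy S om / (4 * beta * N)).
  set RHS := expR (1 / _) * _.
  have : \sum_om kap om * expR (energy (S' false) om / (4 * beta * (N + 1))) +
     \sum_om kap om * expR (energy (S' true) om / (4 * beta * (N + 1))) <= 2 * RHS.
    rewrite -big_split /RHS /= !mulr_sumr; apply: ler_sum => om _.
    rewrite -mulrDr.
    apply: (le_trans (ler_wpM2l (kap0 om) (key om))).
    by rewrite le_eqVlt; apply/orP; left; apply/eqP; ring.
  set x0 := \sum_om _; set x1 := \sum_om _ => h.
  have [h0|h0] := lerP x0 RHS; first by exists false.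
  by exists true; rewrite -/x1; lra.
exists (fun i' => if i' == i then e else eps i').
have -> : (fun k => \sum_(i0 <- i :: s) (-1) ^+ (if i0 == i then e else eps i0) * b i0 k) = S' e.
  apply/funext => k; rewrite big_cons eqxx /S' /S; congr (_ + _).
  apply: eq_big_seq => i' i's; case: eqP => // ii'.
  by rewrite -ii' i's in nis.
have -> : (M + (size s).+1)%:R = N + 1 :> R by rewrite addnS -natr1 NE.
apply: le_trans he _.
have -> : (size s).+1%:R / (4 * M%:R) = 1 / (4 * M%:R) + (size s)%:R / (4 * M%:R) :> R.
  by rewrite -natr1 mulrDl addrC.
rewrite expRD -[X in _ <= X]mulrA; apply: ler_wpM2l; first exact: expR_ge0.
exact: heps.
Qed.

End Entropy.

(** * Codes for averages of letters and their approximation by shorter codes *)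

Section Codes.
Variables (R : realType) (K Om E : finType).
Variables (c : Om -> E -> K -> R) (kap : Om -> R).
Hypothesis kap0 : forall om, 0 <= kap om.
Hypothesis c2 : forall om k, \sum_(e : E) c om e k ^+ 2 <= 2.
Variable sg : R.
Hypothesis sg0 : 0 < sg.

(** Not written as a power, so that ['I_(pow2 j.+1)] is convertible to ['I_(pow2 j + pow2 j)] and
    [lshift], [rshift] apply without casts. *)
Fixpoint pow2 (j : nat) : nat := if j is j'.+1 then (pow2 j' + pow2 j')%N else 1%N.

Lemma pow2E j : pow2 j = (2 ^ j)%N.
Proof. by elim: j => //= j ->; rewrite expnS mul2n addnn. Qed.

Lemma pow2_gt0 j : (0 < pow2 j)%N. Proof. by rewrite pow2E expn_gt0. Qed.

Definition letter : finType := option (bool * K).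

Definition vec (w : letter) (k : K) : R :=
  if w is Some (b, k') then (-1) ^+ (b : bool) * (k == k')%:R else 0.

Definition code j : finType := {ffun 'I_(pow2 j) -> letter}.

Definition avg j (w : code j) (k : K) : R :=
  sg / 2 ^+ j * \sum_l vec (w l) k.

Lemma coord_vec om e w : coord c om e (vec w) =
  if w is Some (b, k) then (-1) ^+ (b : bool) * c om e k else 0.
Proof.
case: w => [[b k]|]; last by rewrite /coord big1// => k _; rewrite mulr0.
rewrite /coord (bigD1 k)//= big1 => [|k' /negbTE k'k]; last by rewrite k'k !mulr0.
by rewrite eqxx mulr1 addr0 mulrC.
Qed.

Lemma energy_vec w om : energy c (vec w) om <= 2.
Proof.
rewrite /energy; under eq_bigr do rewrite coord_vec.
case: w => [[b k]|]; last by rewrite big1// => e _; rewrite expr0n.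
by under eq_bigr do rewrite exprMn sqrr_sign mul1r.
Qed.

Lemma energyB_le z1 z2 om :
  energy c (fun k => z1 k - z2 k) om <= 2 * energy c z1 om + 2 * energy c z2 om.
Proof.
rewrite /energy !mulr_sumr -big_split; apply: ler_sum => e _; rewrite coordB /=.
set a := coord _ _ _ z1; set b := coord _ _ _ z2.
have := sqr_ge0 (a + b); nra.
Qed.

(** A letter has energy at most 2, so the exponent is at most 1/2, and exp (1/2) <= 2. *)
Lemma small_avg0 (w : code 0) : small c kap (2 * sg) (avg w).
Proof.
rewrite /small mulr_sumr; apply: ler_sum => om _.
rewrite mulrC ler_wpM2r//.
have -> : avg w = (fun k => sg * vec (w ord0) k).
  by apply/funext => k; rewrite /avg expr0 divr1 big_ord1.
rewrite energyZ exprMn; set u := energy _ _ _.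
have -> : sg ^+ 2 * u / (2 ^+ 2 * sg ^+ 2) = u / 4 by field; rewrite gt_eqF.
apply: (@le_trans _ _ (expR (1 / 2))).
  by rewrite ler_expR; have := energy_vec (w ord0) om; rewrite -/u; lra.
have -> : (1 / 2 : R) = - (- (1 / 2)) by rewrite opprK.
rewrite expRN -[leRHS]invrK lef_pV2 ?posrE ?expR_gt0//.
by apply: (le_trans _ (expR_ge1Dx _)); lra.
Qed.

(** Keeping one letter of a pair with doubled weight changes the sum of the pair by plus or minus
    the difference of the two letters. The total error is thus a signed sum of the [b l], and the
    signs say which letters to keep. *)
Lemma halve j (w : code j.+1) : exists w' : code j,
  small c kap (4 * sg / Num.sqrt 2 ^+ j) (fun k => avg w k - avg w' k).
Proof.
have a2 : 0 < (2 : R) ^+ j by rewrite exprn_gt0.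
pose a : R := sg / 2 ^+ j.+1.
have a0 : 0 < a by rewrite divr_gt0// exprn_gt0.
pose b (l : 'I_(pow2 j)) k := a * (vec (w (lshift _ l)) k - vec (w (rshift _ l)) k).
(* Two letters of energy at most 2 differ by a vector of energy at most 2 * 2 + 2 * 2. *)
pose beta := a ^+ 2 * 8.
have beta0 : 0 < beta by rewrite mulr_gt0// exprn_gt0.
have hb l om : energy c (b l) om <= beta.
  rewrite energyZ ler_wpM2l ?sqr_ge0//; apply: (le_trans (energyB_le _ _ _)).
  have := energy_vec (w (lshift _ l)) om; have := energy_vec (w (rshift _ l)) om; lra.
have [eps heps] := greedy_signs kap0 (pow2_gt0 j) beta0 hb (index_enum_uniq _).
exists [ffun l => if eps l then w (lshift _ l) else w (rshift _ l)].
have sE : size (index_enum 'I_(pow2 j)) = pow2 j.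
  by rewrite -sum1_size sum1_card card_ord.
rewrite sE in heps.
rewrite /small.
set S := (fun k => _ - _).
have SE : S = (fun k => \sum_l (-1) ^+ eps l * b l k).
  apply/funext => k; rewrite /S /avg big_split_ord /= -/a.
  have -> : sg / 2 ^+ j = a * 2 by rewrite /a [2 ^+ j.+1]exprS; field; rewrite gt_eqF.
  rewrite -mulrA -mulrBr mulr_sumr -big_split -sumrB mulr_sumr.
  apply: eq_bigr => l _ /=; rewrite ffunE /b; case: (eps l) => /=; ring.
rewrite SE.
have -> : (4 * sg / Num.sqrt 2 ^+ j) ^+ 2 = 4 * beta * (pow2 j + pow2 j)%:R.
  rewrite exprMn exprVn -exprM mulnC exprM sqr_sqrtr// pow2E natrD natrX.
  by rewrite /beta /a [2 ^+ j.+1]exprS; field; rewrite gt_eqF.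
apply: (le_trans heps); rewrite ler_wpM2r ?sumr_ge0//.
have -> : ((pow2 j)%:R / (4 * (pow2 j)%:R) : R) = - (- (1 / 4)).
  by field; rewrite pnatr_eq0 -lt0n pow2_gt0.
rewrite expRN -[leRHS]invrK lef_pV2 ?posrE ?expR_gt0//.
by apply: (le_trans _ (expR_ge1Dx _)); lra.
Qed.

(** A majorant of the sum of all halving errors from level j on: 14 / sqrt 2 + 4 <= 14 because sqrt
    2 >= 7/5. *)
Definition lamj j : R := 14 * sg / Num.sqrt 2 ^+ j.

Lemma sqrt2_gt0 : 0 < Num.sqrt 2 :> R. Proof. by rewrite sqrtr_gt0. Qed.

Lemma lamj_gt0 j : 0 < lamj j.
Proof. by rewrite divr_gt0 ?mulr_gt0// exprn_gt0 ?sqrt2_gt0. Qed.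

Lemma lamjS j : lamj j.+1 + 4 * sg / Num.sqrt 2 ^+ j <= lamj j.
Proof.
have h : 7 / 5 <= Num.sqrt 2 :> R.
  by have := sqr_sqrtr (ler0n R 2); have := sqrtr_ge0 (2 : R); nra.
rewrite /lamj exprS.
have p : 0 < Num.sqrt 2 ^+ j :> R by rewrite exprn_gt0 ?sqrt2_gt0.
have -> : 14 * sg / (Num.sqrt 2 * Num.sqrt 2 ^+ j) + 4 * sg / Num.sqrt 2 ^+ j =
  (14 / Num.sqrt 2 + 4) * (sg / Num.sqrt 2 ^+ j).
  by field; rewrite !gt_eqF ?sqrt2_gt0.
have q : 0 <= sg / Num.sqrt 2 ^+ j by rewrite divr_ge0// ltW.
have h1 : 14 / Num.sqrt 2 <= 10 :> R by rewrite ler_pdivrMr ?sqrt2_gt0//; lra.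
by rewrite -mulrA; apply: ler_wpM2r => //; lra.
Qed.

Lemma approx J (w : code J) j : (j <= J)%N ->
  exists w' : code j, small c kap (lamj j) (fun k => avg w k - avg w' k).
Proof.
move=> jJ; rewrite -(subKn jJ); have := leq_subr j J.
elim: (J - j)%N => [|d IH] dJ.
  rewrite subn0; exists w.
  have -> : (fun k => avg w k - avg w k) = (fun=> 0) by apply/funext => k; rewrite subrr.
  exact: small0.
have [w1 h1] := IH (ltnW dJ).
have E1 : (J - d)%N = (J - d.+1).+1 by rewrite subnS prednK// subn_gt0.
rewrite E1 in w1 h1.
have [w2 h2] := halve w1; exists w2.
have -> : (fun k => avg w k - avg w2 k) =
    (fun k => (avg w k - avg w1 k) + (avg w1 k - avg w2 k)).
  by apply/funext => k; rewrite addrA subrK.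
apply: (small_le kap0 _ (lamjS _)).
  by rewrite addr_gt0 ?lamj_gt0// divr_gt0 ?mulr_gt0 ?exprn_gt0 ?sqrt2_gt0.
by apply: smallD; rewrite ?lamj_gt0// divr_gt0 ?mulr_gt0 ?exprn_gt0 ?sqrt2_gt0.
Qed.

(* [rho j] factors through the codes of length [2^j], and takes values in [X]. *)
Lemma chain_maps J (X : pred (code J)) : exists rho : nat -> code J -> code J,
  [/\ forall w, X w -> forall k, avg (rho J w) k = avg w k,
      forall j w, X w -> X (rho j w),
      forall j, exists (f : code J -> code j) (g : code j -> code J),
        (j <= J)%N -> forall w, X w -> rho j w = g (f w),
      forall j w, (j < J)%N -> X w ->
        small c kap (4 * lamj j) (fun k => avg (rho j.+1 w) k - avg (rho j w) k) &
      forall w, X w -> small c kap (4 * lamj 0) (avg (rho 0 w))].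
Proof.
have ex j : exists f : code J -> code j, (j <= J)%N ->
   forall w, small c kap (lamj j) (fun k => avg w k - avg (f w) k).
  have [jJ|jJ] := leqP j J; last by exists (fun _ => [ffun => None]).
  have h (w : code J) := cid (approx w jJ).
  by exists (fun w => sval (h w)) => _ w; exact: (svalP (h w)).
pose f0 j := sval (cid (ex j)).
have f0P j : (j <= J)%N -> forall w, small c kap (lamj j) (fun k => avg w k - avg (f0 j w) k).
  by move=> jJ w; exact: (svalP (cid (ex j)) jJ w).
(* A representative in X of the words with a given short code; the default is not reached from a
   word of X. *)
pose g j (v : code j) : code J := odflt [ffun => None] [pick w | X w && (f0 j w == v)].
pose rho j w := if j == J then w else g j (f0 j w).
have rhoP j w : X w -> (j < J)%N -> X (rho j w) /\ f0 j (rho j w) = f0 j w.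
  move=> Xw jJ; rewrite /rho ltn_eqF// /g; case: pickP => [w' /andP[Xw' /eqP]//|/(_ w)].
  by rewrite Xw eqxx.
(* A word and its representative have the same short code, so each is within [lamj j] of a common
   point. *)
have near j w : (j <= J)%N -> X w -> small c kap (2 * lamj j) (fun k => avg (rho j w) k - avg w k).
  rewrite leq_eqVlt => /orP[/eqP jJ _|jJ Xw].
    rewrite /rho jJ eqxx.
    have -> : (fun k => avg w k - avg w k) = (fun=> 0) by apply/funext => k; rewrite subrr.
    exact: small0.
  have [_ e1] := rhoP _ _ Xw jJ.
  have h1 := f0P _ (ltnW jJ) (rho j w); rewrite e1 in h1.
  have h2 := smallN (f0P _ (ltnW jJ) w).
  have -> : 2 * lamj j = lamj j + lamj j by ring.
  have -> : (fun k => avg (rho j w) k - avg w k) =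
     (fun k => (avg (rho j w) k - avg (f0 j w) k) + - (avg w k - avg (f0 j w) k)).
    by apply/funext => k; ring.
  by apply: smallD; rewrite ?lamj_gt0.
have lam_le j : lamj j.+1 <= lamj j.
  apply: le_trans (lamjS j); rewrite lerDl.
  by rewrite divr_ge0 ?mulr_ge0 ?exprn_ge0 ?sqrtr_ge0// ltW.
exists rho; split.
- by move=> w Xw k; rewrite /rho eqxx.
- move=> j w Xw; have [jJ|jJ|->] := ltngtP j J; last by rewrite /rho eqxx.
    by have [] := rhoP _ _ Xw jJ.
  rewrite /rho gtn_eqF// /g; case: pickP => [w' /andP[]//|/(_ w)].
  by rewrite Xw eqxx.
- move=> j; have [jJ|jJ] := eqVneq j J.
    by subst j; exists id, id => _ w Xw; rewrite /rho eqxx.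
  by exists (f0 j), (g j) => _ w Xw; rewrite /rho (negbTE jJ).
- move=> j w jJ Xw.
  have h1 := near _ _ (ltnW jJ) Xw; have h2 := near _ _ jJ Xw.
  have -> : (fun k => avg (rho j.+1 w) k - avg (rho j w) k) =
    (fun k => (avg (rho j.+1 w) k - avg w k) + - (avg (rho j w) k - avg w k)).
    by apply/funext => k; ring.
  have p1 : 0 < 2 * lamj j by rewrite mulr_gt0 ?lamj_gt0.
  have p2 : 0 < 2 * lamj j.+1 by rewrite mulr_gt0 ?lamj_gt0.
  apply: (@small_le _ _ _ _ _ _ kap0 (2 * lamj j.+1 + 2 * lamj j)).
  - by rewrite addr_gt0.
  - by have := lam_le j; lra.
  - by apply: smallD => //; exact: smallN.
- move=> w Xw.
  have h1 := near _ _ (leq0n J) Xw; have h2 := f0P _ (leq0n J) w.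
  have h3 := small_avg0 (f0 0 w).
  have -> : avg (rho 0 w) =
     (fun k => (avg (rho 0 w) k - avg w k) + ((avg w k - avg (f0 0 w) k) + avg (f0 0 w) k)).
    by apply/funext => k; ring.
  have p0 := lamj_gt0 0.
  (* In units of sg: 2 * 14 + 14 + 2 = 44 is below 4 * 14. *)
  apply: (@small_le _ _ _ _ _ _ kap0 (2 * lamj 0 + (lamj 0 + 2 * sg))).
  - by rewrite /lamj expr0 divr1; have := sg0; lra.
  - by rewrite /lamj expr0 divr1; have := sg0; lra.
  - apply: smallD => //; [lra|have := sg0; lra|].
    by apply: smallD => //; have := sg0; lra.
Qed.

End Codes.

(** * Chaining over random signs *)

Section SignSums.
Variables (R : realType) (J : finType).
Implicit Types (a : J -> R) (eps : {ffun J -> bool}).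

Definition sign_sum eps a : R := \sum_j (-1) ^+ eps j * a j.

Lemma sign_sumB eps a b :
  sign_sum eps (fun j => a j - b j) = sign_sum eps a - sign_sum eps b.
Proof. by rewrite /sign_sum -sumrB; apply: eq_bigr => j _; rewrite mulrBr. Qed.

Lemma sign_mgf a : \sum_eps expR (sign_sum eps a) <= 2 ^+ #|J| * expR (\sum_j a j ^+ 2).
Proof.
have -> : \sum_eps expR (sign_sum eps a) =
    \sum_(eps : {ffun J -> bool}) \prod_j expR ((-1) ^+ eps j * a j).
  by apply: eq_bigr => eps _; rewrite expR_sum.
rewrite -(bigA_distr_bigA (fun j (b : bool) => expR ((-1) ^+ b * a j))).
have -> : (2 : R) ^+ #|J| * expR (\sum_j a j ^+ 2) = \prod_j (2 * expR (a j ^+ 2)).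
  by rewrite big_split /= prodr_const expR_sum.
apply: ler_prod => j _; apply/andP; split.
  by apply: sumr_ge0 => b _; exact: expR_ge0.
by rewrite big_bool /= expr0 expr1 mul1r mulN1r addrC sum_expR_le.
Qed.

(** Chernoff bound for both tails, with the optimal l = t / (2 V). Sums over all sign patterns stand
    for 2^#|J| times a uniform probability. *)
Lemma sign_tail a (t V : R) : 0 <= t -> 0 < V -> \sum_j a j ^+ 2 <= V ->
  \sum_eps (t < `|sign_sum eps a|)%R%:R <= 2 ^+ #|J| * (2 * expR (- (t ^+ 2 / (4 * V)))).
Proof.
move=> t0 V0 aV; pose l := t / (2 * V).
have l0 : 0 <= l by rewrite divr_ge0// mulr_ge0// ltW.
have half (b : J -> R) : \sum_j b j ^+ 2 <= V ->
    \sum_eps expR (l * sign_sum eps b - l * t) <= 2 ^+ #|J| * expR (- (t ^+ 2 / (4 * V))).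
  move=> bV.
  have -> : \sum_eps expR (l * sign_sum eps b - l * t) =
      (\sum_eps expR (sign_sum eps (fun j => l * b j))) * expR (- (l * t)).
    rewrite mulr_suml; apply: eq_bigr => eps _; rewrite -expRD; congr (expR (_ + _)).
    by rewrite /sign_sum mulr_sumr; apply: eq_bigr => j _; rewrite mulrCA.
  apply: (le_trans (ler_wpM2r (expR_ge0 _) (sign_mgf _))).
  rewrite -mulrA -expRD ler_wpM2l ?exprn_ge0// ler_expR.
  have -> : \sum_j (l * b j) ^+ 2 = l ^+ 2 * \sum_j b j ^+ 2.
    by rewrite mulr_sumr; apply: eq_bigr => j _; rewrite exprMn.
  have := ler_wpM2l (sqr_ge0 l) bV.
  have -> : - (t ^+ 2 / (4 * V)) = l ^+ 2 * V - l * t by rewrite /l; field; rewrite gt_eqF.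
  lra.
have aV' : \sum_j (- a j) ^+ 2 <= V.
  by under eq_bigr do rewrite sqrrN.
have := lerD (half a aV) (half (fun j => - a j) aV').
rewrite -big_split => h; apply: le_trans (le_trans h _); last first.
  by rewrite le_eqVlt; apply/orP; left; apply/eqP; ring.
apply: ler_sum => eps _ /=.
have -> : sign_sum eps (fun j => - a j) = - sign_sum eps a.
  by rewrite /sign_sum -sumrN; apply: eq_bigr => j _; rewrite mulrN.
set S := sign_sum eps a.
have p1 := expR_ge0 (l * S - l * t); have p2 := expR_ge0 (l * - S - l * t).
case: ltP => [tS|_]; last by rewrite addr_ge0.
have -> : true%:R = 1 :> R by [].
have e1 (x : R) : t <= x -> 1 <= expR (l * x - l * t).
  by move=> tx; rewrite -[leLHS]expR0 ler_expR -mulrBr mulr_ge0// subr_ge0 tx.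
have [S0|S0] := lerP 0 S.
  by rewrite ger0_norm// in tS; have := e1 S (ltW tS); lra.
by rewrite ltr0_norm// in tS; have := e1 (- S) (ltW tS); lra.
Qed.

Variables (Pt : finType) (X : pred Pt) (tv : Pt -> J -> R) (rho : nat -> Pt -> Pt).
Variables (L N : nat) (V th : R) (A : nat -> finType).
Hypotheses (N2 : (2 <= N)%N) (V0 : 0 < V) (th0 : 0 <= th).
Hypothesis thV : 20 * V * ln N%:R <= th ^+ 2.
Hypothesis cardA : forall j, (j <= L)%N -> (#|A j| <= N ^ (2 ^ j))%N.
Hypothesis rhoL : forall w, X w -> tv (rho L w) =1 tv w.
Hypothesis rhoA : forall j, exists (f : Pt -> A j) (g : A j -> Pt),
  (j <= L)%N -> forall w, X w -> rho j w = g (f w).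
Hypothesis incr : forall j w, (j < L)%N -> X w ->
  \sum_i (tv (rho j.+1 w) i - tv (rho j w) i) ^+ 2 <= V / 2 ^+ j.
Hypothesis incr0 : forall w, X w -> \sum_i tv (rho 0 w) i ^+ 2 <= V.

Let big_at eps (a : J -> R) : bool := th < `|sign_sum eps a|.

(** By [thV] each link has a tail of order N^(-5 * 2^j), and there are at most N^(3 * 2^j) links;
    the remaining N^(-2 * 2^j) is at most N^-2 / 2^j. *)
Let level_tail (B : finType) (a : B -> J -> R) (j k : nat) :
  (k <= 3 * 2 ^ j)%N -> (#|B| <= N ^ k)%N ->
  \sum_eps \sum_(b : B) ((\sum_i a b i ^+ 2 <= V / 2 ^+ j) && big_at eps (a b))%:R
    <= 2 ^+ #|J| * (2 * (N%:R ^- 2 / 2 ^+ j)) :> R.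
Proof.
move=> kj cB; rewrite exchange_big /=.
have N1 : 0 < N%:R :> R by rewrite ltr0n; case: N N2.
have p2 : 0 < (2 : R) ^+ j by rewrite exprn_gt0.
have hb b : \sum_(eps : {ffun J -> bool})
    ((\sum_i a b i ^+ 2 <= V / 2 ^+ j) && big_at eps (a b))%:R
    <= 2 ^+ #|J| * (2 * ((N%:R)^-1 ^+ (5 * 2 ^ j)) : R).
  case: (lerP (\sum_i a b i ^+ 2)) => [aV|_]; last first.
    by rewrite big1// mulr_ge0 ?exprn_ge0// mulr_ge0// exprn_ge0// invr_ge0 ltW.
  apply: (le_trans (sign_tail th0 (divr_gt0 V0 p2) aV)).
  rewrite ler_wpM2l ?exprn_ge0// ler_wpM2l//.
  rewrite -[in leRHS](lnK N1) -expRN -expRM_natl ler_expR mulrN lerN2.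
  rewrite ler_pdivlMr ?mulr_gt0 ?divr_gt0//.
  have -> : (5 * 2 ^ j)%:R * ln N%:R * (4 * (V / 2 ^+ j)) = 20 * V * ln N%:R.
    by rewrite natrM natrX; field; rewrite gt_eqF.
  exact: thV.
apply: (le_trans (ler_sum _ (fun b _ => hb b))).
rewrite sumr_const -[#|_|]/#|B| -[leLHS]mulr_natr -!mulrA.
apply: ler_wpM2l; first by rewrite exprn_ge0.
apply: ler_wpM2l => //.
have i0 : 0 <= (N%:R : R)^-1 by rewrite invr_ge0 ltW.
have i1 : (N%:R : R)^-1 <= 1 by rewrite invf_le1// ler1n (ltn_trans _ N2).
have i2 : (N%:R : R)^-1 <= 2^-1 by rewrite lef_pV2 ?posrE// ler_nat.
have jj : (j <= 2 ^ j)%N by exact/ltnW/ltn_expl.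
have c1 : (#|B|%:R : R) <= N%:R ^+ (3 * 2 ^ j).
  by rewrite -natrX ler_nat (leq_trans cB)// leq_exp2l// (leq_trans _ N2).
apply: (le_trans (ler_wpM2l (exprn_ge0 _ i0) c1)).
have -> : (5 * 2 ^ j = 3 * 2 ^ j + 2 * 2 ^ j)%N by rewrite -mulnDl.
rewrite exprD mulrAC -exprMn mulVf ?gt_eqF// expr1n mul1r.
have h1 : (2 + j <= 2 * 2 ^ j)%N.
  case: (j) => // j'; have := ltn_expl j'.+1 (leqnn 2); lia.
apply: (@le_trans _ _ ((N%:R)^-1 ^+ (2 + j))).
  by rewrite ler_wiXn2l.
rewrite exprD exprVn -(exprVn 2 j); apply: ler_wpM2l.
  by rewrite invr_ge0 exprn_ge0// ltW.
by rewrite lerXn2r// nnegrE invr_ge0.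
Qed.

(** Union bound over all links: if none exceeds th, telescoping leaves at most (L + 1) th. Level 0
    contributes 2 N^-2 and the geometric series over the increments at most 4 N^-2. *)
Lemma chain_tail :
  \sum_eps [exists w, X w && ((L.+1)%:R * th < `|sign_sum eps (tv w)|)]%:R
   <= 2 ^+ #|J| * (6 * N%:R ^- 2) :> R.
Proof.
pose f j := sval (cid (rhoA j)).
pose g j := sval (cid (svalP (cid (rhoA j)))).
have fg j w : (j <= L)%N -> X w -> rho j w = g j (f j w).
  by move=> jL Xw; exact: (svalP (cid (svalP (cid (rhoA j)))) jL w Xw).
pose d0 (b : A 0%N) i := tv (g 0%N b) i.
(* A link depends on two short codes only, which leaves at most N^(2^(j+1) + 2^j) = N^(3 * 2^j) of
   them. *)
pose d j (b : A j.+1 * A j) i := tv (g j.+1 b.1) i - tv (g j b.2) i.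
pose F0 eps := \sum_b ((\sum_i d0 b i ^+ 2 <= V / 2 ^+ 0) && big_at eps (d0 b))%:R : R.
pose F j eps := \sum_b ((\sum_i d j b i ^+ 2 <= V / 2 ^+ j) && big_at eps (d j b))%:R : R.
have F00 eps : 0 <= F0 eps by apply: sumr_ge0.
have Fj0 j eps : 0 <= F j eps by apply: sumr_ge0.
have one_le (I : finType) (Q : pred I) i : Q i -> 1 <= \sum_i (Q i)%:R :> R.
  by move=> Qi; rewrite (bigD1 i)//= Qi lerDl; apply: sumr_ge0.
have step eps : ([exists w, X w && ((L.+1)%:R * th < `|sign_sum eps (tv w)|)]%:R : R)
    <= F0 eps + \sum_(j < L) F j eps.
  case: existsP => [[w /andP[Xw hw]]|_]; last by rewrite addr_ge0// sumr_ge0.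
  have [h0|h0] := boolP (big_at eps (tv (rho 0%N w))).
    rewrite (@le_trans _ _ (F0 eps))// ?lerDl ?sumr_ge0//.
    apply: (one_le _ _ (f 0%N w)).
    rewrite /d0 -fg// h0 andbT expr0 divr1; exact: incr0.
  have [h1|h1] := boolP [exists j : 'I_L, big_at eps (fun i => tv (rho j.+1 w) i - tv (rho j w) i)].
    case/existsP: h1 => j hj.
    rewrite (@le_trans _ _ (F j eps))//; last first.
      rewrite (bigD1 j)//= addrCA lerDl addr_ge0// sumr_ge0//.
    apply: (one_le _ _ (f j.+1 w, f j w)).
    rewrite /d /= -!fg//; last exact: ltnW.
    by rewrite hj andbT; exact: incr.
  exfalso; move: hw; apply/negP; rewrite -leNgt.
  have tel k : (k <= L)%N -> `|sign_sum eps (tv (rho k w))| <= k.+1%:R * th.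
    elim: k => [_|k IH kL]; first by rewrite mul1r leNgt.
    have -> : sign_sum eps (tv (rho k.+1 w)) = sign_sum eps (tv (rho k w)) +
       sign_sum eps (fun i => tv (rho k.+1 w) i - tv (rho k w) i).
      by rewrite sign_sumB addrC subrK.
    rewrite -natr1 mulrDl mul1r; apply: (le_trans (ler_normD _ _)).
    apply: lerD; first exact/IH/ltnW.
    rewrite leNgt; apply/negP => hk; move/negP: h1; apply; apply/existsP.
    by exists (Ordinal kL).
  have -> : sign_sum eps (tv w) = sign_sum eps (tv (rho L w)).
    by apply: eq_bigr => i _; rewrite rhoL.
  exact: tel.
apply: (le_trans (ler_sum _ (fun eps _ => step eps))).
rewrite big_split /= [X in _ + X <= _]exchange_big /=.
have t0 : \sum_eps F0 eps <= 2 ^+ #|J| * (2 * (N%:R ^- 2 / 2 ^+ 0)).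
  by apply: (@level_tail _ _ 0%N 1%N) => //; exact: (cardA (leq0n L)).
have tj (j : 'I_L) : \sum_eps F j eps <= 2 ^+ #|J| * (2 * (N%:R ^- 2 / 2 ^+ j)).
  apply: (@level_tail _ _ j (2 ^ j.+1 + 2 ^ j)); first by rewrite expnS; lia.
  rewrite card_prod expnD leq_mul//; first exact: cardA.
  by apply: cardA; exact: ltnW.
apply: (le_trans (lerD t0 (ler_sum _ (fun j _ => tj j)))).
rewrite -!mulr_sumr -mulrDr ler_wpM2l ?exprn_ge0// expr0 divr1.
have geo k : \sum_(j < k) (2 ^+ j)^-1 = 2 - 2 / 2 ^+ k :> R.
  elim: k => [|k IH]; first by rewrite big_ord0 expr0 divr1 subrr.
  rewrite big_ord_recr IH /= exprS; field.
  by rewrite gt_eqF// exprn_gt0.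
rewrite geo.
have q0 : 0 <= (N%:R : R) ^- 2 by rewrite invr_ge0 exprn_ge0.
have q1 : 0 <= 2 / 2 ^+ L :> R by rewrite divr_ge0// exprn_ge0.
nra.
Qed.

End SignSums.

(** * Circulant measurements and the Fourier transform *)

Section RootsOfUnity.
Variables (R : realType) (m : nat).
Hypothesis m0 : (0 < m)%N.

Definition sqn (w : R[i]) : R := complex.Re w ^+ 2 + complex.Im w ^+ 2.

Lemma sqn_ge0 w : 0 <= sqn w. Proof. by rewrite addr_ge0 ?sqr_ge0. Qed.

Lemma sqnM w1 w2 : sqn (w1 * w2) = sqn w1 * sqn w2.
Proof. by case: w1 w2 => [a b] [a' b']; rewrite /sqn /=; ring. Qed.

Lemma sqnJ w : sqn (conjc w) = sqn w.
Proof. by case: w => [a b]; rewrite /sqn /= sqrrN. Qed.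

Lemma sqnD_le w1 w2 : sqn (w1 + w2) <= 2 * sqn w1 + 2 * sqn w2.
Proof.
case: w1 w2 => [a b] [a' b']; rewrite /sqn /=.
have := sqr_ge0 (a - a'); have := sqr_ge0 (b - b'); nra.
Qed.

Lemma sqnE w : (sqn w)%:C%C = w * conjc w.
Proof. by case: w => [a b]; apply/eqP; rewrite eq_complex /sqn /=; apply/andP; split; apply/eqP; ring. Qed.

Definition zeta (k : nat) : R[i] :=
  Complex (cos (2 * pi * k%:R / m%:R)) (sin (2 * pi * k%:R / m%:R)).

Arguments zeta : simpl never.
Local Arguments conjc : simpl never.

Lemma sqn_zeta k : sqn (zeta k) = 1. Proof. exact: cos2Dsin2. Qed.

Lemma zetaJ k : zeta k * conjc (zeta k) = 1.
Proof. by rewrite -sqnE sqn_zeta. Qed.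

Lemma zetaD a b : zeta (a + b) = zeta a * zeta b.
Proof.
rewrite /zeta natrD mulrDr mulrDl cosD sinD; congr Complex; ring.
Qed.

Lemma zeta0 : zeta 0 = 1.
Proof. by rewrite /zeta mulr0 mul0r cos0 sin0. Qed.

Lemma zetaM a b : zeta (a * b) = zeta a ^+ b.
Proof.
elim: b => [|b IH]; first by rewrite muln0 zeta0 expr0.
by rewrite mulnS zetaD IH exprS.
Qed.

Lemma zetam : zeta m = 1.
Proof.
have m1 : m%:R != 0 :> R by rewrite pnatr_eq0 -lt0n.
rewrite /zeta mulfK// mulr2n mulrDl mul1r -mulr2n cos2pi.
by congr Complex; rewrite mulr2n sinD sinpi mul0r mulr0 addr0.
Qed.

Lemma zeta_modn a b : a = b %[mod m] -> zeta a = zeta b.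
Proof.
have h c : zeta c = zeta (c %% m).
  by rewrite {1}(divn_eq c m) zetaD mulnC zetaM zetam expr1n mul1r.
by move=> ab; rewrite h ab -h.
Qed.

(** With the half angle x strictly between 0 and pi, cos (2 x) = 1 would force sin x = 0. *)
Lemma zeta_neq1 a : (0 < a < m)%N -> zeta a != 1.
Proof.
move=> /andP[a0 am]; apply/eqP => /(congr1 (@complex.Re R)); rewrite /zeta /=.
pose x : R := pi * a%:R / m%:R.
have m1 : 0 < m%:R :> R by rewrite ltr0n.
have -> : 2 * pi * a%:R / m%:R = x + x by rewrite /x; field; rewrite gt_eqF.
have x0 : 0 < sin x.
  apply: sin_gt0_pi; rewrite /x divr_gt0 ?mulr_gt0 ?pi_gt0 ?ltr0n//=.
  by rewrite ltr_pdivrMr// ltr_pM2l ?pi_gt0// ltr_nat.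
have := cos2Dsin2 x; rewrite cosD; have : 0 < sin x * sin x by rewrite mulr_gt0.
move: (sin x) (cos x) => s c; nra.
Qed.

(** Signals shorter than m are implicitly padded by zeros: d = n for the blocks of x and d = m for
    probes and measurements. *)
Definition dft d (f : 'I_d -> R) (om : 'I_m) : R[i] :=
  \sum_t (f t)%:C%C * zeta (om * t).

(** Off-diagonal terms are geometric sums over powers of an m-th root of unity, which differs from 1
    because d <= m keeps the nodes distinct. *)
Lemma parseval d (f : 'I_d -> R) : (d <= m)%N ->
  \sum_om sqn (dft f om) = m%:R * \sum_t f t ^+ 2.
Proof.
move=> dm; apply: (@complexI R).
rewrite rmorph_sum /=.
have E om : (sqn (dft f om))%:C%C =
    \sum_t \sum_t' (f t)%:C%C * (f t')%:C%C * (zeta t * conjc (zeta t')) ^+ om.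
  rewrite sqnE /dft rmorph_sum mulr_suml; apply: eq_bigr => t _.
  rewrite mulr_sumr; apply: eq_bigr => t' _.
  rewrite rmorphM [X in _ * (X * _)]conjc_real !(mulnC om) !zetaM.
  rewrite exprMn (rmorphXn (@conjc R)); set a := conjc _; ring.
under eq_bigr do rewrite E.
rewrite exchange_big rmorphM rmorph_sum mulr_sumr; apply: eq_bigr => t _.
rewrite exchange_big (bigD1 t)//= [X in _ + X = _]big1 ?addr0 => [|t' t't].
  rewrite -mulr_sumr zetaJ; under eq_bigr do rewrite expr1n.
  by rewrite sumr_const card_ord rmorph_nat expr2 rmorphM mulrC.
rewrite -mulr_sumr.
set g := zeta t * _.
have g1 : g - 1 != 0.
  rewrite subr_eq0; apply/eqP => gE.
  have tt' : zeta t = zeta t' by rewrite -[RHS]mul1r -gE /g mulrAC -mulrA zetaJ mulr1.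
  have h (a b : 'I_d) : (a < b)%N -> zeta a != zeta b.
    move=> ab; apply/eqP => e; have : zeta (b - a) != 1.
      by apply: zeta_neq1; rewrite subn_gt0 ab (leq_ltn_trans (leq_subr _ _))// (leq_trans _ dm).
    have : zeta b = zeta (b - a) * zeta a by rewrite -zetaD subnK// ltnW.
    rewrite -e => e2; move/eqP; apply.
    by rewrite -[LHS]mulr1 -(zetaJ a) mulrA -e2 zetaJ.
  have [] := ltngtP t t' => [/h|/h|/val_inj e].
  - by rewrite tt' eqxx.
  - by rewrite tt' eqxx.
  - by rewrite e eqxx in t't.
have gm : g ^+ m = 1.
  by rewrite exprMn -(rmorphXn (@conjc R)) -!zetaM !(mulnC _ m) !zetaM zetam !expr1n rmorph1 mulr1.
suff -> : \sum_(i < m) g ^+ i = 0 by rewrite mulr0.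
apply: (mulfI g1); rewrite mulr0 -subrX1 gm subrr//.
Qed.

End RootsOfUnity.

Lemma sum_pair (V : nmodType) (A B : finType) (F : A * B -> V) :
  \sum_j F j = \sum_i \sum_t F (i, t).
Proof. by rewrite pair_bigA; apply: eq_bigr => -[]. Qed.

Lemma conjcMr (R : realType) (a : R) (w : R[i]) : conjc (a%:C%C * w) = a%:C%C * conjc w.
Proof.
by case: w => b c; apply/eqP; rewrite eq_complex /=; apply/andP; split; apply/eqP; ring.
Qed.

(** * Circulant measurements as convolutions *)

Section Circulant.
Variables (R : realType) (n m p : nat).
Hypotheses (n0 : (0 < n)%N) (nm : (n <= m)%N).
Let m0 : (0 < m)%N := leq_trans n0 nm.
Local Notation K := ('I_p * 'I_n)%type.
Local Notation J := ('I_p * 'I_m)%type.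
Implicit Types (u v : J -> R) (x y : K -> R) (z : 'I_m -> R) (om : 'I_m).

Definition meas u x (r : 'I_m) : R := \sum_(k : K) x k * u (k.1, circ_idx r k.2).

(* The transpose of [meas ^~ x]. *)
Definition back x z (j : J) : R :=
  \sum_(r < m) \sum_(c < n) (circ_idx r c == j.2)%:R * (x (j.1, c) * z r).

(** The map h of the opening comment, linear in u and quadratic in x. *)
Definition corr u x : J -> R := back x (meas u x).

(** Row r pairs the probe at t with x at c when t + c = r + n - 1 modulo m: a cyclic convolution,
    shifted by n - 1. The Fourier identities below rest on this congruence. *)
Lemma circ_idx_mod (r : 'I_m) (c : 'I_n) : (circ_idx r c + c = r + n.-1 %[mod m])%N.
Proof.
rewrite /circ_idx /= modnDml; congr (_ %% _)%N.
by have := ltn_ord c; lia.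
Qed.

Lemma circ_idx_injl (c : 'I_n) : injective (fun r : 'I_m => circ_idx r c).
Proof.
move=> r r' rr'; apply/val_inj.
have := circ_idx_mod r c; rewrite rr' circ_idx_mod => /eqP.
by rewrite eqn_modDr => /eqP; rewrite !modn_small.
Qed.

Lemma circ_idx_injr (r : 'I_m) : injective (@circ_idx n m r).
Proof.
move=> c c' cc'; apply/val_inj.
have := circ_idx_mod r c; rewrite -(circ_idx_mod r c') cc' => /eqP.
by rewrite eqn_modDl => /eqP; rewrite !modn_small// (leq_trans (ltn_ord _) nm).
Qed.

Lemma sum_circ_idx (V : nmodType) (F : 'I_m -> V) (c : 'I_n) :
  \sum_(r < m) F (circ_idx r c) = \sum_(t < m) F t.
Proof. by rewrite [RHS](reindex_inj (@circ_idx_injl c)). Qed.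

Lemma sum_pick (I : finType) (a : I) (F : I -> R) : \sum_i (a == i)%:R * F i = F a.
Proof.
rewrite (bigD1 a)//= eqxx mul1r big1 ?addr0// => i.
by rewrite eq_sym => /negbTE ->; rewrite mul0r.
Qed.

Lemma meas_back v x z : \sum_r z r * meas v x r = \sum_j v j * back x z j.
Proof.
rewrite [RHS]sum_pair.
under [RHS]eq_bigr => i _.
  rewrite (_ : \sum_t _ = \sum_r \sum_c v (i, circ_idx r c) * (x (i, c) * z r)).
    over.
  under eq_bigr do rewrite /back mulr_sumr.
  rewrite exchange_big; apply: eq_bigr => r _.
  under eq_bigr do rewrite mulr_sumr.
  rewrite exchange_big; apply: eq_bigr => c _ /=.
  under eq_bigr do rewrite mulrCA.
  by rewrite (sum_pick (circ_idx r c) (fun t => v (i, t) * (x (i, c) * z r))).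
rewrite exchange_big; apply: eq_bigr => r _ /=.
rewrite /meas mulr_sumr sum_pair /=.
by apply: eq_bigr => i _; apply: eq_bigr => c _; ring.
Qed.

(** The transform of Phi_u x up to a phase, by [dft_meas]. *)
Definition mult u x om : R[i] :=
  \sum_(i < p) dft (fun t => u (i, t)) om * dft (fun c => x (i, c)) om.

Lemma zeta_circ om (r : 'I_m) (c : 'I_n) :
  zeta R m (om * (r + n.-1)) = zeta R m (om * circ_idx r c) * zeta R m (om * c).
Proof.
rewrite -zetaD -mulnDr; apply: (zeta_modn R m0).
by rewrite -modnMmr -(circ_idx_mod r c) modnMmr.
Qed.

Lemma dft_meas u x om :
  \sum_r (meas u x r)%:C%C * zeta R m (om * (r + n.-1)) = mult u x om.
Proof.
transitivity (\sum_r \sum_(k : K) (x k)%:C%C * zeta R m (om * k.2) *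
    ((u (k.1, circ_idx r k.2))%:C%C * zeta R m (om * circ_idx r k.2))).
  apply: eq_bigr => r _; rewrite rmorph_sum mulr_suml; apply: eq_bigr => k _.
  rewrite rmorphM (zeta_circ _ _ k.2); ring.
rewrite exchange_big /=.
under eq_bigr => k _.
  rewrite -mulr_sumr (sum_circ_idx (fun t => (u (k.1, t))%:C%C * zeta R m (om * t))).
  over.
rewrite /mult sum_pair /=.
apply: eq_bigr => i _; rewrite mulrC mulr_suml; apply: eq_bigr => c _.
by rewrite /dft.
Qed.

Lemma dft_shift z om : sqn (\sum_r (z r)%:C%C * zeta R m (om * (r + n.-1))) = sqn (dft z om).
Proof.
have -> : \sum_r (z r)%:C%C * zeta R m (om * (r + n.-1)) = zeta R m (om * n.-1) * dft z om.
  rewrite /dft mulr_sumr; apply: eq_bigr => r _.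
  by rewrite mulnDr zetaD; ring.
by rewrite sqnM sqn_zeta mul1r.
Qed.

Lemma sum_meas u x : \sum_om sqn (mult u x om) = m%:R * \sum_r meas u x r ^+ 2.
Proof.
rewrite -(parseval m0 (meas u x) (leqnn m)); apply: eq_bigr => om _.
by rewrite -dft_meas dft_shift.
Qed.

(** The adjoint of a convolution has the conjugate multiplier. *)
Lemma dft_back x z i om : dft (fun t => back x z (i, t)) om =
  conjc (dft (fun c => x (i, c)) om) * \sum_r (z r)%:C%C * zeta R m (om * (r + n.-1)).
Proof.
rewrite /dft.
transitivity (\sum_r \sum_c (x (i, c))%:C%C * (z r)%:C%C * zeta R m (om * circ_idx r c)).
  under eq_bigr => t _ do rewrite /back rmorph_sum mulr_suml.
  rewrite exchange_big; apply: eq_bigr => r _ /=.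
  under eq_bigr => t _ do rewrite rmorph_sum mulr_suml.
  rewrite exchange_big; apply: eq_bigr => c _ /=.
  rewrite (bigD1 (circ_idx r c))//= eqxx mul1r big1 ?addr0.
    by rewrite rmorphM.
  by move=> t; rewrite eq_sym => /negbTE ->; rewrite mul0r rmorph0 mul0r.
rewrite rmorph_sum mulr_sumr; apply: eq_bigr => r _.
rewrite mulr_suml; apply: eq_bigr => c _.
rewrite [X in _ = X * _]conjcMr.
rewrite (zeta_circ om r c).
transitivity ((x (i, c))%:C%C * (z r)%:C%C * zeta R m (om * circ_idx r c) *
  (zeta R m (om * c) * conjc (zeta R m (om * c)))); last by ring.
by rewrite zetaJ mulr1.
Qed.

Lemma sum_corrB u x y :
  m%:R * \sum_j (corr u x j - corr u y j) ^+ 2 =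
  \sum_om \sum_(i < p) sqn (conjc (dft (fun c => x (i, c)) om) * mult u x om
                          - conjc (dft (fun c => y (i, c)) om) * mult u y om).
Proof.
rewrite sum_pair.
rewrite mulr_sumr exchange_big /=; apply: eq_bigr => i _.
rewrite -(parseval m0 (fun t => corr u x (i, t) - corr u y (i, t)) (leqnn m)).
apply: eq_bigr => om _; congr sqn.
rewrite -!dft_meas -!dft_back /dft -sumrB; apply: eq_bigr => t _.
by rewrite rmorphB mulrBl.
Qed.

End Circulant.

(** Lagrange's identity writes the defect as a sum of squares. *)
Lemma cauchy_schwarz_sum (R : realType) (I : finType) (a b : I -> R) :
  (\sum_i a i * b i) ^+ 2 <= (\sum_i a i ^+ 2) * \sum_i b i ^+ 2.
Proof.
suff : 0 <= 2 * ((\sum_i a i ^+ 2) * (\sum_i b i ^+ 2) - (\sum_i a i * b i) ^+ 2) by lra.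
have -> : 2 * ((\sum_i a i ^+ 2) * (\sum_i b i ^+ 2) - (\sum_i a i * b i) ^+ 2) =
    \sum_i \sum_j (a i * b j - a j * b i) ^+ 2.
  have e i : \sum_j (a i * b j - a j * b i) ^+ 2 = a i ^+ 2 * (\sum_j b j ^+ 2) +
      b i ^+ 2 * (\sum_j a j ^+ 2) - a i * b i * (2 * \sum_j a j * b j).
    by rewrite !mulr_sumr -big_split -sumrB; apply: eq_bigr => j _ /=; ring.
  under [RHS]eq_bigr do rewrite e.
  by rewrite sumrB big_split -!mulr_suml /=; ring.
by apply: sumr_ge0 => i _; apply: sumr_ge0 => j _; exact: sqr_ge0.
Qed.

Lemma sum_unit (V : nmodType) (F : unit -> V) : \sum_i F i = F tt.
Proof. by rewrite (eq_bigl (pred1 tt)) ?big_pred1_eq//; case. Qed.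

Section ComplexParts.
Variable R : realType.

Definition part (b : bool) (w : R[i]) : R := if b then complex.Re w else complex.Im w.

Lemma part_sum b (I : finType) (F : I -> R[i]) : part b (\sum_i F i) = \sum_i part b (F i).
Proof.
apply: (big_morph (part b)); last by case: b.
by case: b => -[a1 a2] [b1 b2].
Qed.

Lemma partZ b (a : R) w : part b (a%:C%C * w) = a * part b w.
Proof. by case: b; case: w => w1 w2 /=; ring. Qed.

Lemma sqn_part w : sqn w = \sum_b part b w ^+ 2.
Proof. by rewrite big_bool. Qed.

Lemma sqn_sumZ (I : finType) (a : I -> R) (w : I -> R[i]) :
  sqn (\sum_i (a i)%:C%C * w i) = \sum_b (\sum_i part b (w i) * a i) ^+ 2.
Proof.
rewrite sqn_part; apply: eq_bigr => b _; rewrite part_sum; congr (_ ^+ 2).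
by apply: eq_bigr => i _; rewrite partZ mulrC.
Qed.

End ComplexParts.

(** * Increments of the correlation map in the Orlicz norm *)

Section Increment.
Variables (R : realType) (n m p : nat).
Hypotheses (n0 : (0 < n)%N) (p0 : (0 < p)%N) (nm : (n <= m)%N).
Local Notation K := ('I_p * 'I_n)%type.
Local Notation J := ('I_p * 'I_m)%type.
Variables (u : J -> R) (T : R).
Hypothesis T0 : 0 < T.
Implicit Types (x y : K -> R) (om : 'I_m).

Let uhat i om := dft (fun t => u (i, t)) om.

Definition excess om : R := \sum_i Num.max 0 (sqn (uhat i om) - T).

(** A common majorant of the |uhat i om|^2 over all blocks i, constant up to a part that is small on
    average over om. *)
Definition kap om : R := T + excess om.

Lemma excess_ge0 om : 0 <= excess om.
Proof. by apply: sumr_ge0 => i _; rewrite le_max lexx. Qed.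

Lemma kap_gt0 om : 0 < kap om.
Proof. by rewrite ltr_pwDl// excess_ge0. Qed.

Lemma uhat_le_kap i om : sqn (uhat i om) <= kap om.
Proof.
rewrite -lerBlDl /excess (bigD1 i)//= ler_wpDr ?le_max ?lexx ?orbT//.
by apply: sumr_ge0 => j _; rewrite le_max lexx.
Qed.

(** One row for the transform of each block of x, and one for the multiplier divided by sqrt (kap
    om). With this normalization basis vectors have energy at most 2 ([cf2]), and the energy
    controls both factors of the correlation. *)
Definition cvec om (o : 'I_p + unit) (k : K) : R[i] :=
  if o is inl i then (if k.1 == i then zeta R m (om * k.2) else 0)
  else ((Num.sqrt (kap om))^-1)%:C%C * (uhat k.1 om * zeta R m (om * k.2)).

Definition cf om (e : ('I_p + unit) * bool) (k : K) : R := part e.2 (cvec om e.1 k).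

Lemma energy_cf x om : energy cf x om =
  \sum_i sqn (dft (fun c => x (i, c)) om) + sqn (mult u x om) / kap om.
Proof.
have h o : \sum_b coord cf om (o, b) x ^+ 2 = sqn (\sum_k (x k)%:C%C * cvec om o k).
  by rewrite sqn_sumZ; apply: eq_bigr.
rewrite /energy sum_pair big_sumType /=; congr (_ + _).
  apply: eq_bigr => i _; rewrite h; congr sqn.
  rewrite sum_pair (bigD1 i)//= [X in _ + X = _]big1 ?addr0.
    by apply: eq_bigr => c _; rewrite /= eqxx.
  move=> j /negbTE ji; apply: big1 => c _.
  by rewrite /= ji mulr0.
rewrite sum_unit.
have k0 : 0 <= kap om := ltW (kap_gt0 om).
rewrite h.
transitivity ((Num.sqrt (kap om))^-1 ^+ 2 * sqn (mult u x om)); last first.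
  by rewrite exprVn sqr_sqrtr// mulrC.
have -> : \sum_k (x k)%:C%C * cvec om (inr tt) k =
    ((Num.sqrt (kap om))^-1)%:C%C * mult u x om.
  rewrite sum_pair /mult mulr_sumr; apply: eq_bigr => i _.
  rewrite /dft !mulr_sumr; apply: eq_bigr => c _.
  by rewrite /cvec /= /uhat /dft; ring.
by rewrite sqnM /sqn /= expr0n addr0.
Qed.

Lemma cf2 om k : \sum_e cf om e k ^+ 2 <= 2.
Proof.
rewrite sum_pair big_sumType /= sum_unit.
have h o : \sum_b cf om (o, b) k ^+ 2 = sqn (cvec om o k) by rewrite sqn_part.
rewrite h; under eq_bigr do rewrite h.
have -> : \sum_(i < p) sqn (cvec om (inl i) k) = 1.
  rewrite (bigD1 k.1)//= big1 ?addr0 => [|i ik].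
    by rewrite eqxx sqn_zeta.
  by rewrite eq_sym (negbTE ik) /sqn /= expr0n addr0.
have k0 : 0 <= kap om := ltW (kap_gt0 om).
rewrite /= !sqnM sqn_zeta mulr1 {1}/sqn /= expr0n addr0 exprVn sqr_sqrtr//.
by rewrite -lerBrDl mulrC ler_pdivrMr ?kap_gt0//; have := uhat_le_kap k.1 om; lra.
Qed.

Lemma energy_le x om : \sum_k x k ^+ 2 <= 1 -> energy cf x om <= 2 * (n * p)%:R.
Proof.
move=> x1; apply: (@le_trans _ _ (\sum_e \sum_k cf om e k ^+ 2)).
  apply: ler_sum => e _; rewrite /coord.
  set a := cf om e.
  have /(_ (fun k => a k) x) : forall a b : K -> R,
      (\sum_k a k * b k) ^+ 2 <= (\sum_k a k ^+ 2) * \sum_k b k ^+ 2.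
    move=> {a} a b; exact: cauchy_schwarz_sum.
  move=> h; apply: (le_trans h); rewrite -[leRHS]mulr1; apply: ler_wpM2l => //.
  by apply: sumr_ge0 => k _; exact: sqr_ge0.
rewrite exchange_big /=; apply: (le_trans (ler_sum _ (fun k _ => cf2 om k))).
by rewrite sumr_const card_prod !card_ord mulnC -[leLHS]mulr_natr.
Qed.

Lemma sum_dft_le om x : \sum_i sqn (dft (fun c => x (i, c)) om) <= energy cf x om.
Proof. by rewrite energy_cf lerDl divr_ge0 ?sqn_ge0// ltW// kap_gt0. Qed.

Lemma mult_le om x : sqn (mult u x om) <= kap om * energy cf x om.
Proof.
rewrite -ler_pdivrMl ?kap_gt0// energy_cf mulrC lerDr.
by apply: sumr_ge0 => i _; exact: sqn_ge0.
Qed.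

Lemma sum_dftE x : \sum_(om < m) \sum_(i < p) sqn (dft (fun c => x (i, c)) om) = m%:R * \sum_k x k ^+ 2.
Proof.
rewrite exchange_big sum_pair mulr_sumr; apply: eq_bigr => i _ /=.
by rewrite parseval// (leq_trans n0 nm).
Qed.

Hypothesis excess_small : 2 * (n * p)%:R * \sum_(om < m) excess om <= m%:R.

Let np1 : 1 <= (n * p)%:R :> R.
Proof. by rewrite ler1n muln_gt0 n0 p0. Qed.

Let weight x y om := sqn (mult u x om) + kap om * \sum_i sqn (dft (fun c => y (i, c)) om).

Let weight_ge0 x y om : 0 <= weight x y om.
Proof.
rewrite addr_ge0 ?sqn_ge0// mulr_ge0 ?(ltW (kap_gt0 _))//.
by apply: sumr_ge0 => i _; exact: sqn_ge0.
Qed.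

(** Leibniz rule: the difference of the two products is split into terms that each contain x - y
    once. *)
Let freq_le x y om :
  \sum_(i < p) sqn (conjc (dft (fun c => x (i, c)) om) * mult u x om
                  - conjc (dft (fun c => y (i, c)) om) * mult u y om)
  <= 2 * (energy cf (fun k => x k - y k) om * weight x y om).
Proof.
have dB i : dft (fun c => x (i, c) - y (i, c)) om =
    dft (fun c => x (i, c)) om - dft (fun c => y (i, c)) om.
  by rewrite /dft -sumrB; apply: eq_bigr => c _; rewrite rmorphB mulrBl.
have mB : mult u (fun k => x k - y k) om = mult u x om - mult u y om.
  by rewrite /mult -sumrB; apply: eq_bigr => i _; rewrite dB mulrBr.
set z := fun k => x k - y k.
have e0 : 0 <= energy cf z om := energy_ge0 _ _ _.
apply: (@le_trans _ _ (\sum_(i < p) (2 * (sqn (dft (fun c => z (i, c)) om) * sqn (mult u x om))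
   + 2 * (sqn (dft (fun c => y (i, c)) om) * sqn (mult u z om))))).
  apply: ler_sum => i _.
  set a := dft (fun c => x (i, c)) om; set b := dft (fun c => y (i, c)) om.
  have -> : conjc a * mult u x om - conjc b * mult u y om =
      conjc (a - b) * mult u x om + conjc b * (mult u x om - mult u y om).
    by rewrite (rmorphB (@conjc R)); ring.
  by apply: (le_trans (sqnD_le _ _)); rewrite !sqnM !sqnJ dB mB.
rewrite big_split /= -!mulr_sumr -!mulr_suml -mulrDr ler_wpM2l// /weight [leRHS]mulrDr.
apply: lerD; first by rewrite ler_wpM2r ?sqn_ge0// sum_dft_le.
rewrite mulrCA [leRHS]mulrA mulrC ler_wpM2r//; last exact: mult_le.
by apply: sumr_ge0 => i _; exact: sqn_ge0.
Qed.

(** The energy A of x - y may be large at a few frequencies. The inequality A <= L (tau + exp (A / L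
    - tau)) separates a bounded part, paid by the total weight, from an exponential part, paid by
    [small] and the crude bound 4 n p kap on the weight. The choice tau = ln (n p) balances the two,
    and no log m arises. *)
Lemma corr_increment x y (lam : R) :
  \sum_k x k ^+ 2 <= 1 -> \sum_k y k ^+ 2 <= 1 -> 0 < lam ->
  small cf kap lam (fun k => x k - y k) ->
  \sum_j (corr u x j - corr u y j) ^+ 2 <=
  2 * lam ^+ 2 * (ln (n * p)%:R * (\sum_r meas u x r ^+ 2 + T + 1) + 8 * (T + 1)).
Proof.
move=> x1 y1 lam0 sm.
have mR : 0 < m%:R :> R by rewrite ltr0n (leq_trans n0 nm).
rewrite -(ler_pM2l mR) (sum_corrB n0 nm).
apply: (le_trans (ler_sum _ (fun om _ => freq_le x y om))).
rewrite -mulr_sumr; set A := energy cf (fun k => x k - y k) in sm *.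
set tau := ln (n * p)%:R; set N : R := (n * p)%:R; set L := lam ^+ 2.
have L0 : 0 < L by rewrite exprn_gt0.
have tau0 : 0 <= tau by rewrite ln_ge0.
have N0 : 0 < N by rewrite (lt_le_trans ltr01).
have etau : expR (- tau) * N = 1 by rewrite expRN lnK ?posrE// mulVf ?gt_eqF.
have kap0 om : 0 <= kap om := ltW (kap_gt0 om).
have AL om : A om <= L * (tau + expR (- tau) * expR (A om / L)).
  rewrite -ler_pdivrMl// mulrC -expRD.
  by have := expR_ge1Dx (- tau + A om / L); lra.
have wN om : weight x y om <= 4 * N * kap om.
  have hx := mult_le om x; have ex := energy_le om x1.
  have hy := sum_dft_le om y; have ey := energy_le om y1.
  have h1 : sqn (mult u x om) <= kap om * (2 * N) by apply: (le_trans hx); rewrite ler_wpM2l.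
  have h2 : kap om * \sum_i sqn (dft (fun c => y (i, c)) om) <= kap om * (2 * N).
    by apply: ler_wpM2l => //; exact: le_trans hy ey.
  by rewrite /weight; lra.
have sx : \sum_(om < m) excess om <= m%:R / (2 * N).
  by rewrite ler_pdivlMr ?mulr_gt0// mulrC.
have sx0 : 0 <= \sum_(om < m) excess om by apply: sumr_ge0 => om _; exact: excess_ge0.
have sk : \sum_om kap om <= m%:R * (T + 1).
  rewrite /kap big_split /= sumr_const card_ord mulrDr mulr1.
  apply: lerD; first by rewrite mulr_natl.
  apply: (le_trans sx); rewrite ler_pdivrMr ?mulr_gt0// ler_peMr ?(ltW mR)//.
  by have := np1; rewrite -/N; lra.
(* Parseval evaluates the main terms; on the excess the crude energy bound 2 n p is enough by
   [excess_small]. *)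
have sw : \sum_om weight x y om <= m%:R * (\sum_r meas u x r ^+ 2 + T + 1).
  rewrite /weight big_split /= (sum_meas n0 nm) -addrA [leRHS]mulrDr lerD2l.
  under eq_bigr do rewrite /kap mulrDl.
  rewrite big_split /= -mulr_sumr sum_dftE mulrDr mulr1.
  apply: lerD.
    by rewrite mulrCA ler_wpM2l ?(ltW mR)// ler_piMr// ltW.
  apply: (@le_trans _ _ (\sum_(om < m) excess om * (2 * N))).
    apply: ler_sum => om _; rewrite ler_wpM2l ?excess_ge0//.
    exact: (le_trans (sum_dft_le om y) (energy_le om y1)).
  by rewrite -mulr_suml mulrC.
have main : \sum_om A om * weight x y om <=
    L * (tau * \sum_om weight x y om + 8 * \sum_om kap om).
  apply: (@le_trans _ _ (\sum_om L * (tau * weight x y om +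
      expR (- tau) * (4 * N) * (kap om * expR (A om / L))))).
    apply: ler_sum => om _.
    apply: (le_trans (ler_wpM2r (weight_ge0 x y om) (AL om))).
    set E := expR (A om / L); set e := expR (- tau).
    have -> : L * (tau + e * E) * weight x y om =
      L * (tau * weight x y om + e * E * weight x y om) by ring.
    apply: ler_wpM2l; first exact: ltW.
    rewrite lerD2l.
    have -> : e * (4 * N) * (kap om * E) = e * E * (4 * N * kap om) by ring.
    by apply: ler_wpM2l => //; rewrite mulr_ge0 ?expR_ge0.
  rewrite -mulr_sumr; apply: ler_wpM2l; first exact: ltW.
  rewrite big_split /= -!mulr_sumr lerD2l.
  have -> : expR (- tau) * (4 * N) = 4 by rewrite mulrCA etau mulr1.
  by have := sm; rewrite /small -/L; set Q := \sum_om _; set Q' := \sum_om _; lra.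
have h1 := ler_wpM2l tau0 sw.
have h2 := ler_wpM2l (ltW L0) (lerD h1 (ler_wpM2l (ler0n R 8) sk)).
have := le_trans main h2; set Q := \sum_om _; set q := \sum_r _ => h.
suff -> : m%:R * (2 * L * (tau * (q + T + 1) + 8 * (T + 1))) =
  2 * (L * (tau * (m%:R * (q + T + 1)) + 8 * (m%:R * (T + 1)))) by rewrite ler_pM2l.
by ring.
Qed.

End Increment.

(** * Chaining for the Rademacher sum with u and v frozen *)

Section SignChaos.
Variables (R : realType) (n m p s L : nat).
Hypotheses (n0 : (0 < n)%N) (p0 : (0 < p)%N) (nm : (n <= m)%N).
Hypotheses (s0 : (0 < s)%N) (snp : (s <= n * p)%N) (Ls : (2 ^ L <= 16 * s ^ 2)%N).
Local Notation K := ('I_p * 'I_n)%type.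
Local Notation J := ('I_p * 'I_m)%type.
Variables (u v : J -> R) (T D : R).
Hypothesis T0 : 0 < T.
Hypothesis excess_small : 2 * (n * p)%:R * \sum_(om < m) excess u T om <= m%:R.
Hypothesis cross_small :
  \sum_(r < m) \sum_(k : K) \sum_(l : K)
    Num.max 0 (m%:R * v (k.1, circ_idx r k.2) ^+ 2 - T) * u (l.1, circ_idx r l.2) ^+ 2
  <= (n * p)%:R^-1.

Definition grid (w : code K L) : K -> R := avg (Num.sqrt s%:R) w.

Definition in_ball (w : code K L) : bool := \sum_k grid w k ^+ 2 <= 1.

Hypothesis D_max : forall w, in_ball w -> \sum_r meas u (grid w) r ^+ 2 <= D.

(** A bound on the squared correlation uniform over the unit ball. It is far from sharp, and serves
    only where v_j exceeds its truncation level, where [cross_small] makes the total negligible. *)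
Let local_energy (j : J) : R :=
  \sum_(r < m) \sum_(c < n) \sum_(l : K)
    (circ_idx r c == j.2)%:R * u (l.1, circ_idx r l.2) ^+ 2.

Lemma corr_sq_le (x : K -> R) j : \sum_k x k ^+ 2 <= 1 ->
  corr u x j ^+ 2 <= local_energy j.
Proof.
move=> x1.
pose F (i : 'I_m * 'I_n * K) : R := (circ_idx i.1.1 i.1.2 == j.2)%:R.
have F2 i : F i ^+ 2 = F i by rewrite /F; case: eqP => _; rewrite ?expr1n// expr0n.
have -> : corr u x j = \sum_(i : 'I_m * 'I_n * K)
    (F i * (x (j.1, i.1.2) * x i.2)) * (F i * u (i.2.1, circ_idx i.1.1 i.2.2)).
  rewrite /corr /back !sum_pair; apply: eq_bigr => r _; apply: eq_bigr => c _.
  rewrite /meas !mulr_sumr; apply: eq_bigr => l _.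
  have -> : (circ_idx r c == j.2)%:R = F (r, c, l) ^+ 2 by rewrite F2.
  by rewrite /=; set f := F _; ring.
apply: (le_trans (cauchy_schwarz_sum _ _)).
rewrite -[leRHS]mul1r; apply: ler_pM.
- by apply: sumr_ge0 => i _; exact: sqr_ge0.
- by apply: sumr_ge0 => i _; exact: sqr_ge0.
- under eq_bigr do rewrite exprMn F2 exprMn.
  rewrite !sum_pair /=.
  have -> : \sum_(r < m) \sum_(c < n) \sum_(t : K)
      F (r, c, t) * (x (j.1, c) ^+ 2 * x t ^+ 2) =
      \sum_(c < n) (\sum_(r < m) (circ_idx r c == j.2)%:R) * x (j.1, c) ^+ 2 * \sum_t x t ^+ 2.
    rewrite exchange_big; apply: eq_bigr => c _; rewrite !mulr_suml; apply: eq_bigr => r _ /=.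
    by rewrite mulr_sumr; apply: eq_bigr => t _; rewrite mulrA.
  apply: (@le_trans _ _ (\sum_(c < n) x (j.1, c) ^+ 2)).
    apply: ler_sum => c _.
    have -> : \sum_(r < m) (circ_idx r c == j.2)%:R = 1 :> R.
      rewrite (sum_circ_idx n0 nm (fun t => (t == j.2)%:R : R)).
      by rewrite (bigD1 j.2)//= eqxx big1 ?addr0// => t /negbTE ->.
    by rewrite mul1r ler_piMr// sqr_ge0.
  apply: le_trans x1; rewrite sum_pair (bigD1 j.1)//= lerDl.
  by apply: sumr_ge0 => i _; apply: sumr_ge0 => c _; exact: sqr_ge0.
- rewrite /local_energy !sum_pair le_eqVlt; apply/orP; left; apply/eqP.
  by do 3! (apply: eq_bigr => ? _); rewrite exprMn F2.
Qed.

Lemma sum_local_energy : \sum_j Num.max 0 (m%:R * v j ^+ 2 - T) * local_energy j =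
  \sum_(r < m) \sum_(k : K) \sum_(l : K)
    Num.max 0 (m%:R * v (k.1, circ_idx r k.2) ^+ 2 - T) * u (l.1, circ_idx r l.2) ^+ 2.
Proof.
rewrite sum_pair.
have e i : \sum_(t < m) Num.max 0 (m%:R * v (i, t) ^+ 2 - T) * local_energy (i, t) =
  \sum_(r < m) \sum_(c < n) \sum_(l : K)
    Num.max 0 (m%:R * v (i, circ_idx r c) ^+ 2 - T) * u (l.1, circ_idx r l.2) ^+ 2.
  under eq_bigr => t _ do rewrite /local_energy mulr_sumr.
  rewrite exchange_big; apply: eq_bigr => r _ /=.
  under eq_bigr => t _ do rewrite mulr_sumr.
  rewrite exchange_big; apply: eq_bigr => c _ /=.
  under eq_bigr => t _ do rewrite mulr_sumr.
  rewrite exchange_big; apply: eq_bigr => l _ /=.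
  under eq_bigr => t _ do rewrite mulrCA.
  by rewrite (sum_pick (circ_idx r c)
    (fun t => Num.max 0 (m%:R * v (i, t) ^+ 2 - T) * u (l.1, circ_idx r l.2) ^+ 2)).
under eq_bigr do rewrite e.
rewrite exchange_big; apply: eq_bigr => r _ /=.
by rewrite sum_pair.
Qed.

Let B : R := ln (n * p)%:R * (D + T + 1) + 8 * (T + 1).

(** 6272 = 2 * (4 * 14)^2 comes from [corr_increment] at radius [4 * lamj]; the summand 64 pays for
    the large entries of v. *)
Definition chaos_var : R := s%:R / m%:R * (6272 * T * B + 64).

Let m0 : 0 < m%:R :> R. Proof. by rewrite ltr0n (leq_trans n0 nm). Qed.
Let np1 : 1 <= (n * p)%:R :> R. Proof. by rewrite ler1n muln_gt0 n0 p0. Qed.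

Lemma masked_increment (x y : K -> R) j : (j <= L)%N ->
  \sum_k x k ^+ 2 <= 1 -> \sum_k y k ^+ 2 <= 1 -> \sum_r meas u x r ^+ 2 <= D ->
  small (cf u T) (kap u T) (4 * lamj (Num.sqrt s%:R) j) (fun k => x k - y k) ->
  \sum_i (v i * corr u x i - v i * corr u y i) ^+ 2 <= chaos_var / 2 ^+ j.
Proof.
move=> jL x1 y1 xD sm.
have s1 : 0 < Num.sqrt s%:R :> R by rewrite sqrtr_gt0 ltr0n.
have inc := corr_increment n0 p0 nm T0 excess_small x1 y1 (mulr_gt0 (ltr0n _ 4) (lamj_gt0 s1 j)) sm.
have lam2 : (4 * lamj (Num.sqrt s%:R) j) ^+ 2 = 3136 * (s%:R / 2 ^+ j) :> R.
  rewrite /lamj !exprMn exprVn -exprM mulnC exprM !sqr_sqrtr//; field.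
  by rewrite gt_eqF// exprn_gt0.
have p2 : 0 < (2 : R) ^+ j by rewrite exprn_gt0.
have ln0 : 0 <= ln (n * p)%:R :> R by rewrite ln_ge0.
have inc' : \sum_i (corr u x i - corr u y i) ^+ 2 <= 6272 * (s%:R / 2 ^+ j) * B.
  apply: (le_trans inc); rewrite lam2.
  have -> : 2 * (3136 * (s%:R / 2 ^+ j)) = 6272 * (s%:R / 2 ^+ j) :> R by ring.
  have q0 : 0 <= s%:R / 2 ^+ j :> R by rewrite divr_ge0// ltW.
  apply: ler_wpM2l; first exact: (mulr_ge0 (ler0n R 6272) q0).
  by rewrite /B lerD2r; apply: ler_wpM2l => //; lra.
have vmax i : m%:R * v i ^+ 2 <= T + Num.max 0 (m%:R * v i ^+ 2 - T).
  by rewrite -lerBlDl le_max lexx orbT.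
rewrite -(ler_pM2l m0) mulr_sumr.
apply: (@le_trans _ _ (\sum_i (T * (corr u x i - corr u y i) ^+ 2 +
   4 * (Num.max 0 (m%:R * v i ^+ 2 - T) * local_energy i)))).
  apply: ler_sum => i _.
  have -> : m%:R * (v i * corr u x i - v i * corr u y i) ^+ 2 =
    m%:R * v i ^+ 2 * (corr u x i - corr u y i) ^+ 2 by ring.
  apply: (le_trans (ler_wpM2r (sqr_ge0 _) (vmax i))).
  rewrite mulrDl lerD2l [leRHS]mulrCA; apply: ler_wpM2l; first by rewrite le_max lexx.
  have := corr_sq_le i x1; have := corr_sq_le i y1.
  set a := corr u x i; set b := corr u y i; have := sqr_ge0 (a + b); nra.
rewrite big_split /= -!mulr_sumr sum_local_energy.
apply: (le_trans (lerD (ler_wpM2l (ltW T0) inc') (ler_wpM2l (ler0n R 4) cross_small))).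
(* From 2^j <= 16 s^2 and s <= n p: the contribution of the large entries is absorbed at every level
   of the chain. *)
have h : 4 * (n * p)%:R^-1 <= 64 * (s%:R / 2 ^+ j) :> R.
  rewrite ler_pdivrMr ?(lt_le_trans ltr01)// mulrAC mulrA ler_pdivlMr//.
  have h1 : (2 : R) ^+ j <= 16 * s%:R ^+ 2.
    by rewrite -!natrX -natrM ler_nat (leq_trans _ Ls)// leq_exp2l.
  have h2 : s%:R <= (n * p)%:R :> R by rewrite ler_nat.
  have h3 : 0 <= s%:R :> R by [].
  nra.
rewrite /chaos_var.
have -> : m%:R * (s%:R / m%:R * (6272 * T * B + 64) / 2 ^+ j) =
  T * (6272 * (s%:R / 2 ^+ j) * B) + 64 * (s%:R / 2 ^+ j).
  by field; rewrite !gt_eqF.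
by rewrite lerD2l.
Qed.

Hypothesis D0 : 0 <= D.

Lemma chaos_var_gt0 : 0 < chaos_var.
Proof.
have l0 : 0 <= ln (n * p)%:R :> R by rewrite ln_ge0.
have B0 : 0 <= B.
  have := T0 => T1; have := D0 => D1.
  by rewrite /B addr_ge0// mulr_ge0//; lra.
have c0 : 0 <= 6272 * T * B.
  exact: (mulr_ge0 (mulr_ge0 (ler0n R 6272) (ltW T0)) B0).
rewrite /chaos_var; apply: mulr_gt0; first by rewrite divr_gt0// ltr0n.
by move: c0; set c := _ * B; lra.
Qed.

(** Chaining with [N] the number of letters, 2 n p + 1, since a code of length 2^j takes at most
    N^(2^j) values. *)
Lemma sign_chaos (th : R) : 0 <= th ->
  20 * chaos_var * ln (2 * (n * p)%:R + 1) <= th ^+ 2 ->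
  \sum_(eps : {ffun J -> bool})
    [exists w, in_ball w &&
      (L.+1%:R * th < `|\sum_j (-1) ^+ eps j * (v j * corr u (grid w) j)|)]%:R
  <= 2 ^+ #|{: J}| * (6 * (2 * (n * p)%:R + 1) ^- 2) :> R.
Proof.
move=> th0 thV.
have s1 : 0 < Num.sqrt s%:R :> R by rewrite sqrtr_gt0 ltr0n.
have cardN : #|{: letter K}| = (2 * (n * p) + 1)%N.
  by rewrite card_option card_prod card_bool card_prod !card_ord addn1 (mulnC p).
have NE : (2 * (n * p) + 1)%:R = 2 * (n * p)%:R + 1 :> R by rewrite natrD natrM.
have kap0 om : 0 <= kap u T om := ltW (kap_gt0 u T0 om).
have [rho [rhoL rhoX rhof rhoS rho0]] := chain_maps kap0 (cf2 u T0) s1 in_ball.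
have c0 i : corr u (fun _ : K => 0) i = 0.
  by rewrite /corr /back big1// => r _; rewrite big1// => c _; rewrite mul0r mulr0.
have z1 : \sum_(k : K) (0 : R) ^+ 2 <= 1 by rewrite big1// => k _; rewrite expr0n.
rewrite -NE; apply: (chain_tail (X := in_ball) (rho := rho) (A := code K)
   (V := chaos_var)) => //.
- by have := muln_gt0 n p; rewrite n0 p0; case: (n * p)%N => // ? _; lia.
- exact: chaos_var_gt0.
- by rewrite NE.
- by move=> j _; rewrite card_ffun card_ord pow2E cardN.
- move=> w Xw i; congr (_ * corr u _ i).
  by apply/funext => k; exact: rhoL.
- move=> j w jL Xw.
  apply: masked_increment; first exact: ltnW.
  + exact: rhoX.
  + exact: rhoX.
  + exact/D_max/rhoX.
  + exact: rhoS.
- move=> w Xw.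
  (* The first link is treated as an increment from the zero vector. *)
  have := @masked_increment (grid (rho 0%N w)) (fun=> 0) 0%N (leq0n L) (rhoX _ _ Xw) z1
    (D_max (rhoX _ _ Xw)).
  rewrite expr0 divr1 => h.
  apply: (le_trans _ (h _)).
    by rewrite le_eqVlt; apply/orP; left; apply/eqP/eq_bigr => i _; rewrite c0 mulr0 subr0.
  have -> : (fun k => grid (rho 0%N w) k - 0) = grid (rho 0%N w).
    by apply/funext => k; rewrite subr0.
  exact: rho0.
Qed.

End SignChaos.

(** * Joint laws and independent copies *)

Section NormalMgf.
Variable R : realType.
Local Notation mu := (@lebesgue_measure R).

Lemma ge0_integral_normal (c sg : R) (f : R -> \bar R) : measurable_fun [set: R] f ->
  (forall x, 0 <= f x)%E ->
  (\int[normal_prob c sg]_x f x = \int[mu]_x (f x * (normal_pdf c sg x)%:E))%E.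
Proof.
move=> mf f0.
have dom := @normal_prob_dominates R c sg.
rewrite -(Radon_Nikodym_SigmaFinite.change_of_variables dom)//.
apply: ae_eq_integral => //.
- apply: emeasurable_funM => //; apply: (measurable_int mu).
  exact: Radon_Nikodym_SigmaFinite.f_integrable.
- apply: emeasurable_funM => //=; apply/measurable_EFinP.
  exact: measurable_normal_pdf.
- apply: ae_eqe_mul2l => /=.
  apply: integral_ae_eq => //=.
  + exact: Radon_Nikodym_SigmaFinite.f_integrable.
  + by apply/measurable_EFinP; exact: measurable_normal_pdf.
  + by move=> E E01 mE; rewrite -Radon_Nikodym_SigmaFinite.f_integral.
Qed.

(** Completing the square turns the integrand into a multiple of the density with mean t sg^2. *)
Lemma normal_mgf (sg t : R) : sg != 0 ->
  (\int[normal_prob 0 sg]_x (expR (t * x))%:E = (expR (t ^+ 2 * sg ^+ 2 / 2))%:E)%E.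
Proof.
move=> sg0.
have mE : measurable_fun [set: R] (fun x : R => (expR (t * x))%:E).
  apply/measurable_EFinP; apply: measurableT_comp => //.
rewrite ge0_integral_normal//.
have e x : ((expR (t * x))%:E * (normal_pdf 0 sg x)%:E)%E =
    ((expR (t ^+ 2 * sg ^+ 2 / 2))%:E * (normal_pdf (t * sg ^+ 2) sg x)%:E)%E.
  rewrite -!EFinM; congr EFin; rewrite /normal_pdf (negbTE sg0) /normal_fun.
  rewrite mulrCA [RHS]mulrCA; congr (_ * _); rewrite -!expRD; congr expR.
  by field.
under eq_integral do rewrite e.
rewrite ge0_integralZl//.
- by rewrite integral_normal_pdf mule1.
- by apply/measurable_EFinP; exact: measurable_normal_pdf.
- by move=> x _; rewrite lee_fin normal_pdf_ge0.
Qed.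

End NormalMgf.

(** * Laws of finite families of random variables *)

Section FunctionSpace.
Variables (R : realType) (J : finType).

(** A named copy of the function type, to carry the sigma-algebra generated by boxes. *)
Definition family := J -> R.
HB.instance Definition _ := gen_eqMixin family.
HB.instance Definition _ := gen_choiceMixin family.
HB.instance Definition _ := isPointed.Build family (fun=> 0).

Definition boxes : set (set family) :=
  [set S | exists B : J -> set R,
     (forall j, measurable (B j : set (measurableTypeR R))) /\ S = [set f : family | forall j, B j (f j)]].

Definition funspace := g_sigma_algebraType boxes.
HB.instance Definition _ := Measurable.on funspace.

Lemma setI_closed_boxes : setI_closed boxes.
Proof.
move=> _ _ [B1 [mB1 ->]] [B2 [mB2 ->]]; exists (fun j => B1 j `&` B2 j); split.
  by move=> j; exact: measurableI.
apply/seteqP; split => [f [h1 h2] j|f h]; first by split.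
by split => j; have [] := h j.
Qed.

Lemma measurable_coord (j : J) : measurable_fun setT (fun f : funspace => f j : measurableTypeR R).
Proof.
move=> _ B mB; rewrite setTI; apply: sub_sigma_algebra.
exists (fun i => if i == j then B else setT); split.
  by move=> i; case: ifP.
apply/seteqP; split => [f Bf i|f /(_ j)]; last by rewrite eqxx.
by case: eqP => // ->.
Qed.

Lemma measurable_box d (T : measurableType d) (X : J -> T -> R) (B : J -> set R) :
  (forall j, measurable_fun setT (X j : T -> measurableTypeR R)) ->
  (forall j, measurable (B j : set (measurableTypeR R))) ->
  measurable [set w | forall j, B j (X j w)].
Proof.
move=> mX mB.
have -> : [set w | forall j, B j (X j w)] = \bigcap_(j in [set: J]) (X j @^-1` B j).
  by apply/seteqP; split => [w h j _|w h j]; [exact: h|exact: h].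
apply: fin_bigcap_measurable => // j _.
by rewrite -[X in measurable X]setTI; exact: mX.
Qed.

Lemma measurable_tofun d (T : measurableType d) (X : J -> T -> R) :
  (forall j, measurable_fun setT (X j : T -> measurableTypeR R)) ->
  measurable_fun setT (fun w => (fun j => X j w) : funspace).
Proof.
move=> mX; apply: (@measurability _ _ T funspace setT _ boxes) => //.
move=> _ [_ [B [mB ->]] <-]; rewrite setTI.
exact: measurable_box.
Qed.

(** Boxes form a pi-system, so image laws that agree on them agree everywhere; integrals follow by
    pushforward. *)
Lemma same_law d1 d2 (T1 : measurableType d1) (T2 : measurableType d2)
    (P1 : probability T1 R) (P2 : probability T2 R) (X1 : J -> T1 -> R) (X2 : J -> T2 -> R) :
  (forall j, measurable_fun setT (X1 j : T1 -> measurableTypeR R)) ->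
  (forall j, measurable_fun setT (X2 j : T2 -> measurableTypeR R)) ->
  (forall B : J -> set R, (forall j, measurable (B j : set (measurableTypeR R))) ->
     P1 [set w | forall j, B j (X1 j w)] = P2 [set w | forall j, B j (X2 j w)]) ->
  (forall S : set funspace, measurable S ->
     P1 [set w | S (fun j => X1 j w)] = P2 [set w | S (fun j => X2 j w)]) /\
  (forall F : funspace -> \bar R, measurable_fun setT F -> (forall f, 0 <= F f)%E ->
     (\int[P1]_w F (fun j => X1 j w) = \int[P2]_w F (fun j => X2 j w))%E).
Proof.
move=> mX1 mX2 law.
have m1 := measurable_tofun mX1; have m2 := measurable_tofun mX2.
pose Y1 : {mfun T1 >-> funspace} := HB.pack (fun w => (fun j => X1 j w) : funspace)
  (isMeasurableFun.Build _ _ _ _ _ m1).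
pose Y2 : {mfun T2 >-> funspace} := HB.pack (fun w => (fun j => X2 j w) : funspace)
  (isMeasurableFun.Build _ _ _ _ _ m2).
have eqm (S : set funspace) : measurable S -> pushforward P1 Y1 S = pushforward P2 Y2 S.
  move=> mS.
  pose Q1 : {measure set funspace -> \bar R} := pushforward P1 Y1.
  pose Q2 : {measure set funspace -> \bar R} := pushforward P2 Y2.
  have c0 : \bigcup_(k in [set: nat]) [set: funspace] = [set: funspace].
    by rewrite bigcup_const//; exists 0%N.
  have g0 (k : nat) : boxes [set: funspace].
    by exists (fun=> setT); split => //; apply/seteqP; split.
  have h := @measure_unique _ R funspace boxes (fun=> setT) erefl setI_closed_boxes g0 c0 (Q1 m1) (Q2 m2).
  apply: (h _ _ S mS).
  - by move=> _ [B [mB ->]]; exact: law.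
  - by move=> _; rewrite /Q1 /= /pushforward preimage_setT probability_setT ltry.
split; first exact: eqm.
move=> F mF F0.
rewrite -[LHS](@ge0_integral_pushforward _ _ _ _ _ _ m1 P1 setT F)//.
rewrite -[RHS](@ge0_integral_pushforward _ _ _ _ _ _ m2 P2 setT F)//.
by apply: eq_measure_integral => S mS _; exact: eqm.
Qed.

End FunctionSpace.

(** * Consequences of independence; exchanging two copies *)

Section Independence.
Context d (T : measurableType d) (R : realType) (P : probability T R).
Variables (J : finType) (phi : J -> T -> R).
Hypothesis mphi : forall j, measurable_fun setT (phi j : T -> measurableTypeR R).
Hypothesis indep : forall B : J -> set R,
  (forall j, measurable (B j : set (measurableTypeR R))) ->
  P [set w | forall j, B j (phi j w)] = (\prod_j P (phi j @^-1` B j))%E.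

Local Notation P2 := (P \x P)%E.

Lemma measurable_phi_preimage j (B : set R) : measurable (B : set (measurableTypeR R)) ->
  measurable (phi j @^-1` B).
Proof. by move=> mB; rewrite -[X in measurable X]setTI; exact: mphi. Qed.

Lemma measurable_fst_fun d1 d2 (T1 : measurableType d1) (T2 : measurableType d2)
    (f : T1 -> R) : measurable_fun setT (f : T1 -> measurableTypeR R) ->
  measurable_fun setT ((fun w => f w.1) : T1 * T2 -> measurableTypeR R).
Proof. by move=> mf; apply: (measurableT_comp mf measurable_fst). Qed.

Lemma measurable_snd_fun d1 d2 (T1 : measurableType d1) (T2 : measurableType d2)
    (f : T2 -> R) : measurable_fun setT (f : T2 -> measurableTypeR R) ->
  measurable_fun setT ((fun w => f w.2) : T1 * T2 -> measurableTypeR R).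
Proof. by move=> mf; apply: (measurableT_comp mf measurable_snd). Qed.

(** Coordinate j0 comes from the first copy, the others from the second. By independence the joint
    law is that of [phi], so Fubini on the square splits off one coordinate at a time. *)
Let split_family j0 (j : J) (w : T * T) : R := if j == j0 then phi j w.1 else phi j w.2.

Let measurable_split j0 j :
  measurable_fun setT (split_family j0 j : T * T -> measurableTypeR R).
Proof.
rewrite /split_family; case: eqP => _.
  exact: (@measurable_fst_fun _ _ T T _ (mphi j)).
exact: (@measurable_snd_fun _ _ T T _ (mphi j)).
Qed.

Let split_law j0 (B : J -> set R) :
  (forall j, measurable (B j : set (measurableTypeR R))) ->
  P [set w | forall j, B j (phi j w)] = P2 [set w | forall j, B j (split_family j0 j w)].
Proof.
move=> mB.
pose B' j := if j == j0 then setT else B j.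
have mB' j : measurable (B' j : set (measurableTypeR R)) by rewrite /B'; case: ifP.
have -> : [set w | forall j, B j (split_family j0 j w)] =
    (phi j0 @^-1` B j0) `*` [set w | forall j, B' j (phi j w)].
  apply/seteqP; split => [[w1 w2] /= h|[w1 w2] /= [h1 h2] j].
    split; first by have := h j0; rewrite /split_family eqxx.
    by move=> j; have := h j; rewrite /split_family /B'; case: eqP.
  by rewrite /split_family; case: eqP => [->//|/eqP jj0]; have := h2 j; rewrite /B' (negbTE jj0).
rewrite product_measure1E; [|exact: measurable_phi_preimage|exact: measurable_box].
transitivity (P (phi j0 @^-1` B j0) * \prod_j P (phi j @^-1` B' j))%E; last first.
  by congr (_ * _)%E; rewrite -(indep mB').
rewrite (indep mB) (bigD1 j0)//= [in RHS](bigD1 j0)//= {1}/B' eqxx preimage_setT.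
rewrite probability_setT mul1e; congr (_ * _)%E.
by apply: eq_bigr => j /negbTE jj0; rewrite /B' jj0.
Qed.

Lemma expectation_prod (f : J -> R -> R) (s : seq J) : uniq s ->
  (forall j, measurable_fun setT (f j)) -> (forall j x, 0 <= f j x) ->
  (\int[P]_w (\prod_(j <- s) f j (phi j w))%:E = \prod_(j <- s) \int[P]_w (f j (phi j w))%:E)%E.
Proof.
move=> us mf f0.
have mfp j : measurable_fun setT (fun w => f j (phi j w)).
  exact: (measurableT_comp (mf j) (mphi j)).
elim: s us => [_|j s IH /=/andP[js us]].
  rewrite big_nil; under eq_integral do rewrite big_nil.
  by rewrite integral_cst//= probability_setT mule1.
have mprod (s' : seq J) : measurable_fun setT (fun w => \prod_(j <- s') f j (phi j w)).
  by apply: measurable_prod => i _; exact: mfp.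
have p0 (s' : seq J) w : 0 <= \prod_(j <- s') f j (phi j w) by apply: prodr_ge0.
pose F (x : funspace R J) : \bar R := (\prod_(i <- j :: s) f i (x i))%:E.
have mF : measurable_fun setT F.
  apply/measurable_EFinP; apply: measurable_prod => i _.
  exact: (measurableT_comp (mf i) (measurable_coord i)).
have F0 x : (0 <= F x)%E by rewrite lee_fin; apply: prodr_ge0.
have [_ law] := same_law mphi (measurable_split j) (split_law j).
rewrite [LHS](law F mF F0).
rewrite (fubini_tonelli1 (fun w => F (fun i => split_family j i w))).
- have e w1 w2 : F (fun i => split_family j i (w1, w2)) =
      ((f j (phi j w1))%:E * (\prod_(i <- s) f i (phi i w2))%:E)%E.
    rewrite /F big_cons -EFinM /split_family eqxx /=; congr (_ * _)%:E.
    apply: eq_big_seq => i si; case: eqP => // ij.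
    by rewrite -ij si in js.
  have inner w1 : fubini_F P (fun w => F (fun i => split_family j i w)) w1 =
      ((f j (phi j w1))%:E * \prod_(i <- s) \int[P]_w (f i (phi i w))%:E)%E.
    rewrite /fubini_F; under eq_integral do rewrite e.
    rewrite ge0_integralZl//; last 3 first.
    + exact/measurable_EFinP.
    + by move=> w _; rewrite lee_fin.
    + by rewrite lee_fin.
    by rewrite IH.
  under eq_integral do rewrite inner.
  rewrite ge0_integralZr//.
  + by rewrite big_cons.
  + exact/measurable_EFinP.
  + by move=> w _; rewrite lee_fin.
  + by apply: prode_ge0 => i _; apply: integral_ge0 => w _; rewrite lee_fin.
- apply: (measurableT_comp mF).
  exact: (measurable_tofun (measurable_split j)).
- by move=> w; exact: F0.
Qed.

Variable s2 : R.
Hypothesis mgf1 : forall j t,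
  (\int[P]_w (expR (t * phi j w))%:E = (expR (t ^+ 2 * s2 / 2))%:E)%E.

Lemma measurable_linear (b : J -> R) : measurable_fun setT (fun w => \sum_j b j * phi j w).
Proof.
by apply: measurable_sum => j; apply: measurable_funM; [exact: measurable_cst|exact: mphi].
Qed.

Lemma mgf (b : J -> R) :
  (\int[P]_w (expR (\sum_j b j * phi j w))%:E = (expR (s2 / 2 * \sum_j b j ^+ 2))%:E)%E.
Proof.
under eq_integral do rewrite expR_sum.
rewrite (@expectation_prod (fun j x => expR (b j * x))) ?index_enum_uniq//.
  under eq_bigr do rewrite mgf1.
  rewrite prodEFin -expR_sum; congr (expR _)%:E.
  by rewrite mulr_sumr; apply: eq_bigr => j _; ring.
by move=> j; apply: measurableT_comp.
Qed.

Lemma measurable_linear2 (a b : J -> R) :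
  measurable_fun setT (fun w : T * T => \sum_j a j * phi j w.1 + \sum_j b j * phi j w.2).
Proof.
apply: measurable_funD.
  exact: (@measurable_fst_fun _ _ T T _ (measurable_linear a)).
exact: (@measurable_snd_fun _ _ T T _ (measurable_linear b)).
Qed.

Lemma mgf2 (a b : J -> R) :
  (\int[P2]_w (expR (\sum_j a j * phi j w.1 + \sum_j b j * phi j w.2))%:E
   = (expR (s2 / 2 * (\sum_j a j ^+ 2 + \sum_j b j ^+ 2)))%:E)%E.
Proof.
rewrite (fubini_tonelli1 (fun w : T * T =>
  (expR (\sum_j a j * phi j w.1 + \sum_j b j * phi j w.2))%:E)); last 2 first.
- by apply/measurable_EFinP; apply: measurableT_comp => //; exact: measurable_linear2.
- by move=> w; rewrite lee_fin expR_ge0.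
have ml (c : J -> R) : measurable_fun setT (fun w => (expR (\sum_j c j * phi j w))%:E).
  by apply/measurable_EFinP; apply: measurableT_comp => //; exact: measurable_linear.
have inner w1 : fubini_F P (fun w : T * T =>
    (expR (\sum_j a j * phi j w.1 + \sum_j b j * phi j w.2))%:E) w1 =
    ((expR (\sum_j a j * phi j w1))%:E * (expR (s2 / 2 * \sum_j b j ^+ 2))%:E)%E.
  rewrite /fubini_F; under eq_integral do rewrite /= expRD EFinM.
  by rewrite ge0_integralZl// mgf.
under eq_integral do rewrite inner.
rewrite ge0_integralZr//.
by rewrite mgf -EFinM -expRD mulrDr.
Qed.

Definition pair_family (x : bool * J) (w : T * T) : R := phi x.2 (if x.1 then w.2 else w.1).

Lemma measurable_pair_family x :
  measurable_fun setT (pair_family x : T * T -> measurableTypeR R).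
Proof.
rewrite /pair_family; case: x => -[] j /=.
  exact: (@measurable_snd_fun _ _ T T _ (mphi j)).
exact: (@measurable_fst_fun _ _ T T _ (mphi j)).
Qed.

Let pair_law (B : bool * J -> set R) :
  (forall x, measurable (B x : set (measurableTypeR R))) ->
  P2 [set w | forall x, B x (pair_family x w)] =
  (\prod_j (P (phi j @^-1` B (false, j)) * P (phi j @^-1` B (true, j))))%E.
Proof.
move=> mB.
have -> : [set w | forall x, B x (pair_family x w)] =
    [set w | forall j, B (false, j) (phi j w)] `*` [set w | forall j, B (true, j) (phi j w)].
  apply/seteqP; split => [[w1 w2] /= h|[w1 w2] /= [h1 h2] [[] j]//].
  by split=> j; [exact: (h (false, j))|exact: (h (true, j))].
rewrite product_measure1E; last 2 first.
  exact: (measurable_box mphi (fun j => mB (false, j))).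
  exact: (measurable_box mphi (fun j => mB (true, j))).
rewrite big_split /=; congr (_ * _)%E.
  by rewrite -(indep (B := fun j => B (false, j))).
by rewrite -(indep (B := fun j => B (true, j))).
Qed.

(** On boxes the joint law of the two copies is a product over j of factors symmetric in the copies,
    so it is unchanged when they are exchanged at any set of indices. *)
Lemma swap_law (eps : J -> bool) :
  (forall S : set (funspace R (bool * J)%type), measurable S ->
    P2 [set w | S (fun x => pair_family x w)] =
    P2 [set w | S (fun x => pair_family (x.1 (+) eps x.2, x.2) w)]) /\
  (forall F : funspace R (bool * J)%type -> \bar R, measurable_fun setT F ->
    (forall f, 0 <= F f)%E ->
    (\int[P2]_w F (fun x => pair_family x w) =
     \int[P2]_w F (fun x => pair_family (x.1 (+) eps x.2, x.2) w))%E).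
Proof.
have m1 := measurable_pair_family.
have m2 (x : bool * J) : measurable_fun setT
  (pair_family (x.1 (+) eps x.2, x.2) : T * T -> measurableTypeR R).
  exact: measurable_pair_family.
have eqB (B : bool * J -> set R) : (forall x, measurable (B x : set (measurableTypeR R))) ->
    P2 [set w | forall x, B x (pair_family x w)] =
    P2 [set w | forall x, B x (pair_family (x.1 (+) eps x.2, x.2) w)].
  move=> mB; rewrite pair_law//.
  have -> : [set w | forall x, B x (pair_family (x.1 (+) eps x.2, x.2) w)] =
    [set w | forall x, B (x.1 (+) eps x.2, x.2) (pair_family x w)].
    apply/seteqP; split => w h [b j] /=.
      by have := h (b (+) eps j, j); rewrite /= addbK.
    by have := h (b (+) eps j, j); rewrite /= addbK.
  rewrite (pair_law (B := fun x => B (x.1 (+) eps x.2, x.2)))//.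
  apply: eq_bigr => j _ /=.
  by case: (eps j) => //=; rewrite muleC.
exact: (same_law m1 m2 eqB).
Qed.

End Independence.

(** * Moments and exponential tails *)

Section SecondMoment.
Import numFieldNormedType.Exports.
Variable R : realType.

Let rest (z : R) : R := expR z + expR (- z) - 2 - z ^+ 2.

(* The power series of [rest] has nonnegative even coefficients and starts at order 4. *)
Lemma cosh_rest (t z : R) : 0 <= t <= 1 -> 0 <= rest (t * z) <= t ^+ 4 * rest z.
Proof.
move=> /andP[t0 t1].
pose f (y : R) i := exp_coeff y i + exp_coeff (- y) i.
have fE y i : f y i = (1 + (-1) ^+ i) * y ^+ i / i`!%:R.
  by rewrite /f /exp_coeff /= [(- y) ^+ i]exprNn; ring.
have f0 y i : 0 <= f y i.
  rewrite fE divr_ge0//; case: (boolP (odd i)) => oi.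
    by rewrite -signr_odd oi expr1 subrr mul0r.
  by rewrite -signr_odd (negbTE oi) mulr_ge0// ?addr_ge0// exprn_even_ge0.
have ser y : (fun N => series (exp_coeff y) (N + 4)%N + series (exp_coeff (- y)) (N + 4)%N
    - 2 - y ^+ 2) @ \oo --> rest y.
  apply: cvgB; last exact: cvg_cst.
  apply: cvgB; last exact: cvg_cst.
  by apply: cvgD; rewrite (cvg_shiftn 4 (series (exp_coeff _))); exact: is_cvg_series_exp_coeff.
have serE y N : series (exp_coeff y) (N + 4)%N + series (exp_coeff (- y)) (N + 4)%N
    - 2 - y ^+ 2 = \sum_(i < N) f y (4 + i)%N.
  have -> : series (exp_coeff y) (N + 4)%N + series (exp_coeff (- y)) (N + 4)%N =
      \sum_(i < 4 + N) f y i.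
    by rewrite /series /= -big_split /= addnC big_mkord.
  rewrite big_split_ord /= !big_ord_recl big_ord0 /= /bump /=.
  have -> : f y 0%N = 2 by rewrite fE expr0 !mulr1 divr1.
  have -> : f y 1%N = 0 by rewrite fE expr1 subrr !mul0r.
  have -> : f y 2%N = y ^+ 2 by rewrite fE sqrrN expr1n (_ : 2`! = 2%N)//; field.
  have -> : f y 3%N = 0 by rewrite fE (_ : (-1) ^+ 3 = -1) ?subrr ?mul0r//; ring.
  by ring.
have sc N : \sum_(i < N) f (t * z) (4 + i)%N <= t ^+ 4 * \sum_(i < N) f z (4 + i)%N.
  rewrite mulr_sumr; apply: ler_sum => i _.
  have -> : f (t * z) (4 + i)%N = t ^+ i * (t ^+ 4 * f z (4 + i)%N).
    by rewrite !fE exprMn (exprD t); ring.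
  by rewrite ler_piMl ?exprn_ile1// mulr_ge0 ?exprn_ge0.
have e y := funext (serE y).
apply/andP; split.
  apply: (ler_cvg_to (@cvg_cst _ (0 : R) _ _ _) (ser (t * z))).
  by apply: nearW => N; rewrite serE; apply: sumr_ge0 => i _; exact: f0.
have tser : (fun N => t ^+ 4 * \sum_(i < N) f z (4 + i)%N) @ \oo --> t ^+ 4 * rest z.
  apply: cvgMr; rewrite -e; exact: ser.
apply: (ler_cvg_to (ser (t * z)) tser).
by apply: nearW => N; rewrite serE; exact: sc.
Qed.

(** No differentiation under the integral: t^2 E[Z^2] + 2 + E[rest (t Z)] = 2 exp (t^2 b / 2), where
    by [cosh_rest] the remainder is nonnegative and of order t^4. Dividing by t^2 and taking t small
    gives both inequalities. *)
Lemma second_moment d (T : measurableType d) (P : probability T R) (Z : T -> R) (b : R) :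
  measurable_fun setT Z -> 0 <= b ->
  (forall t, (\int[P]_w (expR (t * Z w))%:E = (expR (t ^+ 2 * b / 2))%:E)%E) ->
  (\int[P]_w (Z w ^+ 2)%:E = b%:E)%E.
Proof.
move=> mZ b0 mgf.
have mE (t : R) : measurable_fun setT (fun w => (expR (t * Z w))%:E).
  apply/measurable_EFinP; apply: measurableT_comp => //.
  by apply: measurable_funM => //; exact: measurable_cst.
have rest0 z : 0 <= rest z.
  have h01 : 0 <= (1 : R) <= 1 by rewrite ler01 lexx.
  by have /andP[h _] := cosh_rest z h01; rewrite mul1r in h.
have mrest (t : R) : measurable_fun setT (fun w => (rest (t * Z w))%:E).
  apply/measurable_EFinP; rewrite /rest.
  have mt : measurable_fun setT (fun w => t * Z w).
    by apply: measurable_funM => //; exact: measurable_cst.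
  apply: measurable_funB; last exact: measurable_funX.
  apply: measurable_funB; last exact: measurable_cst.
  apply: measurable_funD; first exact: measurableT_comp.
  by apply: measurableT_comp => //; exact: measurableT_comp.
have mZ2 : measurable_fun setT (fun w => (Z w ^+ 2)%:E).
  by apply/measurable_EFinP; exact: measurable_funX.
have id t : ((t ^+ 2)%:E * \int[P]_w (Z w ^+ 2)%:E + (2%:E + \int[P]_w (rest (t * Z w))%:E)
    = (2 * expR (t ^+ 2 * b / 2))%:E)%E.
  rewrite -ge0_integralZl//; last 2 first.
  - by move=> w _; rewrite lee_fin sqr_ge0.
  - by rewrite lee_fin sqr_ge0.
  have m1 : measurable_fun setT (fun w => ((t ^+ 2)%:E * (Z w ^+ 2)%:E)%E).
    by apply: emeasurable_funM => //; exact: measurable_cst.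
  have m2 : measurable_fun setT (fun w => (2%:E + (rest (t * Z w))%:E)%E).
    by apply: emeasurable_funD => //; exact: measurable_cst.
  have p1 w : [set: T] w -> (0 <= (t ^+ 2)%:E * (Z w ^+ 2)%:E)%E.
    by move=> _; rewrite -EFinM lee_fin mulr_ge0 ?sqr_ge0.
  have p2 w : [set: T] w -> (0 <= 2%:E + (rest (t * Z w))%:E)%E.
    by move=> _; rewrite -EFinD lee_fin addr_ge0.
  have p3 w : [set: T] w -> (0 <= (rest (t * Z w))%:E)%E by move=> _; rewrite lee_fin.
  have p4 (w : T) : [set: T] w -> (0 <= (2 : R)%:E)%E by move=> _; rewrite lee_fin.
  have p5 (s : R) w : [set: T] w -> (0 <= (expR (s * Z w))%:E)%E.
    by move=> _; rewrite lee_fin expR_ge0.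
  have -> : (2%:E + \int[P]_w (rest (t * Z w))%:E =
      \int[P]_w (2%:E + (rest (t * Z w))%:E) :> \bar R)%E.
    rewrite (ge0_integralD P measurableT p4 (measurable_cst _) p3 (mrest t)).
    by rewrite integral_cst//= probability_setT mule1.
  rewrite -(ge0_integralD P measurableT p1 m1 p2 m2).
  transitivity (\int[P]_w ((expR (t * Z w))%:E + (expR (- t * Z w))%:E))%E.
    apply: eq_integral => w _; rewrite -EFinM -!EFinD; congr EFin.
    by rewrite /rest mulNr; ring.
  rewrite (ge0_integralD P measurableT (p5 t) (mE t) (p5 (- t)) (mE (- t))).
  by rewrite !mgf sqrrN -EFinD; congr EFin; ring.
have A0 : (0 <= \int[P]_w (Z w ^+ 2)%:E)%E.
  by apply: integral_ge0 => w _; rewrite lee_fin sqr_ge0.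
have C0 t : (0 <= \int[P]_w (rest (t * Z w))%:E)%E.
  by apply: integral_ge0 => w _; rewrite lee_fin.
have Cle t : 0 <= t <= 1 -> (\int[P]_w (rest (t * Z w))%:E <=
    (t ^+ 4)%:E * \int[P]_w (rest (1 * Z w))%:E)%E.
  move=> t01; rewrite -ge0_integralZl//; last 2 first.
  - by move=> w _; rewrite lee_fin.
  - by rewrite lee_fin exprn_ge0//; case/andP: t01.
  apply: ge0_le_integral => //.
  - by move=> w _; rewrite lee_fin.
  - by apply: emeasurable_funM => //; exact: measurable_cst.
  - by move=> w _; rewrite -EFinM lee_fin mul1r; have /andP[] := cosh_rest (Z w) t01.
move: A0 C0 id Cle.
set A := (\int[P]_w (Z w ^+ 2)%:E)%E; set C := fun t => (\int[P]_w (rest (t * Z w))%:E)%E.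
move=> A0 C0 id Cle.
have fin1 := id 1; rewrite expr1n mul1e in fin1.
have Afin : A \is a fin_num.
  rewrite ge0_fin_numE//; apply: (@le_lt_trans _ _ (A + (2%:E + C 1%R))%E).
    rewrite leeDl//; apply: adde_ge0; last exact: C0.
    by rewrite lee_fin.
  by rewrite fin1 ltry.
have Cfin t : C t \is a fin_num.
  have := id t; rewrite -(fineK Afin) -EFinM => h.
  rewrite (ge0_fin_numE (C0 t)); apply: (@le_lt_trans _ _ ((t ^+ 2 * fine A)%R%:E + (2%R%:E + C t))%E).
    rewrite addeA leeDr// -EFinD lee_fin addr_ge0// mulr_ge0 ?sqr_ge0//.
    exact: fine_ge0.
  by rewrite h ltry.
pose a := fine A; pose c t := fine (C t).
have AE : A = a%:E by rewrite fineK.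
have CE t : C t = (c t)%:E by rewrite fineK.
have id' t : t ^+ 2 * a + (2 + c t) = 2 * expR (t ^+ 2 * b / 2).
  have : ((t ^+ 2)%R%:E * A + (2%R%:E + C t) = (2 * expR (t ^+ 2 * b / 2))%R%:E)%E := id t.
  by rewrite AE CE -EFinM -!EFinD => -[].
have cle t : 0 <= t <= 1 -> c t <= t ^+ 4 * c 1.
  move=> /Cle h; have : (C t <= (t ^+ 4)%R%:E * C 1%R)%E by exact: h.
  by rewrite !CE -EFinM lee_fin.
have c0 t : 0 <= c t by have : (0 <= C t)%E := C0 t; rewrite CE lee_fin.
rewrite AE; congr EFin; apply/eqP; rewrite eq_le; apply/andP.
(* [t] small enough for the remainders, of order [t ^ 2], to be negligible. *)
have small_t (e M : R) : 0 < e -> 0 <= M -> exists t, [/\ 0 < t, t <= 1 & t ^+ 2 * M <= e].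
  move=> e0 M0; pose t := Num.min 1 (e / (M + 1)).
  have M1 : 0 < M + 1 by lra.
  have t0 : 0 < t by rewrite /t lt_min ltr01 divr_gt0.
  have t1 : t <= 1 by rewrite /t ge_min lexx.
  exists t; split => //; have tM : t * (M + 1) <= e.
    by rewrite -ler_pdivlMr// /t ge_min lexx orbT.
  nra.
split; apply/ler_addgt0Pr => e e0.
- have e1 : 0 < Num.min 1 e by rewrite lt_min ltr01.
  have [t [t0 t1 tM]] := small_t _ _ e1 (addr_ge0 b0 (sqr_ge0 b)).
  have t2 : 0 < t ^+ 2 by rewrite exprn_gt0.
  have [tM1 tMe] : t ^+ 2 * (b + b ^+ 2) <= 1 /\ t ^+ 2 * (b + b ^+ 2) <= e.
    by move: tM; rewrite le_min => /andP[].
  have b2 := sqr_ge0 b.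
  pose x := t ^+ 2 * b / 2.
  have tb : 0 <= t ^+ 2 * b by rewrite mulr_ge0// ltW.
  have tb2 : 0 <= t ^+ 2 * b ^+ 2 by rewrite mulr_ge0// ltW.
  have x0 : 0 <= x by rewrite /x; lra.
  have x1 : x <= 1 / 2 by rewrite /x; lra.
  (* [exp x <= 1 / (1 - x)], hence [exp x <= 1 + x + 2 x ^ 2]. *)
  have Ex : expR x * (1 - x) <= 1.
    have := ler_wpM2l (expR_ge0 x) (expR_ge1Dx (- x)).
    by rewrite -expRD subrr expR0.
  have E2 : expR x <= 1 + x + 2 * x ^+ 2 by nra.
  have := id' t; have := c0 t; rewrite -/x => h1 h2.
  have h3 : t ^+ 2 * a <= t ^+ 2 * (b + t ^+ 2 * b ^+ 2).
    have -> : t ^+ 2 * (b + t ^+ 2 * b ^+ 2) = 2 * x + 4 * x ^+ 2 by rewrite /x; field.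
    lra.
  by rewrite ler_pM2l// in h3; lra.
- have [t [t0 t1 tM]] := small_t e (c 1) e0 (c0 1).
  have t01 : 0 <= t <= 1 by rewrite ltW.
  have h := id' t; have h2 := cle _ t01.
  have h3 := expR_ge1Dx (t ^+ 2 * b / 2).
  have t2 : 0 < t ^+ 2 by rewrite exprn_gt0.
  rewrite -(ler_pM2l t2) mulrDr.
  have : t ^+ 4 * c 1 <= t ^+ 2 * e.
    by rewrite (exprD t 2 2) -mulrA ler_pM2l.
  lra.
Qed.

End SecondMoment.

Section Events.
Context d (T : measurableType d) (R : realType) (P : probability T R).
Variables (n m p : nat).
Hypotheses (n0 : (0 < n)%N) (p0 : (0 < p)%N) (nm : (n <= m)%N).
Local Notation K := ('I_p * 'I_n)%type.
Local Notation J := ('I_p * 'I_m)%type.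
Variable phi : J -> T -> R.
Hypothesis mphi : forall j, measurable_fun setT (phi j : T -> measurableTypeR R).
Hypothesis indep : forall B : J -> set R,
  (forall j, measurable (B j : set (measurableTypeR R))) ->
  P [set w | forall j, B j (phi j w)] = (\prod_j P (phi j @^-1` B j))%E.
Hypothesis mgf1 : forall j t,
  (\int[P]_w (expR (t * phi j w))%:E = (expR (t ^+ 2 * m%:R^-1 / 2))%:E)%E.

Local Notation P2 := (P \x P)%E.

Definition psum (w : T * T) (j : J) : R := phi j w.1 + phi j w.2.
Definition pdiff (w : T * T) (j : J) : R := phi j w.1 - phi j w.2.

Let m0 : 0 < m%:R :> R. Proof. by rewrite ltr0n (leq_trans n0 nm). Qed.

Definition elin (a b : J -> R) (w : T * T) : R :=
  \sum_j a j * psum w j + \sum_j b j * pdiff w j.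

Lemma elinE a b w : elin a b w =
  \sum_j (a j + b j) * phi j w.1 + \sum_j (a j - b j) * phi j w.2.
Proof.
rewrite /elin -!big_split; apply: eq_bigr => j _ /=.
by rewrite /psum /pdiff; ring.
Qed.

Lemma measurable_elin a b : measurable_fun setT (elin a b).
Proof.
have -> : elin a b = (fun w => \sum_j (a j + b j) * phi j w.1 + \sum_j (a j - b j) * phi j w.2).
  by apply/funext => w; rewrite elinE.
exact: measurable_linear2.
Qed.

(** Since (a + b)^2 + (a - b)^2 = 2 a^2 + 2 b^2, sums and differences of the copies act as two
    independent families of variance 2 / m. *)
Lemma mgf_elin a b : (\int[P2]_w (expR (elin a b w))%:E =
  (expR (m%:R^-1 * (\sum_j a j ^+ 2 + \sum_j b j ^+ 2)))%:E)%E.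
Proof.
under eq_integral do rewrite elinE.
have mi : 0 <= m%:R^-1 :> R by rewrite invr_ge0 ltW.
rewrite (mgf2 mphi indep mgf1); congr (expR _)%:E.
rewrite -mulrA; congr (_ * _).
by rewrite -!big_split mulr_sumr; apply: eq_bigr => j _ /=; field.
Qed.

(** Both quantities of the good event are dominated by sums of this form, so exponential moments of
    linear forms suffice. *)
Lemma exp_markov (I : finType) (c : I -> R) (a b : I -> J -> R) (t kappa : R) :
  0 < t -> (forall i, 0 <= c i) ->
  (forall i, c i * expR (m%:R^-1 * (\sum_j a i j ^+ 2 + \sum_j b i j ^+ 2)) <= kappa) ->
  measurable [set w | t < \sum_i c i * expR (elin (a i) (b i) w)] /\
  (P2 [set w | (t < \sum_i c i * expR (elin (a i) (b i) w))%R] <= (#|I|%:R * kappa / t)%:E)%E.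
Proof.
move=> t0 c0 ck.
pose G w := \sum_i c i * expR (elin (a i) (b i) w).
have mexp i : measurable_fun setT (fun w => c i * expR (elin (a i) (b i) w)).
  apply: measurable_funM; first exact: measurable_cst.
  by apply: measurableT_comp => //; exact: measurable_elin.
have mG : measurable_fun setT G by apply: measurable_sum.
have mS : measurable [set w | t < G w].
  rewrite -[X in measurable X]setTI (_ : [set w | t < G w] = G @^-1` `]t, +oo[).
    by apply: mG => //; exact: measurable_itv.
  by apply/seteqP; split => w /=; rewrite in_itv/= andbT.
split; first exact: mS.
have G0 w : 0 <= G w by apply: sumr_ge0 => i _; rewrite mulr_ge0 ?expR_ge0.
have intG : (\int[P2]_w (G w)%:E <= (#|I|%:R * kappa)%:E)%E.
  under eq_integral do rewrite /G -sumEFin.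
  rewrite ge0_integral_sum//; last 2 first.
  - by move=> i; apply/measurable_EFinP; exact: mexp.
  - by move=> i w _; rewrite lee_fin mulr_ge0 ?expR_ge0.
  have -> : (#|I|%:R * kappa = \sum_(i : I) kappa)%R by rewrite sumr_const mulr_natl.
  rewrite -sumEFin; apply: lee_sum => i _.
  under eq_integral do rewrite EFinM.
  rewrite ge0_integralZl//.
  - by rewrite mgf_elin -EFinM lee_fin.
  - by apply/measurable_EFinP; apply: measurableT_comp => //; exact: measurable_elin.
  - by rewrite lee_fin.
suff h : (P2 [set w | (t < G w)%R] * t%:E <= (#|I|%:R * kappa)%:E)%E.
  have qE : P2 [set w | t < G w] = (fine (P2 [set w | t < G w]))%:E.
    rewrite fineK//; pose PP : probability (T * T)%type R := P2.
    exact: (@fin_num_measure _ _ _ PP _ mS).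
  by move: h; rewrite qE -EFinM !lee_fin ler_pdivlMr.
apply: le_trans intG.
rewrite muleC -[X in (_ * P2 X)%E]setIT -integral_indic//.
rewrite -ge0_integralZl//; last 2 first.
- by apply/measurable_EFinP; exact: measurable_indic.
- by rewrite lee_fin ltW.
apply: ge0_le_integral => //.
- by move=> w _; rewrite -EFinM lee_fin mulr_ge0// ltW.
- apply: emeasurable_funM; first exact: measurable_cst.
  by apply/measurable_EFinP; exact: measurable_indic.
- by apply/measurable_EFinP.
- move=> w _; rewrite -EFinM lee_fin indicE.
  by have [|_] := boolP (w \in _); rewrite ?mulr0// inE mulr1 => /ltW.
Qed.

End Events.

(** * Truncated squares dominated by exponentials *)

Section Truncation.
Variable R : realType.

(** Beyond r write t = r (1 + y): then (1 + y)^2 <= exp (2 y) <= exp (th r y). *)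
Lemma trunc_exp (r th t : R) : 0 < r -> 2 <= th * r ->
  Num.max 0 (t ^+ 2 - r ^+ 2) <=
  \sum_(b : bool) r ^+ 2 * expR (- (th * r)) * expR ((-1) ^+ b * (th * t)).
Proof.
move=> r0 thr; rewrite big_bool /= expr1 expr0 mulN1r mul1r.
wlog t0 : t / 0 <= t.
  move=> h; have [/h//|t0] := lerP 0 t.
  have t1 : 0 <= - t by lra.
  by have := h _ t1; rewrite sqrrN mulrN opprK addrC.
have c0 : 0 <= r ^+ 2 * expR (- (th * r)) by rewrite mulr_ge0 ?sqr_ge0 ?expR_ge0.
rewrite ge_max; apply/andP; split; first by rewrite addr_ge0// mulr_ge0 ?expR_ge0.
apply: (@le_trans _ _ (r ^+ 2 * expR (- (th * r)) * expR (th * t))); last first.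
  by rewrite lerDr mulr_ge0 ?expR_ge0.
have [tr|tr] := lerP t r.
  apply: (@le_trans _ _ 0); last by rewrite mulr_ge0 ?expR_ge0.
  by rewrite subr_le0 lerXn2r ?nnegrE// ltW.
apply: (@le_trans _ _ (t ^+ 2)); first by rewrite gerBl sqr_ge0.
rewrite -mulrA -expRD.
pose y := t / r - 1.
have y0 : 0 <= y by rewrite /y subr_ge0 ler_pdivlMr// mul1r ltW.
have tE : t = r * (1 + y) by rewrite /y; field; rewrite gt_eqF.
have e1 : 1 + y <= expR y := expR_ge1Dx y.
have e2 : (1 + y) ^+ 2 <= expR (2 * y).
  have -> : expR (2 * y) = expR y ^+ 2 by rewrite expr2 -expRD; congr expR; ring.
  by rewrite lerXn2r ?nnegrE ?expR_ge0// addr_ge0.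
rewrite {1}tE exprMn ler_wpM2l ?sqr_ge0//; apply: (le_trans e2).
rewrite ler_expR; have -> : - (th * r) + th * t = (th * r) * y by rewrite tE; ring.
by rewrite ler_wpM2r.
Qed.

(** The truncation 2 r^2 is shared between the real and the imaginary part. *)
Lemma trunc_sqn (w : R[i]) (r : R) :
  Num.max 0 (sqn w - 2 * r ^+ 2) <= \sum_b Num.max 0 (part b w ^+ 2 - r ^+ 2).
Proof.
rewrite ge_max; apply/andP; split; first by apply: sumr_ge0 => b _; rewrite le_max lexx.
rewrite sqn_part !big_bool /=.
have h (x : R) : x <= Num.max 0 x by rewrite le_max lexx orbT.
by have := h (complex.Re w ^+ 2 - r ^+ 2); have := h (complex.Im w ^+ 2 - r ^+ 2); lra.
Qed.

Lemma sqr_le_exp (y : R) : y ^+ 2 <= \sum_(b : bool) expR ((-1) ^+ b * y).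
Proof.
rewrite big_bool /= expr1 expr0 mulN1r mul1r.
have h01 : 0 <= (1 : R) <= 1 by rewrite ler01 lexx.
by have /andP[+ _] := cosh_rest y h01; rewrite mul1r; lra.
Qed.

End Truncation.

Section GoodEvent.
Context d (T : measurableType d) (R : realType) (P : probability T R).
Variables (n m p : nat).
Hypotheses (n0 : (0 < n)%N) (p0 : (0 < p)%N) (nm : (n <= m)%N).
Local Notation K := ('I_p * 'I_n)%type.
Local Notation J := ('I_p * 'I_m)%type.
Variable phi : J -> T -> R.
Hypothesis mphi : forall j, measurable_fun setT (phi j : T -> measurableTypeR R).
Hypothesis indep : forall B : J -> set R,
  (forall j, measurable (B j : set (measurableTypeR R))) ->
  P [set w | forall j, B j (phi j w)] = (\prod_j P (phi j @^-1` B j))%E.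
Hypothesis mgf1 : forall j t,
  (\int[P]_w (expR (t * phi j w))%:E = (expR (t ^+ 2 * m%:R^-1 / 2))%:E)%E.

Local Notation P2 := (P \x P)%E.
Local Notation psum := (psum phi).
Local Notation pdiff := (pdiff phi).

Let m0 : 0 < m%:R :> R. Proof. by rewrite ltr0n (leq_trans n0 nm). Qed.

Variable th : R.
Hypothesis th0 : 0 < th.
Hypothesis th2 : 2 <= th * (10 * th).
(** Integration costs exp (th^2) and the truncation gains exp (- th r) = exp (- 10 th^2). With th^2
    = ln (n p), as chosen later, (n p)^-9 is left. *)
Let r := 10 * th.
Let r0 : 0 < r. Proof. by rewrite mulr_gt0. Qed.

Let scale : R := r ^+ 2 * expR (- (th * r)).
Let scale0 : 0 <= scale. Proof. by rewrite mulr_ge0 ?sqr_ge0 ?expR_ge0. Qed.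

(** Frequency, block, real or imaginary part, and sign. *)
Let IA : finType := ('I_m * 'I_p * bool * bool)%type.
Let aA (x : IA) (j : J) : R :=
  (-1) ^+ x.2 * (th * (if j.1 == x.1.1.2 then part x.1.2 (zeta R m (x.1.1.1 * j.2)) else 0)).

(** Row, index for v, index for u, then the signs for v and for u. *)
Let IC : finType := ('I_m * K * K * bool * bool)%type.
Let aC (x : IC) (j : J) : R :=
  (-1) ^+ x.2 * (Num.sqrt m%:R * (j == (x.1.1.2.1, circ_idx x.1.1.1.1 x.1.1.2.2))%:R).
Let bC (x : IC) (j : J) : R :=
  (-1) ^+ x.1.2 * (th * (Num.sqrt m%:R * (j == (x.1.1.1.2.1, circ_idx x.1.1.1.1 x.1.1.1.2.2))%:R)).

Let excess_le w : \sum_(om < m) excess (psum w) (2 * r ^+ 2) om <=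
  \sum_(x : IA) scale * expR (elin phi (aA x) (fun=> 0) w).
Proof.
rewrite /IA 3!sum_pair; apply: ler_sum => om _; apply: ler_sum => i _.
apply: (le_trans (trunc_sqn _ _)); apply: ler_sum => b _.
apply: (le_trans (trunc_exp _ r0 th2)).
rewrite le_eqVlt; apply/orP; left; apply/eqP; apply: eq_bigr => s _.
congr (_ * expR _); rewrite /elin [X in _ = _ + X]big1 ?addr0 => [|j _]; last by rewrite mul0r.
rewrite part_sum sum_pair (bigD1 i)//= [X in _ = _ + X]big1 ?addr0 => [|j /negbTE ji]; last first.
  by apply: big1 => t _; rewrite /aA /= ji !mulr0 mul0r.
rewrite !mulr_sumr; apply: eq_bigr => t _.
by rewrite /aA /= eqxx partZ; ring.
Qed.

Let pick_sum (x : J) (f : J -> R) (a : R) : \sum_j (a * (j == x)%:R) * f j = a * f x.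
Proof.
rewrite (bigD1 x)//= eqxx mulr1 big1 ?addr0// => j /negbTE ->.
by rewrite mulr0 mul0r.
Qed.

Let cross_le w : \sum_(q < m) \sum_(k : K) \sum_(l : K)
    Num.max 0 (m%:R * pdiff w (k.1, circ_idx q k.2) ^+ 2 - 2 * r ^+ 2) *
    psum w (l.1, circ_idx q l.2) ^+ 2 <=
  \sum_(x : IC) (scale / m%:R) * expR (elin phi (aC x) (bC x) w).
Proof.
rewrite /IC; do 4 rewrite sum_pair; apply: ler_sum => q _; apply: ler_sum => k _; apply: ler_sum => l _.
set v := pdiff w _; set u := psum w _.
have sm : Num.sqrt m%:R ^+ 2 = m%:R :> R by rewrite sqr_sqrtr// ltW.
have h1 : Num.max 0 (m%:R * v ^+ 2 - 2 * r ^+ 2) <=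
    \sum_(b : bool) scale * expR ((-1) ^+ b * (th * (Num.sqrt m%:R * v))).
  apply: (le_trans _ (trunc_exp _ r0 th2)).
  rewrite [(_ * v) ^+ 2]exprMn sm ge_max le_max lexx /= le_max; apply/orP; right.
  by have := sqr_ge0 r; lra.
have h2 : u ^+ 2 <= m%:R^-1 * \sum_(b : bool) expR ((-1) ^+ b * (Num.sqrt m%:R * u)).
  rewrite ler_pdivlMl//.
  have -> : m%:R * u ^+ 2 = (Num.sqrt m%:R * u) ^+ 2 by rewrite exprMn sm.
  exact: sqr_le_exp.
have M0 : 0 <= Num.max 0 (m%:R * v ^+ 2 - 2 * r ^+ 2) by rewrite le_max lexx.
apply: (le_trans (ler_pM M0 (sqr_ge0 u) h1 h2)).
rewrite le_eqVlt; apply/orP; left; apply/eqP.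
rewrite mulr_suml; apply: eq_bigr => b1 _; rewrite !mulr_sumr; apply: eq_bigr => b2 _.
have -> : elin phi (aC (q, k, l, b1, b2)) (bC (q, k, l, b1, b2)) w =
    (-1) ^+ b2 * (Num.sqrt m%:R * u) + (-1) ^+ b1 * (th * (Num.sqrt m%:R * v)).
  rewrite /elin /aC /bC /=.
  under eq_bigr do rewrite mulrA.
  under [X in _ + X]eq_bigr do rewrite !mulrA.
  by rewrite !pick_sum /u /v -!mulrA.
by rewrite expRD; ring.
Qed.

Let part_le b (k : nat) : part b (zeta R m k) ^+ 2 <= 1.
Proof.
rewrite -(sqn_zeta R m k) /sqn; case: b => /=.
  by rewrite lerDl sqr_ge0.
by rewrite lerDr sqr_ge0.
Qed.

(** The 4 m p exponentials indexed by [IA] are compared with a threshold proportional to m; for [tC]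
    it is the factor 1 / m in [cross_le] that cancels the number of rows. *)
Let tA : R := m%:R / (2 * (n * p)%:R).
Let tC : R := (n * p)%:R^-1.

Lemma good_event : exists H : set (T * T), [/\ measurable H,
  (P2 (~` H) <= (8 * p%:R * (n * p)%:R * (r ^+ 2 * expR (- (9 * th ^+ 2))) +
     4 * (n * p)%:R ^+ 3 * (r ^+ 2 * expR (1 - 9 * th ^+ 2)))%:E)%E &
  forall w, H w ->
    2 * (n * p)%:R * (\sum_(om < m) excess (psum w) (2 * r ^+ 2) om) <= m%:R /\
    \sum_(q < m) \sum_(k : K) \sum_(l : K)
      Num.max 0 (m%:R * pdiff w (k.1, circ_idx q k.2) ^+ 2 - 2 * r ^+ 2) *
      psum w (l.1, circ_idx q l.2) ^+ 2 <= (n * p)%:R^-1].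
Proof.
have np0 : 0 < (n * p)%:R :> R by rewrite ltr0n muln_gt0 n0 p0.
have tA0 : 0 < tA by rewrite divr_gt0// mulr_gt0.
have tC0 : 0 < tC by rewrite invr_gt0.
have sA x : \sum_j aA x j ^+ 2 <= th ^+ 2 * m%:R.
  apply: (@le_trans _ _ (\sum_(i < p) \sum_(t < m) (if i == x.1.1.2 then th ^+ 2 else 0))).
    rewrite sum_pair; apply: ler_sum => i _; apply: ler_sum => t _.
    rewrite /aA /= exprMn sqrr_sign mul1r exprMn; case: eqP => _; last by rewrite expr0n mulr0.
    by rewrite ler_piMr ?sqr_ge0.
  rewrite (bigD1 x.1.1.2)//= eqxx [X in _ + X <= _]big1 ?addr0 => [|i /negbTE ->]; last first.
    by rewrite big1.
  by rewrite sumr_const card_ord mulr_natr.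
have kA x : scale * expR (m%:R^-1 * (\sum_j aA x j ^+ 2 + \sum_(j : J) (0 : R) ^+ 2)) <=
    r ^+ 2 * expR (- (9 * th ^+ 2)).
  rewrite [X in _ + X]big1 ?addr0 => [|j _]; last by rewrite expr0n.
  rewrite /scale -mulrA ler_wpM2l ?sqr_ge0// -expRD ler_expR.
  have : m%:R^-1 * (\sum_j aA x j ^+ 2) <= th ^+ 2 by rewrite ler_pdivrMl// mulrC.
  by rewrite /r; lra.
have [mA pA] := exp_markov n0 nm mphi indep mgf1 tA0 (fun _ : IA => scale0) kA.
have sm : Num.sqrt m%:R ^+ 2 = m%:R :> R by rewrite sqr_sqrtr// ltW.
have d1 (x : J) : \sum_j ((j == x)%:R : R) ^+ 2 = 1.
  by rewrite (bigD1 x)//= eqxx expr1n big1 ?addr0// => j /negbTE ->; rewrite expr0n.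
have kC x : scale / m%:R * expR (m%:R^-1 * (\sum_j aC x j ^+ 2 + \sum_j bC x j ^+ 2)) <=
    r ^+ 2 * expR (1 - 9 * th ^+ 2) / m%:R.
  have -> : \sum_j aC x j ^+ 2 = m%:R.
    under eq_bigr do rewrite exprMn sqrr_sign mul1r exprMn sm.
    by rewrite -mulr_sumr d1 mulr1.
  have -> : \sum_j bC x j ^+ 2 = th ^+ 2 * m%:R.
    under eq_bigr do rewrite exprMn sqrr_sign mul1r exprMn exprMn sm mulrA.
    by rewrite -mulr_sumr d1 mulr1.
  have -> : m%:R^-1 * (m%:R + th ^+ 2 * m%:R) = 1 + th ^+ 2 by field; rewrite gt_eqF.
  rewrite [leLHS]mulrAC; apply: ler_wpM2r; first by rewrite invr_ge0 ltW.
  rewrite /scale -[leLHS]mulrA; apply: ler_wpM2l; first exact: sqr_ge0.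
  by rewrite -expRD ler_expR /r; lra.
have sC0 : 0 <= scale / m%:R by rewrite divr_ge0// ltW.
have [mC pC] := exp_markov n0 nm mphi indep mgf1 tC0 (fun _ : IC => sC0) kC.
set SA := [set w | tA < _] in mA pA; set SC := [set w | tC < _] in mC pC.
exists (~` (SA `|` SC)); split.
- by apply: measurableC; exact: measurableU.
- rewrite setCK; apply: (le_trans (measureU2 _ mA mC)).
  apply: (le_trans (leeD pA pC)); rewrite -EFinD lee_fin.
  rewrite /IA /IC !card_prod !card_ord !card_bool.
  rewrite le_eqVlt; apply/orP; left; apply/eqP.
  have nz : n%:R != 0 :> R by rewrite pnatr_eq0 -lt0n.
  have pz : p%:R != 0 :> R by rewrite pnatr_eq0 -lt0n.
  have mz : m%:R != 0 :> R by rewrite gt_eqF.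
  by rewrite /tA /tC !natrM; field; rewrite ?nz ?pz ?mz.
- move=> w; rewrite setCU => -[/negP hA /negP hC]; rewrite -leNgt in hA; rewrite -leNgt in hC.
  split; last exact: (le_trans (cross_le w) hC).
  rewrite mulrC -ler_pdivlMr ?mulr_gt0//; exact: (le_trans (excess_le w) hA).
Qed.

End GoodEvent.

(** * Symmetrization *)

Section MeasurableFinite.
Context d (T : measurableType d) (I : finType) (A : I -> T -> bool).
Hypothesis mA : forall i, measurable [set w | A i w].

Lemma measurable_exists : measurable [set w | [exists i, A i w]].
Proof.
have -> : [set w | [exists i, A i w]] = \bigcup_(i in [set: I]) [set w | A i w].
  apply/seteqP; split => [w /= /existsP[i Ai]|w [i _ Ai]]; first by exists i.
  by apply/existsP; exists i.
exact: fin_bigcup_measurable.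
Qed.

Lemma measurable_forall : measurable [set w | [forall i, A i w]].
Proof.
have -> : [set w | [forall i, A i w]] = \bigcap_(i in [set: I]) [set w | A i w].
  apply/seteqP; split => [w /= /forallP Ai i _|w Ai]; first exact: Ai.
  by apply/forallP => i; exact: Ai.
exact: fin_bigcap_measurable.
Qed.

End MeasurableFinite.

Section MeasurableCond.
Context d (T : measurableType d).

Lemma measurable_andb_cond (b : bool) (A : T -> bool) :
  measurable [set w | A w] -> measurable [set w | b && A w].
Proof. by case: b => //= _; rewrite (_ : [set _ | _] = set0)//; apply/seteqP; split. Qed.

Lemma measurable_implyb_cond (b : bool) (A : T -> bool) :
  measurable [set w | A w] -> measurable [set w | b ==> A w].
Proof. by case: b => //= _; rewrite (_ : [set _ | _] = setT)//; apply/seteqP; split. Qed.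

Lemma measurable_set_lt (R : realType) (f g : T -> R) :
  measurable_fun setT f -> measurable_fun setT g -> measurable [set w | f w < g w].
Proof.
move=> mf mg.
rewrite -[X in measurable X]setTI (_ : [set w | f w < g w] = (fun w => g w - f w) @^-1` `]0, +oo[).
  by apply: measurable_funB => //; exact: measurable_itv.
by apply/seteqP; split => w /=; rewrite in_itv/= andbT subr_gt0.
Qed.

End MeasurableCond.

(** * From sign patterns to the two independent copies *)

Section ChaosProb.
Context d (T : measurableType d) (R : realType) (P : probability T R).
Variables (n m p s L : nat).
Hypotheses (n0 : (0 < n)%N) (p0 : (0 < p)%N) (nm : (n <= m)%N).
Hypotheses (s0 : (0 < s)%N) (snp : (s <= n * p)%N) (Ls : (2 ^ L <= 16 * s ^ 2)%N).
Local Notation K := ('I_p * 'I_n)%type.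
Local Notation J := ('I_p * 'I_m)%type.
Variable phi : J -> T -> R.
Hypothesis mphi : forall j, measurable_fun setT (phi j : T -> measurableTypeR R).
Hypothesis indep : forall B : J -> set R,
  (forall j, measurable (B j : set (measurableTypeR R))) ->
  P [set w | forall j, B j (phi j w)] = (\prod_j P (phi j @^-1` B j))%E.
Hypothesis mgf1 : forall j t,
  (\int[P]_w (expR (t * phi j w))%:E = (expR (t ^+ 2 * m%:R^-1 / 2))%:E)%E.

Local Notation P2 := (P \x P)%E.

Definition quad (g : J -> R) (x : K -> R) : R := \sum_(r < m) meas g x r ^+ 2.

Variable th : R.
Hypothesis th0 : 0 < th.
Hypothesis th2 : 2 <= th * (10 * th).
Let T1 : R := 2 * (10 * th) ^+ 2.

(** The square of the deviation in [sign_chaos], at the smallest admissible threshold. *)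
Definition level (D : R) : R :=
  L.+1%:R ^+ 2 * (20 * chaos_var n m p s T1 D * ln (2 * (n * p)%:R + 1)).

(** The quantifier over y makes the gap exceed the level at the grid maximum of |Phi_u y|^2; written
    with finite quantifiers, the event is visibly measurable. *)
Definition deviates (g g' : J -> R) : bool :=
  [exists x : code K L, in_ball R s x && [forall y : code K L, in_ball R s y ==>
    (level (quad (fun j => g j + g' j) (grid R s y)) <
     (quad g (grid R s x) - quad g' (grid R s x)) ^+ 2)]].

Lemma measurable_quad d' (T' : measurableType d') (X : J -> T' -> R) (x : K -> R) :
  (forall j, measurable_fun setT (X j)) -> measurable_fun setT (fun w => quad (X ^~ w) x).
Proof.
move=> mX; apply: measurable_sum => r; apply: measurable_funX.
by apply: measurable_sum => k; apply: measurable_funM; [exact: measurable_cst|exact: mX].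
Qed.

(** Stated for arbitrary families: it is applied to exchanged copies, to the product space, and to
    the coordinates of the function space. *)
Lemma measurable_deviates d' (T' : measurableType d') (X Y : J -> T' -> R) :
  (forall j, measurable_fun setT (X j)) -> (forall j, measurable_fun setT (Y j)) ->
  measurable [set w | deviates (X ^~ w) (Y ^~ w)].
Proof.
move=> mX mY; apply: measurable_exists => x; apply: measurable_andb_cond.
apply: measurable_forall => y; apply: measurable_implyb_cond.
apply: measurable_set_lt.
  have mq : measurable_fun setT (fun w => quad (fun j => X j w + Y j w) (grid R s y)).
    by apply: measurable_quad => j; exact: measurable_funD.
  rewrite /level /chaos_var.
  apply: measurable_funM; first exact: measurable_cst.
  apply: measurable_funM; last exact: measurable_cst.
  apply: measurable_funM; first exact: measurable_cst.
  apply: measurable_funM; first exact: measurable_cst.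
  apply: measurable_funD; last exact: measurable_cst.
  apply: measurable_funM; first exact: measurable_cst.
  apply: measurable_funD; last exact: measurable_cst.
  apply: measurable_funM; first exact: measurable_cst.
  by do 2 (apply: measurable_funD; last exact: measurable_cst).
by apply: measurable_funX; apply: measurable_funB; exact: measurable_quad.
Qed.

(** Factor a^2 - b^2 = (a - b)(a + b) in each row, then transpose by [meas_back]. *)
Lemma quad_diff (g g' : J -> R) (x : K -> R) : quad g x - quad g' x =
  \sum_j (g j - g' j) * corr (fun j => g j + g' j) x j.
Proof.
rewrite /quad -sumrB -(meas_back (fun j => g j - g' j)); apply: eq_bigr => r _.
have -> : meas (fun j => g j + g' j) x r = meas g x r + meas g' x r.
  by rewrite /meas -big_split; apply: eq_bigr => k _; rewrite mulrDr.
have -> : meas (fun j => g j - g' j) x r = meas g x r - meas g' x r.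
  by rewrite /meas -sumrB; apply: eq_bigr => k _; rewrite mulrBr.
ring.
Qed.

Let swapped (eps : J -> bool) (b : bool) (w : T * T) (j : J) : R :=
  pair_family phi (b (+) eps j, j) w.

(** Exchanging copies fixes u and flips signs of v, so for a fixed good w the bad patterns are
    counted by [sign_chaos], with D the grid maximum for this u. *)
Let count_deviates (w : T * T) :
  2 * (n * p)%:R * (\sum_(om < m) excess (psum phi w) T1 om) <= m%:R ->
  \sum_(q < m) \sum_(k : K) \sum_(l : K)
      Num.max 0 (m%:R * pdiff phi w (k.1, circ_idx q k.2) ^+ 2 - T1) *
      psum phi w (l.1, circ_idx q l.2) ^+ 2 <= (n * p)%:R^-1 ->
  \sum_(eps : {ffun J -> bool}) (deviates (swapped eps false w) (swapped eps true w))%:R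
    <= 2 ^+ #|{: J}| * (6 * (2 * (n * p)%:R + 1) ^- 2) :> R.
Proof.
move=> ex cr.
have T10 : 0 < T1 by rewrite mulr_gt0// exprn_gt0// mulr_gt0.
have swS eps j : swapped eps false w j + swapped eps true w j = psum phi w j.
  by rewrite /swapped /pair_family /psum /=; case: (eps j) => //=; rewrite addrC.
have swD eps j : swapped eps false w j - swapped eps true w j = (-1) ^+ eps j * pdiff phi w j.
  rewrite /swapped /pair_family /pdiff /=; case: (eps j) => /=.
    by rewrite expr1 mulN1r opprB.
  by rewrite expr0 mul1r.
have rhs0 : 0 <= 2 ^+ #|{: J}| * (6 * (2 * (n * p)%:R + 1) ^- 2) :> R.
  by rewrite mulr_ge0 ?exprn_ge0// mulr_ge0// invr_ge0 exprn_ge0// addr_ge0// mulr_ge0.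
have [[x0 x0X]|noX] := pselect (exists x : code K L, in_ball R s x); last first.
  rewrite big1// => eps _; rewrite /deviates; case: existsP => // -[x /andP[xX _]].
  by exfalso; apply: noX; exists x.
pose u := psum phi w.
have [y0 y0X y0max] : exists2 y0 : code K L, in_ball R s y0 &
    forall y : code K L, in_ball R s y -> quad u (grid R s y) <= quad u (grid R s y0).
  case: (@arg_maxP _ _ _ x0 (@in_ball R n p s L)
    (fun y => quad u (grid R s y)) x0X) => y y1 y2.
  by exists y.
pose D := quad u (grid R s y0).
have D0 : 0 <= D by apply: sumr_ge0 => r _; exact: sqr_ge0.
pose t2 := 20 * chaos_var n m p s T1 D * ln (2 * (n * p)%:R + 1).
have V0 : 0 < chaos_var n m p s T1 D by apply: chaos_var_gt0.
have t20 : 0 <= t2.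
  rewrite /t2 mulr_ge0//; first exact: (mulr_ge0 (ler0n R 20) (ltW V0)).
  by rewrite ln_ge0// lerDr mulr_ge0.
have key := sign_chaos n0 p0 nm s0 snp Ls T10 ex cr y0max D0 (sqrtr_ge0 t2).
rewrite sqr_sqrtr// in key.
apply: (le_trans _ (key (lexx _))).
apply: ler_sum => eps _; set b := [exists _, _].
suff : deviates (swapped eps false w) (swapped eps true w) -> b.
  by case: (deviates _ _) => // ->.
move=> /existsP[x /andP[xX /forallP /(_ y0)]]; rewrite y0X /= => hx.
apply/existsP; exists x; rewrite xX /=.
move: hx; rewrite quad_diff.
have -> : (fun j => swapped eps false w j + swapped eps true w j) = u.
  by apply/funext => j; rewrite swS.
have -> : \sum_j (swapped eps false w j - swapped eps true w j) * corr u (grid R s x) j =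
    \sum_j (-1) ^+ eps j * (pdiff phi w j * corr u (grid R s x) j).
  by apply: eq_bigr => j _; rewrite swD mulrA.
rewrite /level -/D -/t2 -{1}(sqr_sqrtr t20) -exprMn => hx.
rewrite -(@ltr_pXn2r _ 2)// ?nnegrE ?mulr_ge0 ?sqrtr_ge0//.
by rewrite real_normK ?num_real.
Qed.

(** All exchanged events have the same probability, so it equals the mean of their indicators over
    the patterns. On H this mean is bounded pointwise by the count; off H it is bounded by 1. *)
Lemma chaos_prob (beta : R) :
  8 * p%:R * (n * p)%:R * ((10 * th) ^+ 2 * expR (- (9 * th ^+ 2))) +
     4 * (n * p)%:R ^+ 3 * ((10 * th) ^+ 2 * expR (1 - 9 * th ^+ 2)) <= beta ->
  (P2 [set w | deviates (phi ^~ w.1) (phi ^~ w.2)] <=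
    (beta + 6 * (2 * (n * p)%:R + 1) ^- 2)%:E)%E.
Proof.
move=> hbeta.
have [H [mH PH HP]] := good_event n0 p0 nm mphi indep mgf1 th0 th2.
have {}PH : (P2 (~` H) <= beta%:E)%E by apply: (le_trans PH); rewrite lee_fin.
set N2 : R := 6 * _.
have N20 : 0 <= N2 by rewrite mulr_ge0// invr_ge0 exprn_ge0// addr_ge0// mulr_ge0.
pose S eps := [set w | deviates (swapped eps false w) (swapped eps true w)].
have mpair eps b j : measurable_fun setT (fun w => swapped eps b w j).
  exact: (measurable_pair_family mphi).
have mS eps : measurable (S eps) by apply: measurable_deviates => j; exact: mpair.
have PS (eps : {ffun J -> bool}) : P2 (S (fun _ => false)) = P2 (S eps).
  pose Sf : set (funspace R (bool * J)%type) :=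
    [set f | deviates (fun j => f (false, j)) (fun j => f (true, j))].
  have mSf : measurable Sf.
    by apply: measurable_deviates => j; exact: measurable_coord.
  have := (swap_law mphi indep eps).1 _ mSf.
  have -> : [set w | Sf (fun x => pair_family phi x w)] = S (fun _ => false).
    by apply/seteqP; split => w; rewrite /S /Sf /swapped /=; under eq_fun do rewrite ?addbF.
  by move=> ->.
have -> : [set w | deviates (phi ^~ w.1) (phi ^~ w.2)] = S (fun _ => false) by [].
pose C : R := 2 ^+ #|{: J}|.
have C0 : 0 < C by rewrite exprn_gt0.
have cardE : #|{ffun J -> bool}|%:R = C :> R by rewrite card_ffun card_bool natrX.
pose G w := \sum_(eps : {ffun J -> bool}) (\1_(S eps) w : R).
have mind (A : set (T * T)) : measurable A -> measurable_fun setT (fun w => (\1_A w : R)%:E).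
  by move=> mA; apply/measurable_EFinP; exact: measurable_indic.
have sumE : (C%:E * P2 (S (fun _ => false)) = \int[P2]_w (G w)%:E)%E.
  under eq_integral do rewrite /G -sumEFin.
  rewrite ge0_integral_sum//; last by move=> eps; exact: mind.
  have e (eps : {ffun J -> bool}) : (\int[P2]_w (\1_(S eps) w)%:E = P2 (S (fun _ => false)))%E.
    rewrite integral_indic; [|exact: measurableT|exact: mS].
    rewrite setIT; exact: (esym (PS eps)).
  pose PP : probability (T * T)%type R := P2.
  have qE : P2 (S (fun _ => false)) = (fine (P2 (S (fun _ => false))))%:E.
    by rewrite fineK//; exact: (@fin_num_measure _ _ _ PP _ (mS _)).
  under eq_bigr do rewrite e qE.
  rewrite sumEFin sumr_const {1}qE -EFinM -cardE; congr EFin.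
  by rewrite mulr_natl.
have Gle w : G w <= C * \1_(~` H) w + C * N2.
  have [wH|wH] := pselect (H w).
    have [h1 h2] := HP _ wH.
    have -> : \1_(~` H) w = 0 :> R.
      by rewrite indicE memNset// => /(_ wH).
    rewrite mulr0 add0r.
    apply: (le_trans _ (count_deviates h1 h2)).
    apply: ler_sum => eps _; rewrite indicE /S.
    by have [|//] := boolP (w \in _); rewrite inE /= => ->.
  have -> : \1_(~` H) w = 1 :> R by rewrite indicE mem_set.
  rewrite mulr1 (@le_trans _ _ C)//; last by rewrite lerDl mulr_ge0// ltW.
  rewrite -cardE -sum1_card natr_sum; apply: ler_sum => eps _.
  by rewrite indicE; case: (_ \in _).
have intG : (\int[P2]_w (G w)%:E <= C%:E * (beta + N2)%:E)%E.
  apply: (@le_trans _ _ (\int[P2]_w (C%:E * (\1_(~` H) w : R)%:E + (C * N2)%:E)))%E.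
    apply: ge0_le_integral => //.
    - by move=> w _; rewrite lee_fin; apply: sumr_ge0.
    - by apply/measurable_EFinP; apply: measurable_sum => eps; exact: measurable_indic.
    - apply: emeasurable_funD; last exact: measurable_cst.
      by apply: emeasurable_funM; [exact: measurable_cst|apply: mind; exact: measurableC].
    - by move=> w _; rewrite -EFinM -EFinD lee_fin.
  have mHc : measurable (~` H) by exact: measurableC.
  have p1 w : [set: T * T] w -> (0 <= C%:E * (\1_(~` H) w : R)%:E)%E.
    by move=> _; rewrite -EFinM lee_fin mulr_ge0// ltW.
  have p2 (w : T * T) : [set: T * T] w -> (0 <= (C * N2)%:E)%E.
    by move=> _; rewrite lee_fin mulr_ge0// ltW.
  have m1 : measurable_fun setT (fun w => (C%:E * (\1_(~` H) w : R)%:E)%E).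
    by apply: emeasurable_funM; [exact: measurable_cst|exact: mind].
  rewrite (ge0_integralD P2 measurableT p1 m1 p2 (measurable_cst _)).
  rewrite ge0_integralZl//; last 2 first.
  - exact: mind.
  - by rewrite lee_fin ltW.
  rewrite integral_indic// setIT integral_cst//= probability_setT mule1.
  have -> : (C%:E * (beta + N2)%:E = C%:E * beta%:E + (C * N2)%:E)%E.
    by rewrite -!EFinM -EFinD mulrDr.
  apply: leeD => //.
  by apply: lee_wpmul2l => //; rewrite lee_fin ltW.
rewrite -sumE in intG.
by rewrite lee_pmul2l// in intG.
Qed.

End ChaosProb.

(** * Concentration around the mean *)

Lemma markov_set d (T : measurableType d) (R : realType) (P : probability T R)
    (A : set T) (f : T -> \bar R) (t : R) : measurable A -> measurable_fun setT f ->
  (forall w, 0 <= f w)%E -> 0 <= t -> (forall w, A w -> t%:E <= f w)%E ->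
  (t%:E * P A <= \int[P]_w f w)%E.
Proof.
move=> mA mf f0 t0 tf.
rewrite -[X in (_ * P X)%E]setIT -integral_indic//.
rewrite -ge0_integralZl//; last first.
  by apply/measurable_EFinP; exact: measurable_indic.
apply: ge0_le_integral => //.
- by move=> w _; rewrite -EFinM lee_fin mulr_ge0.
- apply: emeasurable_funM; first exact: measurable_cst.
  by apply/measurable_EFinP; exact: measurable_indic.
- move=> w _; rewrite indicE.
  have [|_] := boolP (w \in _); last by rewrite mule0.
  by rewrite inE mule1 => /tf.
Qed.

Lemma sum_sqr_eq0 (R : realType) (I : finType) (a : I -> R) :
  \sum_i a i ^+ 2 = 0 -> forall i, a i = 0.
Proof.
move=> /eqP; rewrite psumr_eq0 => [/allP h i|i _]; last exact: sqr_ge0.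
by apply/eqP; rewrite -sqrf_eq0; apply: h; rewrite mem_index_enum.
Qed.

Section SignSecondMoment.
Variables (R : realType) (J : finType).

(** The factor 2 e is the price for deducing the bound from [sign_mgf], after dividing by the square
    root of the sum of squares. *)
Lemma sign_second_moment (a : J -> R) :
  \sum_(eps : {ffun J -> bool}) sign_sum eps a ^+ 2 <=
    2 ^+ #|J| * (2 * expR 1 * \sum_j a j ^+ 2).
Proof.
have A0 : 0 <= \sum_j a j ^+ 2 by apply: sumr_ge0 => j _; exact: sqr_ge0.
have [Az|Anz] := eqVneq (\sum_j a j ^+ 2) 0.
  have az := sum_sqr_eq0 Az.
  rewrite Az !mulr0 big1// => eps _.
  by rewrite /sign_sum big1 ?expr0n// => j _; rewrite az mulr0.
set A := \sum_j _ in A0 Anz *.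
have Ap : 0 < A by rewrite lt_neqAle eq_sym Anz.
pose q := Num.sqrt A.
have q0 : 0 < q by rewrite sqrtr_gt0.
have q2 : q ^+ 2 = A by rewrite sqr_sqrtr.
have scale (b : bool) (eps : {ffun J -> bool}) : (-1) ^+ b * (sign_sum eps a / q) =
    sign_sum eps (fun j => (-1) ^+ b / q * a j).
  by rewrite /sign_sum mulr_suml mulr_sumr; apply: eq_bigr => j _; ring.
have half (b : bool) : \sum_(eps : {ffun J -> bool}) expR ((-1) ^+ b * (sign_sum eps a / q))
    <= 2 ^+ #|J| * expR 1.
  under eq_bigr do rewrite scale.
  apply: (le_trans (sign_mgf _)); rewrite ler_pM2l ?exprn_gt0// ler_expR.
  under eq_bigr do rewrite exprMn exprMn sqrr_sign mul1r exprVn q2.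
  by rewrite -mulr_sumr mulVf.
have -> : 2 ^+ #|J| * (2 * expR 1 * A) = A * \sum_(b : bool) 2 ^+ #|J| * expR 1.
  by rewrite big_bool /=; ring.
apply: (@le_trans _ _ (A * \sum_(b : bool) \sum_(eps : {ffun J -> bool})
    expR ((-1) ^+ b * (sign_sum eps a / q)))); last first.
  by rewrite ler_pM2l//; apply: ler_sum => b _; exact: half.
rewrite exchange_big mulr_sumr; apply: ler_sum => eps _ /=.
have -> : sign_sum eps a ^+ 2 = A * (sign_sum eps a / q) ^+ 2.
  by rewrite exprMn exprVn q2; field.
by rewrite ler_pM2l//; exact: sqr_le_exp.
Qed.

End SignSecondMoment.

(** * Moments of the quadratic form at a fixed vector *)

Section FixedPoint.
Context d (T : measurableType d) (R : realType) (P : probability T R).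
Variables (n m p : nat).
Hypotheses (n0 : (0 < n)%N) (p0 : (0 < p)%N) (nm : (n <= m)%N).
Local Notation K := ('I_p * 'I_n)%type.
Local Notation J := ('I_p * 'I_m)%type.
Variable phi : J -> T -> R.
Hypothesis mphi : forall j, measurable_fun setT (phi j : T -> measurableTypeR R).
Hypothesis indep : forall B : J -> set R,
  (forall j, measurable (B j : set (measurableTypeR R))) ->
  P [set w | forall j, B j (phi j w)] = (\prod_j P (phi j @^-1` B j))%E.
Hypothesis mgf1 : forall j t,
  (\int[P]_w (expR (t * phi j w))%:E = (expR (t ^+ 2 * m%:R^-1 / 2))%:E)%E.
Local Notation P2 := (P \x P)%E.

Variables (x : K -> R) (s : R).
Hypothesis x1 : \sum_k x k ^+ 2 <= 1.
Hypothesis xs : (\sum_k `|x k|) ^+ 2 <= s.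

Let m0 : 0 < m%:R :> R. Proof. by rewrite ltr0n (leq_trans n0 nm). Qed.

Let idx (r : 'I_m) (k : K) : J := (k.1, circ_idx r k.2).

(** Row r of Phi_u x as a linear form in the probe u. *)
Let M (r : 'I_m) (j : J) : R := \sum_k x k * (j == idx r k)%:R.

Let idx_inj r : injective (idx r).
Proof.
move=> [i c] [i' c'] e; have e1 : i = i' := congr1 fst e.
have e2 : c = c' := circ_idx_injr n0 nm (congr1 snd e).
by rewrite e1 e2.
Qed.

Let sum_M r (f : J -> R) : \sum_j M r j * f j = \sum_k x k * f (idx r k).
Proof.
under eq_bigr do rewrite mulr_suml.
rewrite exchange_big; apply: eq_bigr => k _ /=.
under eq_bigr => j _ do rewrite -mulrA [j == _]eq_sym.
by rewrite -mulr_sumr sum_pick.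
Qed.

Let measM u r : meas u x r = \sum_j M r j * u j.
Proof. by rewrite sum_M. Qed.

Let M_idx r k : M r (idx r k) = x k.
Proof.
rewrite /M (bigD1 k)//= eqxx mulr1 big1 ?addr0// => l lk.
by rewrite (inj_eq (@idx_inj r)) eq_sym (negbTE lk) mulr0.
Qed.

Let norm_M r : \sum_j M r j ^+ 2 = \sum_k x k ^+ 2.
Proof.
under eq_bigr do rewrite expr2.
by rewrite sum_M; apply: eq_bigr => k _; rewrite M_idx expr2.
Qed.

Let gram r r' : R := \sum_j M r j * M r' j.

Let gram_le1 r r' : `|gram r r'| <= 1.
Proof.
have h := cauchy_schwarz_sum (M r) (M r'); rewrite !norm_M in h.
have h0 : 0 <= \sum_k x k ^+ 2 by apply: sumr_ge0 => k _; exact: sqr_ge0.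
rewrite -(@ler_pXn2r _ 2)// ?nnegrE// real_normK ?num_real// expr1n.
by apply: (le_trans h); rewrite -[leRHS]mulr1 ler_pM.
Qed.

(** For fixed r, a pair of entries of x meets at the same probe index for at most one r'; summing
    over pairs gives the squared l1 norm. *)
Let sum_gram r : \sum_r' `|gram r r'| <= s.
Proof.
apply: le_trans xs; rewrite expr2 mulr_suml.
apply: (@le_trans _ _ (\sum_r' \sum_k `|x k| * `|M r' (idx r k)|)).
  apply: ler_sum => r' _; rewrite /gram sum_M.
  by apply: (le_trans (ler_norm_sum _ _ _)); apply: ler_sum => k _; rewrite normrM.
rewrite exchange_big; apply: ler_sum => k _ /=.
rewrite -mulr_sumr ler_wpM2l//.
apply: (@le_trans _ _ (\sum_r' \sum_l `|x l| * (idx r k == idx r' l)%:R)).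
  apply: ler_sum => r' _; apply: (le_trans (ler_norm_sum _ _ _)).
  by apply: ler_sum => l _; rewrite normrM [X in _ * X <= _]ger0_norm.
rewrite exchange_big; apply: ler_sum => l _ /=.
rewrite -mulr_sumr ler_piMr//.
apply: (@le_trans _ _ (\sum_r' (circ_idx r' l.2 == (idx r k).2)%:R)).
  apply: ler_sum => r' _; rewrite ler_nat.
  by case: eqP => // ->; rewrite /= eqxx.
rewrite (sum_circ_idx n0 nm (fun t => (t == (idx r k).2)%:R : R)).
by rewrite (bigD1 (idx r k).2)//= eqxx big1 ?addr0// => t /negbTE ->.
Qed.

(** The matrix of the quadratic form u -> |Phi_u x|^2. *)
Let B (j a : J) : R := \sum_r M r j * M r a.

Let corrB u j : corr u x j = \sum_a B j a * u a.
Proof.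
have := meas_back (fun i => (i == j)%:R) x (meas u x).
under [RHS]eq_bigr do rewrite eq_sym.
rewrite sum_pick -/(corr u x j) => <-.
rewrite /B; under [RHS]eq_bigr do rewrite mulr_suml.
rewrite exchange_big; apply: eq_bigr => r _ /=.
rewrite !measM mulrC mulr_sumr.
have -> : \sum_i M r i * (i == j)%:R = M r j.
  under eq_bigr do rewrite mulrC eq_sym.
  by rewrite sum_pick.
by apply: eq_bigr => a _; rewrite mulrA.
Qed.

(** The squared Frobenius norm of [B] is the sum of the squared Gram entries of the rows. Entries
    are at most 1 in modulus, so squares may be replaced by moduli and [sum_gram] applies. *)
Let frob : \sum_j \sum_a B j a ^+ 2 <= m%:R * s.
Proof.
have -> : \sum_j \sum_a B j a ^+ 2 = \sum_r \sum_r' gram r r' ^+ 2.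
  transitivity (\sum_j \sum_a \sum_r \sum_r' (M r j * M r' j) * (M r a * M r' a)).
    apply: eq_bigr => j _; apply: eq_bigr => a _.
    rewrite expr2 {1}/B mulr_suml; apply: eq_bigr => r _.
    by rewrite /B mulr_sumr; apply: eq_bigr => r' _; ring.
  transitivity (\sum_r \sum_r' \sum_j \sum_a (M r j * M r' j) * (M r a * M r' a)).
    transitivity (\sum_r \sum_j \sum_a \sum_r' (M r j * M r' j) * (M r a * M r' a)).
      rewrite [RHS]exchange_big; apply: eq_bigr => j _; exact: exchange_big.
    apply: eq_bigr => r _; rewrite [RHS]exchange_big; apply: eq_bigr => j _.
    exact: exchange_big.
  apply: eq_bigr => r _; apply: eq_bigr => r' _.
  rewrite expr2 {1}/gram mulr_suml; apply: eq_bigr => j _; by rewrite /gram mulr_sumr.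
have -> : m%:R * s = \sum_(r < m) s by rewrite sumr_const card_ord mulr_natl.
apply: ler_sum => r _; apply: le_trans (sum_gram r); apply: ler_sum => r' _.
rewrite -real_normK ?num_real// expr2 ler_piMr//; exact: gram_le1.
Qed.

Lemma measurable_meas r : measurable_fun setT (fun w => meas (phi ^~ w) x r).
Proof.
have -> : (fun w => meas (phi ^~ w) x r) = (fun w => \sum_j M r j * phi j w).
  by apply/funext => w; rewrite measM.
exact: measurable_linear.
Qed.

Lemma quad_mean : (\int[P]_w (quad (phi ^~ w) x)%:E = (\sum_k x k ^+ 2)%:E)%E.
Proof.
have e r : (\int[P]_w (meas (phi ^~ w) x r ^+ 2)%:E = (m%:R^-1 * \sum_k x k ^+ 2)%:E)%E.
  apply: second_moment.
  - exact: measurable_meas.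
  - by rewrite mulr_ge0 ?invr_ge0//; apply: sumr_ge0 => k _; exact: sqr_ge0.
  move=> t.
  under eq_integral => w _ do rewrite measM mulr_sumr.
  under eq_integral => w _ do under eq_bigr do rewrite mulrA.
  rewrite (mgf mphi indep mgf1); congr (expR _)%:E.
  under eq_bigr do rewrite exprMn.
  by rewrite -mulr_sumr norm_M; ring.
under eq_integral do rewrite /quad -sumEFin.
rewrite ge0_integral_sum//; last 2 first.
- by move=> r; apply/measurable_EFinP; apply: measurable_funX; exact: measurable_meas.
- by move=> r w _; rewrite lee_fin sqr_ge0.
under eq_bigr do rewrite e.
rewrite sumEFin sumr_const card_ord; congr EFin.
rewrite -[LHS]mulr_natl mulrA mulfV ?mul1r//.
by rewrite gt_eqF.
Qed.

Let corr2_le (u : J -> R) (j : J) (tau : R) : 0 < tau ->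
  m%:R / tau ^+ 2 * corr u x j ^+ 2 <=
    \sum_(b : bool) expR (\sum_a (-1) ^+ b * (Num.sqrt m%:R / tau) * B j a * u a).
Proof.
move=> t0.
have -> : m%:R / tau ^+ 2 * corr u x j ^+ 2 = (Num.sqrt m%:R / tau * corr u x j) ^+ 2.
  by rewrite !exprMn exprVn sqr_sqrtr ?ltW.
apply: (le_trans (sqr_le_exp _)); apply: ler_sum => b _.
rewrite ler_expR corrB !mulr_sumr le_eqVlt; apply/orP; left; apply/eqP.
by apply: eq_bigr => a _; ring.
Qed.

(** After normalization, each factor squared is at most a sum of two exponentials of linear forms;
    each of the four products has mean exp 2. *)
Let cross_moment j : (\int[P2]_w ((pdiff phi w j * corr (psum phi w) x j) ^+ 2)%:E <=
  (4 * expR 2 / m%:R ^+ 2 * \sum_a B j a ^+ 2)%:E)%E.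
Proof.
have t20 : 0 <= \sum_a B j a ^+ 2 by apply: sumr_ge0 => a _; exact: sqr_ge0.
have [tz|tnz] := eqVneq (\sum_a B j a ^+ 2) 0.
  have Bz := sum_sqr_eq0 tz.
  have cz u : corr u x j = 0 by rewrite corrB big1// => a _; rewrite Bz mul0r.
  under eq_integral => w _ do rewrite cz mulr0 expr0n /=.
  by rewrite integral0 tz mulr0.
pose tau := Num.sqrt (\sum_a B j a ^+ 2).
have tp : 0 < tau by rewrite sqrtr_gt0 lt_neqAle eq_sym tnz.
have tE : tau ^+ 2 = \sum_a B j a ^+ 2 by rewrite sqr_sqrtr.
have mi : 0 <= m%:R :> R by rewrite ltW.
pose al (b : bool * bool) (a : J) : R := (-1) ^+ b.2 * (Num.sqrt m%:R / tau) * B j a.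
pose be (b : bool * bool) (a : J) : R := (j == a)%:R * ((-1) ^+ b.1 * Num.sqrt m%:R).
have mom b : (\int[P2]_w (expR (elin phi (al b) (be b) w))%:E = (expR 2)%:E)%E.
  rewrite (mgf_elin n0 nm mphi indep mgf1); congr (expR _)%:E.
  have -> : \sum_a al b a ^+ 2 = m%:R.
    under eq_bigr do rewrite /al !exprMn exprVn sqrr_sign mul1r sqr_sqrtr//.
    by rewrite -mulr_sumr -tE; field; rewrite gt_eqF.
  have -> : \sum_a be b a ^+ 2 = m%:R.
    under eq_bigr do rewrite /be exprMn expr2 -mulrA.
    by rewrite sum_pick eqxx mul1r exprMn sqrr_sign mul1r sqr_sqrtr.
  by field; rewrite gt_eqF.
have mexp b : measurable_fun setT (fun w => (expR (elin phi (al b) (be b) w))%:E).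
  by apply/measurable_EFinP; apply: measurableT_comp => //; exact: measurable_elin.
have bound w : (pdiff phi w j * corr (psum phi w) x j) ^+ 2 <=
    tau ^+ 2 / m%:R ^+ 2 * \sum_(b : bool * bool) expR (elin phi (al b) (be b) w).
  have := corr2_le (psum phi w) j tp; set X := \sum_(b : bool) _ => hX.
  have := sqr_le_exp (Num.sqrt m%:R * pdiff phi w j); set Y := \sum_(b : bool) _ => hY.
  rewrite exprMn sqr_sqrtr// in hY.
  have XY : Y * X = \sum_(b : bool * bool) expR (elin phi (al b) (be b) w).
    rewrite sum_pair /Y mulr_suml; apply: eq_bigr => b1 _.
    rewrite /X mulr_sumr; apply: eq_bigr => b2 _; rewrite -expRD addrC; congr expR.
    rewrite /elin /al /be /=; congr (_ + _).
    under [RHS]eq_bigr do rewrite -mulrA.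
    by rewrite sum_pick mulrA.
  have -> : (pdiff phi w j * corr (psum phi w) x j) ^+ 2 = tau ^+ 2 / m%:R ^+ 2 *
      ((m%:R * pdiff phi w j ^+ 2) * (m%:R / tau ^+ 2 * corr (psum phi w) x j ^+ 2)).
    by field; rewrite !gt_eqF.
  apply: ler_wpM2l; first by rewrite divr_ge0 ?exprn_ge0// ltW.
  rewrite -XY; apply: ler_pM => //.
    by rewrite mulr_ge0// sqr_ge0.
  by rewrite mulr_ge0 ?sqr_ge0// divr_ge0// sqr_ge0.
have mh : measurable_fun setT (fun w => pdiff phi w j * corr (psum phi w) x j).
  have -> : (fun w => pdiff phi w j * corr (psum phi w) x j) =
      (fun w => elin phi (fun=> 0) (fun a => (j == a)%:R) w * elin phi (B j) (fun=> 0) w).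
    apply/funext => w; congr (_ * _).
      by rewrite /elin sum_pick [X in X + _]big1 ?add0r// => a _; rewrite mul0r.
    by rewrite /elin corrB [X in _ + X]big1 ?addr0// => a _; rewrite mul0r.
  by apply: measurable_funM; exact: measurable_elin.
apply: (@le_trans _ _ (\int[P2]_w ((tau ^+ 2 / m%:R ^+ 2)%:E *
    (\sum_(b : bool * bool) (expR (elin phi (al b) (be b) w))%:E))))%E.
  apply: ge0_le_integral => //.
  - by move=> w _; rewrite lee_fin sqr_ge0.
  - by apply/measurable_EFinP; exact: measurable_funX.
  - apply: emeasurable_funM; first exact: measurable_cst.
    by apply: emeasurable_sum.
  - by move=> w _; rewrite sumEFin -EFinM lee_fin.
have c0 : 0 <= tau ^+ 2 / m%:R ^+ 2 by rewrite divr_ge0 ?exprn_ge0// ltW.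
have mS : measurable_fun setT (fun w => \sum_(b : bool * bool) (expR (elin phi (al b) (be b) w))%:E)%E.
  by apply: emeasurable_sum.
have S0 w : [set: T * T] w -> (0 <= \sum_(b : bool * bool) (expR (elin phi (al b) (be b) w))%:E)%E.
  by move=> _; rewrite sumEFin lee_fin; apply: sumr_ge0 => b _; exact: expR_ge0.
rewrite (ge0_integralZl _ measurableT mS S0); last by rewrite lee_fin.
rewrite ge0_integral_sum//.
under eq_bigr do rewrite mom.
rewrite sumEFin -EFinM lee_fin sumr_const card_prod card_bool -tE.
by rewrite le_eqVlt; apply/orP; left; apply/eqP; rewrite -[_ *+ _]mulr_natl; field; rewrite gt_eqF.
Qed.

Lemma sum_cross_moment :
  (\sum_j \int[P2]_w ((pdiff phi w j * corr (psum phi w) x j) ^+ 2)%:E <=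
   (4 * expR 2 * s / m%:R)%:E)%E.
Proof.
apply: (@le_trans _ _ (\sum_j (4 * expR 2 / m%:R ^+ 2 * \sum_a B j a ^+ 2)%:E)%E).
  by apply: lee_sum => j _; exact: cross_moment.
rewrite sumEFin lee_fin -mulr_sumr.
have -> : 4 * expR 2 * s / m%:R = 4 * expR 2 / m%:R ^+ 2 * (m%:R * s).
  by field; rewrite gt_eqF.
by apply: ler_wpM2l; [rewrite divr_ge0 ?exprn_ge0 ?mulr_ge0 ?expR_ge0// ltW|exact: frob].
Qed.

End FixedPoint.

(** Jensen's inequality by the tangent of the square at mu. The case split on the sign of f - mu
    moves terms across so that only nonnegative functions are integrated. *)
Lemma sqr_dist_mean_le d (T : measurableType d) (R : realType) (P : probability T R)
    (Z : T -> R) (f mu : R) : measurable_fun setT Z -> (forall w, 0 <= Z w) ->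
  (\int[P]_w (Z w)%:E = mu%:E)%E ->
  (((f - mu) ^+ 2)%:E <= \int[P]_w ((f - Z w) ^+ 2)%:E)%E.
Proof.
move=> mZ Z0 ZE.
have mu0 : 0 <= mu by rewrite -lee_fin -ZE integral_ge0// => w _; rewrite lee_fin.
have mEZ : measurable_fun setT (fun w => (Z w)%:E) by apply/measurable_EFinP.
have msq : measurable_fun setT (fun w => ((f - Z w) ^+ 2)%:E).
  by apply/measurable_EFinP; apply: measurable_funX; apply: measurable_funB.
have lin (c e : R) : 0 <= c -> 0 <= e ->
    (\int[P]_w (c%:E * (Z w)%:E + e%:E) = (c * mu + e)%:E)%E.
  move=> c0 e0; rewrite ge0_integralD//; last 2 first.
  - by move=> w _; rewrite -EFinM lee_fin mulr_ge0.
  - by apply: emeasurable_funM; [exact: measurable_cst|].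
  rewrite ge0_integralZl// ?ZE; last by move=> w _; rewrite lee_fin.
  by rewrite integral_cst//= probability_setT mule1.
have sq0 w : [set: T] w -> (0 <= ((f - Z w) ^+ 2)%:E)%E by rewrite lee_fin sqr_ge0.
have [a0|a0] := leP 0 (f - mu).
  have h : (((f - mu) ^+ 2 + 2 * (f - mu) * mu)%:E <=
      \int[P]_w (((f - Z w) ^+ 2)%:E + (2 * (f - mu))%:E * (Z w)%:E))%E.
    rewrite -[leLHS](_ : \int[P]_w (cst ((f - mu) ^+ 2 + 2 * (f - mu) * mu)%:E w) = _)%E; last first.
      by rewrite integral_cst//= probability_setT mule1.
    apply: ge0_le_integral => //.
    - by move=> w _; rewrite lee_fin addr_ge0 ?sqr_ge0// !mulr_ge0.
    - apply: emeasurable_funD => //.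
      by apply: emeasurable_funM; [exact: measurable_cst|].
    - move=> w _; rewrite -EFinM -EFinD lee_fin.
      by have := sqr_ge0 (mu - Z w); nra.
  move: h; rewrite ge0_integralD//; last 2 first.
  - by move=> w _; rewrite -EFinM lee_fin !mulr_ge0.
  - by apply: emeasurable_funM; [exact: measurable_cst|].
  rewrite ge0_integralZl//; last 2 first.
  - by move=> w _; rewrite lee_fin.
  - by rewrite lee_fin mulr_ge0.
  by rewrite ZE -EFinM EFinD leeD2rE.
have h : ((2 * (mu - f) * mu + (f - mu) ^+ 2)%:E <=
    \int[P]_w (((f - Z w) ^+ 2)%:E + (2 * (mu - f) * mu)%:E))%E.
  rewrite -lin ?sqr_ge0//; last by rewrite mulr_ge0//; lra.
  apply: ge0_le_integral => //.
  - move=> w _; rewrite -EFinM -EFinD lee_fin addr_ge0 ?sqr_ge0// mulr_ge0//; lra.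
  - apply: emeasurable_funD => //.
    by apply: emeasurable_funM; [exact: measurable_cst|].
  - by apply: emeasurable_funD.
  - move=> w _; rewrite -EFinM -!EFinD lee_fin.
    by have := sqr_ge0 (mu - Z w); nra.
move: h; rewrite ge0_integralD//; last first.
  by move=> w _; rewrite lee_fin !mulr_ge0//; lra.
by rewrite integral_cst//= probability_setT mule1 addrC EFinD leeD2rE.
Qed.

Section Concentration.
Context d (T : measurableType d) (R : realType) (P : probability T R).
Variables (n m p : nat).
Hypotheses (n0 : (0 < n)%N) (p0 : (0 < p)%N) (nm : (n <= m)%N).
Local Notation K := ('I_p * 'I_n)%type.
Local Notation J := ('I_p * 'I_m)%type.
Variable phi : J -> T -> R.
Hypothesis mphi : forall j, measurable_fun setT (phi j : T -> measurableTypeR R).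
Hypothesis indep : forall B : J -> set R,
  (forall j, measurable (B j : set (measurableTypeR R))) ->
  P [set w | forall j, B j (phi j w)] = (\prod_j P (phi j @^-1` B j))%E.
Hypothesis mgf1 : forall j t,
  (\int[P]_w (expR (t * phi j w))%:E = (expR (t ^+ 2 * m%:R^-1 / 2))%:E)%E.
Local Notation P2 := (P \x P)%E.

Variables (x : K -> R) (s : R).
Hypothesis x1 : \sum_k x k ^+ 2 <= 1.
Hypothesis xs : (\sum_k `|x k|) ^+ 2 <= s.

Let m0 : 0 < m%:R :> R. Proof. by rewrite ltr0n (leq_trans n0 nm). Qed.

Let s0 : 0 <= s. Proof. exact: le_trans (sqr_ge0 _) xs. Qed.

Let gap (w : T * T) : R := quad (phi ^~ w.1) x - quad (phi ^~ w.2) x.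

Let mfst j : measurable_fun setT (fun w : T * T => phi j w.1).
Proof. exact: (measurable_pair_family mphi (false, j)). Qed.

Let msnd j : measurable_fun setT (fun w : T * T => phi j w.2).
Proof. exact: (measurable_pair_family mphi (true, j)). Qed.

Let mcross j : measurable_fun setT (fun w => pdiff phi w j * corr (psum phi w) x j).
Proof.
apply: measurable_funM; first by apply: measurable_funB.
apply: measurable_sum => r; apply: measurable_sum => c.
apply: measurable_funM; first exact: measurable_cst.
apply: measurable_funM; first exact: measurable_cst.
apply: measurable_sum => k; apply: measurable_funM; first exact: measurable_cst.
exact: measurable_funD.
Qed.

Let swapped_gap (eps : {ffun J -> bool}) :
  (\int[P2]_w (gap w ^+ 2)%:E = \int[P2]_w
    (sign_sum eps (fun j => pdiff phi w j * corr (psum phi w) x j) ^+ 2)%:E)%E.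
Proof.
pose F (f : funspace R (bool * J)%type) : \bar R :=
  ((quad (fun j => f (false, j)) x - quad (fun j => f (true, j)) x) ^+ 2)%:E.
have mF : measurable_fun setT F.
  apply/measurable_EFinP; apply: measurable_funX; apply: measurable_funB.
    apply: (measurable_quad (X := fun j (f : funspace R (bool * J)%type) => f (false, j))) => j.
    exact: measurable_coord.
  apply: (measurable_quad (X := fun j (f : funspace R (bool * J)%type) => f (true, j))) => j.
  exact: measurable_coord.
have F0 f : (0 <= F f)%E by rewrite lee_fin sqr_ge0.
have := (swap_law mphi indep eps).2 F mF F0.
rewrite /F /= => ->; apply: eq_integral => w _; congr (_ ^+ 2)%:E.
rewrite quad_diff; apply: eq_bigr => j _; rewrite /pair_family /=.
have -> : (fun j => phi j (if eps j then w.2 else w.1) + phi j (if ~~ eps j then w.2 else w.1)) =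
    psum phi w.
  by apply/funext => i; rewrite /psum; case: (eps i) => //=; rewrite addrC.
rewrite /pdiff mulrA; congr (_ * _).
by case: (eps j) => /=; rewrite ?expr1 ?expr0 ?mulN1r ?mul1r ?opprB.
Qed.

(** The squared gap is averaged over all exchanges, which gives a Rademacher second moment; the
    constants multiply to 2 e * 4 e^2 = 8 e^3. *)
Lemma gap_second_moment :
  (\int[P2]_w (gap w ^+ 2)%:E <= (8 * expR 3 * s / m%:R)%:E)%E.
Proof.
pose C : R := 2 ^+ #|{: J}|.
have C0 : 0 < C by rewrite exprn_gt0.
have cardE : #|{ffun J -> bool}|%:R = C :> R by rewrite card_ffun card_bool natrX.
have mgap : measurable_fun setT (fun w => (gap w ^+ 2)%:E).
  by apply/measurable_EFinP; apply: measurable_funX; apply: measurable_funB; exact: measurable_quad.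
have msgn (eps : {ffun J -> bool}) : measurable_fun setT (fun w =>
    (sign_sum eps (fun j => pdiff phi w j * corr (psum phi w) x j) ^+ 2)%:E).
  apply/measurable_EFinP; apply: measurable_funX; apply: measurable_sum => j.
  by apply: measurable_funM; [exact: measurable_cst|exact: mcross].
have msq j : measurable_fun setT (fun w => ((pdiff phi w j * corr (psum phi w) x j) ^+ 2)%:E).
  by apply/measurable_EFinP; exact: measurable_funX.
have sumC : (C%:E * \int[P2]_w (gap w ^+ 2)%:E = \int[P2]_w (\sum_(eps : {ffun J -> bool})
    sign_sum eps (fun j => pdiff phi w j * corr (psum phi w) x j) ^+ 2)%:E)%E.
  under [RHS]eq_integral do rewrite -sumEFin.
  rewrite [RHS]ge0_integral_sum//; last by move=> eps w _; rewrite lee_fin sqr_ge0.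
  under [RHS]eq_bigr do rewrite -swapped_gap.
  rewrite -cardE -[in LHS]sum1_card natr_sum -sumEFin ge0_sume_distrl//.
  by apply: eq_bigr => eps _; rewrite mul1e.
rewrite -(@lee_pmul2l _ C%:E)// sumC.
apply: (@le_trans _ _ (\int[P2]_w ((C * (2 * expR 1))%:E *
    \sum_j ((pdiff phi w j * corr (psum phi w) x j) ^+ 2)%:E))%E).
  apply: ge0_le_integral => //.
  - by move=> w _; rewrite lee_fin; apply: sumr_ge0 => eps _; exact: sqr_ge0.
  - under eq_fun do rewrite -sumEFin.
    by apply: emeasurable_sum.
  - apply: emeasurable_funM; first exact: measurable_cst.
    by apply: emeasurable_sum.
  - move=> w _; rewrite sumEFin -EFinM lee_fin -mulrA; exact: sign_second_moment.
have mS : measurable_fun setT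
    (fun w => \sum_j ((pdiff phi w j * corr (psum phi w) x j) ^+ 2)%:E)%E.
  by apply: emeasurable_sum.
have S0 w : [set: T * T] w ->
    (0 <= \sum_j ((pdiff phi w j * corr (psum phi w) x j) ^+ 2)%:E)%E.
  by move=> _; rewrite sumEFin lee_fin; apply: sumr_ge0 => j _; exact: sqr_ge0.
have c0 : 0 <= C * (2 * expR 1) by rewrite mulr_ge0 ?mulr_ge0 ?expR_ge0// ltW.
rewrite (ge0_integralZl _ measurableT mS S0) ?lee_fin//.
rewrite ge0_integral_sum//; last by move=> j w _; rewrite lee_fin sqr_ge0.
apply: (@le_trans _ _ ((C * (2 * expR 1))%:E * (4 * expR 2 * s / m%:R)%:E)%E).
  apply: lee_wpmul2l; first by rewrite lee_fin.
  exact: (sum_cross_moment n0 nm mphi indep mgf1 x1 xs).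
have e3 : expR 3 = expR 1 * expR 2 :> R by rewrite -expRD; congr expR; ring.
rewrite -!EFinM lee_fin e3 le_eqVlt; apply/orP; left; apply/eqP.
by field; rewrite gt_eqF.
Qed.

(** For a fixed first copy, the mean of the squared gap over the second copy dominates the squared
    distance to |x|^2. *)
Lemma fixed_point_tail (t : R) : 0 <= t ->
  ((t ^+ 2)%:E * P [set w | (t < `|quad (phi ^~ w) x - \sum_k x k ^+ 2|)%R] <=
   (8 * expR 3 * s / m%:R)%:E)%E.
Proof.
move=> t0; apply: le_trans gap_second_moment.
have mq : measurable_fun setT (fun w => quad (phi ^~ w) x) by exact: measurable_quad.
have mgap : measurable_fun setT (fun w => (gap w ^+ 2)%:E).
  by apply/measurable_EFinP; apply: measurable_funX; apply: measurable_funB; exact: measurable_quad.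
have g0 w : (0 <= (gap w ^+ 2)%:E)%E by rewrite lee_fin sqr_ge0.
rewrite (fubini_tonelli1 _ mgap g0).
apply: markov_set.
- apply: measurable_set_lt; first exact: measurable_cst.
  by apply: measurableT_comp => //; apply: measurable_funB.
- exact: measurable_fun_fubini_tonelli_F.
- by move=> w; apply: integral_ge0.
- exact: sqr_ge0.
move=> w /= tw.
apply: (@le_trans _ _ ((quad (phi ^~ w) x - \sum_k x k ^+ 2) ^+ 2)%:E).
  by rewrite lee_fin -[leRHS]real_normK ?num_real// ler_pXn2r ?nnegrE// ltW.
apply: sqr_dist_mean_le => //.
- by move=> w'; apply: sumr_ge0 => r _; exact: sqr_ge0.
- exact: (quad_mean n0 nm mphi indep mgf1).
Qed.

End Concentration.

(** * Descent from the gap of two copies to the deviation of one *)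

Section Median.
Context d (T : measurableType d) (R : realType) (P : probability T R).
Variables (n m p s L : nat).
Hypotheses (n0 : (0 < n)%N) (p0 : (0 < p)%N) (nm : (n <= m)%N).
Hypotheses (s0 : (0 < s)%N) (snp : (s <= n * p)%N) (Ls : (2 ^ L <= 16 * s ^ 2)%N).
Local Notation K := ('I_p * 'I_n)%type.
Local Notation J := ('I_p * 'I_m)%type.
Variable phi : J -> T -> R.
Hypothesis mphi : forall j, measurable_fun setT (phi j : T -> measurableTypeR R).
Hypothesis indep : forall B : J -> set R,
  (forall j, measurable (B j : set (measurableTypeR R))) ->
  P [set w | forall j, B j (phi j w)] = (\prod_j P (phi j @^-1` B j))%E.
Hypothesis mgf1 : forall j t,
  (\int[P]_w (expR (t * phi j w))%:E = (expR (t ^+ 2 * m%:R^-1 / 2))%:E)%E.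
Local Notation P2 := (P \x P)%E.

Definition dev (x : code K L) (w : T) : R :=
  `|quad (phi ^~ w) (grid R s x) - \sum_k grid R s x k ^+ 2|.

Definition Dev (t : R) : set T := [set w | [exists x : code K L, in_ball R s x && (t < dev x w)]].

Let m0 : 0 < m%:R :> R. Proof. by rewrite ltr0n (leq_trans n0 nm). Qed.

Let measurable_dev (x : code K L) : measurable_fun setT (dev x).
Proof.
apply: measurableT_comp => //; apply: measurable_funB => //.
exact: measurable_quad.
Qed.

Lemma measurable_Dev t : measurable (Dev t).
Proof.
apply: measurable_exists => x; apply: measurable_andb_cond.
by apply: measurable_set_lt => //; exact: measurable_dev.
Qed.

(** Letters have l1 norm at most 1, so the bound holds on the whole grid, for sparse and non-sparse
    points alike. *)
Lemma grid_norm1 (x : code K L) : (\sum_k `|grid R s x k|) ^+ 2 <= s%:R.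
Proof.
have h : \sum_k `|grid R s x k| <= Num.sqrt s%:R.
  have p2 : 0 < (2 : R) ^+ L by rewrite exprn_gt0.
  have c0 : 0 <= Num.sqrt s%:R / 2 ^+ L :> R by rewrite divr_ge0 ?sqrtr_ge0// ltW.
  apply: (@le_trans _ _ (\sum_(k : K) Num.sqrt s%:R / 2 ^+ L * \sum_l `|vec R (x l) k|)).
    apply: ler_sum => k _; rewrite /grid /avg normrM ger0_norm//.
    by apply: ler_wpM2l => //; exact: ler_norm_sum.
  rewrite -mulr_sumr exchange_big /=.
  apply: (@le_trans _ _ (Num.sqrt s%:R / 2 ^+ L * \sum_(l < pow2 L) 1)).
    apply: ler_wpM2l => //; apply: ler_sum => l _; rewrite /vec.
    case: (x l) => [[b k0]|]; last by rewrite big1// => k _; rewrite normr0.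
    under eq_bigr do rewrite normrM normr_sign mul1r [_ == k0]eq_sym normr_nat -[_%:R]mulr1.
    by rewrite sum_pick.
  rewrite sumr_const card_ord pow2E -[_ *+ _]mulr_natl mulr1 natrX mulrVK//.
  by rewrite unitfE gt_eqF.
rewrite -[leRHS]sqr_sqrtr// ler_pXn2r ?nnegrE ?sqrtr_ge0//.
exact: sumr_ge0.
Qed.

Lemma fixed_dev (t : R) (x : code K L) : in_ball R s x -> 0 < t ->
  32 * expR 3 * s%:R <= t ^+ 2 * m%:R -> (P [set w | (t < dev x w)%R] <= (4^-1)%:E)%E.
Proof.
move=> xX t0 ht.
have := fixed_point_tail n0 nm mphi indep mgf1 xX (grid_norm1 x) (ltW t0).
have t2 : 0 < t ^+ 2 by rewrite exprn_gt0.
move=> h; rewrite -(@lee_pmul2l _ (t ^+ 2)%:E)//.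
apply: (le_trans h); rewrite -EFinM lee_fin.
rewrite ler_pdivrMr//; move: ht; set e := expR 3; lra.
Qed.

(** A crude bound by the size of the grid, which only provides some level where the descent can
    start. *)
Let Dev_tail (k : nat) : (0 < k)%N ->
  (k%:R%:E * P (Dev k%:R) <= #|code K L|%:R%:E)%E.
Proof.
move=> k0.
pose q (x : code K L) w : \bar R :=
  (if in_ball R s x then quad (phi ^~ w) (grid R s x) else 0)%:E.
have q0 x w : (0 <= q x w)%E.
  by rewrite lee_fin; case: ifP => // _; apply: sumr_ge0 => r _; exact: sqr_ge0.
have mq x : measurable_fun setT (q x).
  apply/measurable_EFinP; case: (in_ball R s x); first exact: measurable_quad.
  exact: measurable_cst.
apply: (@le_trans _ _ (\int[P]_w (\sum_(x : code K L) q x w))%E); last first.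
  rewrite ge0_integral_sum//.
  apply: (@le_trans _ _ (\sum_(x : code K L) 1%:E)%E); last first.
    by rewrite sumEFin lee_fin sumr_const.
  apply: lee_sum => x _; rewrite /q; case: (boolP (in_ball R s x)) => xX; last by rewrite integral0 lee_fin.
  by rewrite (quad_mean n0 nm mphi indep mgf1) lee_fin.
apply: markov_set => //.
- exact: measurable_Dev.
- exact: emeasurable_sum.
- by move=> w; exact: sume_ge0.
move=> w /= /existsP[x /andP[xX]]; rewrite /dev => h.
rewrite (bigD1 x)//=; apply: lee_paddr; first by apply: sume_ge0.
move: (q0 x w); rewrite /q xX !lee_fin => qx.
have k1 : 1 <= k%:R :> R by rewrite ler1n.
have := xX; rewrite /in_ball => x1; have xs0 : 0 <= \sum_k grid R s x k ^+ 2.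
  by apply: sumr_ge0 => i _; exact: sqr_ge0.
move: h.
by case: (ler0P (quad (phi ^~ w) (grid R s x) - _)) => _; lra.
Qed.

Variable th : R.
Variables (delta e0 eta : R).
Hypotheses (delta01 : 0 < delta <= 1) (e01 : 44 * e0 <= 1) (eta8 : 8 * eta <= 1).
Hypothesis level_le : forall D, 0 <= D -> level n m p s L th D <= e0 * delta ^+ 2 * (1 + D).
Hypothesis deviates_eta :
  (P2 [set w | deviates n s L th (phi ^~ w.1) (phi ^~ w.2)] <= eta%:E)%E.
Hypothesis fixed4 : forall x : code K L, in_ball R s x ->
  (P [set w | (delta / 2 < dev x w)%R] <= (4^-1)%:E)%E.

(** With A the deviation at x, the gap is at least A / 2, while |Phi_u y|^2 <= 6 + 4 A on the grid.
    As delta <= 1 and delta < A, the level stays below 11 e0 A^2, which is at most A^2 / 4 when 44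
    e0 <= 1. *)
Let deviates_of_dev (x : code K L) (w w' : T) (t : R) : delta <= t -> in_ball R s x ->
  (forall y : code K L, in_ball R s y -> dev y w <= dev x w) -> t < dev x w ->
  dev x w' <= delta / 2 -> (forall y : code K L, in_ball R s y -> dev y w' <= t + 1) ->
  deviates n s L th (phi ^~ w) (phi ^~ w').
Proof.
move=> td xX xmax tx xw' yw'; apply/existsP; exists x; rewrite xX /=.
apply/forallP => y; apply/implyP => yX.
set qu := quad (fun j => _) _.
have q0 z : 0 <= quad (phi ^~ z) (grid R s y) by apply: sumr_ge0 => r _; exact: sqr_ge0.
have qu0 : 0 <= qu by apply: sumr_ge0 => r _; exact: sqr_ge0.
have quE : qu <= 2 * quad (phi ^~ w) (grid R s y) + 2 * quad (phi ^~ w') (grid R s y).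
  rewrite /qu /quad !mulr_sumr -big_split; apply: ler_sum => r _ /=.
  have -> : meas (fun j => phi j w + phi j w') (grid R s y) r =
      meas (phi ^~ w) (grid R s y) r + meas (phi ^~ w') (grid R s y) r.
    by rewrite /meas -big_split; apply: eq_bigr => k _; rewrite mulrDr.
  set a := meas _ _ _; set b := meas _ _ _; have := sqr_ge0 (a - b); nra.
have y1 : \sum_k grid R s y k ^+ 2 <= 1 := yX.
have qle z c : dev y z <= c -> quad (phi ^~ z) (grid R s y) <= 1 + c.
  by rewrite /dev ler_norml => /andP[_]; lra.
have h1 := qle _ _ (xmax y yX); have h2 := qle _ _ (yw' y yX).
apply: (le_lt_trans (level_le qu0)).
set A := dev x w in h1 tx *.
have gapA : A - delta / 2 <= `|quad (phi ^~ w) (grid R s x) - quad (phi ^~ w') (grid R s x)|.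
  move: xw'; rewrite /A /dev; set a := quad _ _; set b := quad _ _; set c := \sum_k _ => hb.
  by have := ler_distD a b c; lra.
set G := quad _ _ - quad _ _ in gapA *.
have /andP[d0 d1] := delta01; have e1 := e01.
have dA : delta < A by lra.
have GA : A / 2 <= `|G| by lra.
have G2 : A ^+ 2 / 4 <= G ^+ 2.
  have -> : A ^+ 2 / 4 = (A / 2) ^+ 2 by field.
  by rewrite -[leRHS]real_normK ?num_real// ler_pXn2r ?nnegrE//; lra.
apply: (lt_le_trans _ G2).
have u7 : 1 + qu <= 7 + 4 * A by lra.
have [e00|e00] := leP e0 0.
  apply: (@le_lt_trans _ _ 0); last by rewrite divr_gt0 ?exprn_gt0//; lra.
  by rewrite mulr_le0_ge0 ?mulr_le0_ge0 ?sqr_ge0//; lra.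
have d2 : delta ^+ 2 < A ^+ 2 by rewrite ltr_pXn2r ?nnegrE//; lra.
have d2A : delta ^+ 2 * A <= A ^+ 2.
  have -> : A ^+ 2 = A * A by rewrite expr2.
  have dd : delta ^+ 2 <= delta by rewrite expr2 ler_piMl// ltW.
  by apply: ler_wpM2r; lra.
apply: (@le_lt_trans _ _ (e0 * (delta ^+ 2 * (7 + 4 * A)))).
  by rewrite -mulrA; apply: ler_wpM2l; [lra|apply: ler_wpM2l; [exact: sqr_ge0|lra]].
nra.
Qed.

(* For [w] in [Dev t], at least half of the [w'] deviate little both at the
   maximizer of [w] and, up to [t + 1], everywhere. *)
Let median_step (t : R) : delta <= t -> (P (Dev (t + 1)) <= (4^-1)%:E)%E ->
  (P (Dev t) <= (2 * eta)%:E)%E.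
Proof.
move=> td Pt1.
pose S : set (T * T) := [set w | deviates n s L th (phi ^~ w.1) (phi ^~ w.2)].
have mS : measurable S.
  apply: (@measurable_deviates R n m p s L th _ (T * T)%type (fun j w => phi j w.1) (fun j w => phi j w.2)) => j.
    exact: (measurable_pair_family mphi (false, j)).
  exact: (measurable_pair_family mphi (true, j)).
suff : ((2^-1)%:E * P (Dev t) <= P2 S)%E.
  move=> h; have := le_trans h deviates_eta.
  rewrite -(@lee_pmul2l _ 2%:E)//= muleA -!EFinM mulfV ?mul1e//.
apply: markov_set.
- exact: measurable_Dev.
- exact: measurable_fun_xsection.
- by [].
- by rewrite invr_ge0.
move=> w /= /existsP[x0 /andP[x0X x0t]].
have [x xX xmax] : exists2 x : code K L, in_ball R s x &
    forall y : code K L, in_ball R s y -> dev y w <= dev x w.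
  case: (@arg_maxP _ _ _ x0 (@in_ball R n p s L) (fun y => dev y w) x0X) => x xX xm.
  by exists x.
have tx : t < dev x w := lt_le_trans x0t (xmax _ x0X).
pose A := [set w' | (delta / 2 < dev x w')%R].
have mA : measurable A by apply: measurable_set_lt => //; exact: measurable_dev.
have mB : measurable (Dev (t + 1)) by exact: measurable_Dev.
have mAB : measurable (A `|` Dev (t + 1)) by exact: measurableU.
have PAB : (P (A `|` Dev (t + 1)) <= (2^-1)%:E)%E.
  apply: (le_trans (measureU2 _ mA mB)).
  apply: (le_trans (leeD (fixed4 xX) Pt1)); rewrite -EFinD lee_fin; lra.
have sub : ~` (A `|` Dev (t + 1)) `<=` xsection S w.
  move=> w' /= h; rewrite /xsection /= inE /S /=.
  apply: (deviates_of_dev td xX xmax tx).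
    by rewrite leNgt; apply/negP => h'; apply: h; left.
  move=> y yX; rewrite leNgt; apply/negP => h'; apply: h; right.
  by apply/existsP; exists y; rewrite yX.
apply: (@le_trans _ _ (P (~` (A `|` Dev (t + 1))))).
  rewrite probability_setC//.
  have pE : P (A `|` Dev (t + 1)) = (fine (P (A `|` Dev (t + 1))))%:E.
    by rewrite fineK//; exact: fin_num_measure.
  by move: PAB; rewrite pE -EFinB !lee_fin; lra.
by apply: le_measure => //; rewrite inE; [exact: measurableC|exact: measurable_xsection].
Qed.

(** Each step returns 2 eta <= 1/4, which is what the next step requires. Integer levels descend to
    1; a last step from delta + 1 >= 1 reaches delta. *)
Lemma Dev_prob : (P (Dev delta) <= (2 * eta)%:E)%E.
Proof.
have /andP[d0 d1] := delta01; have e8 := eta8.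
have Dev_le (a b : R) : a <= b -> (P (Dev b) <= P (Dev a))%E.
  move=> ab; apply: le_measure; rewrite ?inE; try exact: measurable_Dev.
  move=> w /= /existsP[x /andP[xX h]]; apply/existsP; exists x.
  by rewrite xX (le_lt_trans ab).
have [k [k0 Pk]] : exists k : nat, (0 < k)%N /\ (P (Dev k%:R) <= (4^-1)%:E)%E.
  exists (4 * #|code K L|).+1; split => //.
  have k0 : 0 < (4 * #|code K L|).+1%:R :> R by rewrite ltr0n.
  rewrite -(@lee_pmul2l _ (4 * #|code K L|).+1%:R%:E)//.
  apply: (le_trans (Dev_tail (ltn0Sn _))).
  rewrite -EFinM lee_fin ler_pdivlMr// -natrM ler_nat mulnC; exact: leqnSn.
have down : (P (Dev 1) <= (4^-1)%:E)%E.
  elim: k k0 Pk => // -[|k] IH _ Pk; first exact: Pk.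
  apply: IH => //.
  have h : (P (Dev k.+1%:R) <= (2 * eta)%:E)%E.
    apply: median_step; last by rewrite natr1.
    by apply: (le_trans d1); rewrite ler1n.
  by apply: (le_trans h); rewrite lee_fin; lra.
apply: median_step => //.
by apply: le_trans down; apply: Dev_le; lra.
Qed.

End Median.

(** * From the grid to sparse vectors *)

Section Rounding.
Variables (R : realType) (K : finType).
Implicit Types (x y z : K -> R) (G : {set K}).

Definition bil (A : K -> K -> R) y x : R := \sum_k \sum_l y k * A k l * x l.

Definition supp_in G x := forall k, k \notin G -> x k = 0.

(** Letter k is repeated [b k] times and the word is padded by [None], the zero letter. *)
Lemma letters_sum (b : K -> nat) (sg : K -> bool) (N : nat) : (\sum_k b k <= N)%N ->
  exists w : {ffun 'I_N -> letter K}, forall k,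
    \sum_l vec R (w l) k = (-1) ^+ sg k * (b k)%:R.
Proof.
move=> bN.
pose t : seq (letter K) := flatten [seq nseq (b k) (Some (sg k, k)) | k <- enum K].
have st : (size t <= N)%N.
  rewrite size_flatten /shape -map_comp sumnE big_map big_enum /=.
  by under eq_bigr do rewrite size_nseq.
exists [ffun l : 'I_N => nth None t l] => k.
under eq_bigr do rewrite ffunE.
rewrite -(big_mkord xpredT (fun l : nat => vec R (nth None t l) k)).
rewrite (@big_cat_nat _ _ _ (size t))//=.
rewrite [X in _ + X]big_nat_cond [X in _ + X]big1 ?addr0; last first.
  by move=> l /andP[/andP[tl _] _]; rewrite nth_default.
rewrite -(big_nth None xpredT (fun l => vec R l k)) big_flatten big_map big_enum /=.
rewrite (bigD1 k)//= [X in _ + X]big1 ?addr0.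
  by rewrite big_nseq_cond /= iter_addr_0 eqxx mulr1 mulr_natr.
move=> k' k'k; rewrite big_nseq_cond /= iter_addr_0.
by rewrite eq_sym (negbTE k'k) mulr0 mul0rn.
Qed.

(** Moduli are rounded down to multiples of h = sqrt s / 2^L. The l1 norm of x is at most sqrt s, so
    2^L letters suffice; the error is at most sqrt s * h = s / 2^L <= 1 / c. *)
Lemma round_to_grid (s L c : nat) G x : (0 < s)%N -> (c * s <= 2 ^ L)%N -> (#|G| <= s)%N -> supp_in G x -> \sum_k x k ^+ 2 <= 1 ->
  exists w : code K L, let x' := avg (Num.sqrt s%:R) w in
    [/\ supp_in G x', \sum_k x' k ^+ 2 <= 1 & \sum_k (c%:R * (x k - x' k)) ^+ 2 <= 1].
Proof.
move=> s0 sL Gs xG x1.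
have q0 : 0 < Num.sqrt s%:R :> R by rewrite sqrtr_gt0 ltr0n.
have p0 : 0 < (2 : R) ^+ L by rewrite exprn_gt0.
pose h : R := Num.sqrt s%:R / 2 ^+ L.
have h0 : 0 < h by rewrite divr_gt0.
pose b k := Num.truncn (`|x k| / h).
have bP k : (b k)%:R * h <= `|x k| < ((b k)%:R + 1) * h.
  have := truncn_itv (divr_ge0 (normr_ge0 (x k)) (ltW h0)).
  by rewrite -/(b k) ler_pdivlMr// ltr_pdivrMr// -natr1.
have cG : \sum_k (k \in G)%:R <= s%:R :> R.
  rewrite -natr_sum ler_nat; apply: leq_trans Gs.
  by rewrite -sum1_card [leqRHS]big_mkcond; apply: leq_sum => k _; case: (k \in G).
have xs : \sum_k `|x k| <= Num.sqrt s%:R.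
  rewrite -(@ler_pXn2r _ 2)// ?nnegrE ?sqrtr_ge0//; last exact: sumr_ge0.
  rewrite sqr_sqrtr//.
  have := cauchy_schwarz_sum (fun k => (k \in G)%:R : R) (fun k => `|x k|).
  have -> : \sum_k (k \in G)%:R * `|x k| = \sum_k `|x k|.
    apply: eq_bigr => k _; have [_|/xG ->] := boolP (k \in G); first by rewrite mul1r.
    by rewrite normr0 mulr0.
  move=> cs; apply: (le_trans cs); rewrite -[leRHS]mulr1; apply: ler_pM => //.
  - by apply: sumr_ge0 => k _; exact: sqr_ge0.
  - by apply: sumr_ge0 => k _; exact: sqr_ge0.
  - apply: le_trans cG; apply: ler_sum => k _.
    by case: (k \in G); rewrite ?expr1n ?expr0n.
  - by under eq_bigr do rewrite real_normK ?num_real//.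
have bN : (\sum_k b k <= pow2 L)%N.
  rewrite pow2E -(ler_nat R) natr_sum natrX -(ler_pM2r h0).
  have -> : 2 ^+ L * h = Num.sqrt s%:R by rewrite /h mulrCA divff ?mulr1// gt_eqF.
  apply: le_trans xs; rewrite mulr_suml; apply: ler_sum => k _.
  by have /andP[] := bP k.
have [w wE] := letters_sum (fun k => x k < 0) bN.
have xE k : avg (Num.sqrt s%:R) w k = (-1) ^+ (x k < 0)%R * ((b k)%:R * h).
  by rewrite /avg wE -/h; ring.
have xA k : `|avg (Num.sqrt s%:R) w k| <= `|x k|.
  rewrite xE normrM normr_sign mul1r ger0_norm; last by rewrite mulr_ge0// ltW.
  by have /andP[] := bP k.
exists w; split.
- by move=> k /xG xk; apply/eqP; rewrite -normr_le0; apply: (le_trans (xA k)); rewrite xk normr0.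
- apply: le_trans x1; apply: ler_sum => k _.
  by rewrite -[leLHS]real_normK ?num_real// -[leRHS]real_normK ?num_real// ler_pXn2r ?nnegrE.
have dE k : `|x k - avg (Num.sqrt s%:R) w k| <= (k \in G)%:R * h.
  have [kG|/xG xk] := boolP (k \in G); last first.
    rewrite xk sub0r normrN; apply: (le_trans (xA k)); by rewrite xk normr0 mul0r.
  rewrite mul1r xE {1}[x k]numEsign.
  rewrite [_ < _]/(x k < 0) -mulrBr normrM normr_sign mul1r.
  have /andP[h1 h2] := bP k.
  by rewrite ger0_norm; lra.
apply: (@le_trans _ _ (\sum_k (k \in G)%:R * (c%:R ^+ 2 * h ^+ 2))).
  apply: ler_sum => k _; rewrite exprMn.
  rewrite [leRHS]mulrCA; apply: ler_wpM2l; first exact: sqr_ge0.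
  rewrite -[leLHS]real_normK ?num_real//.
  have := dE k; case: (k \in G); rewrite /= ?mul1r ?mul0r => hk.
    by rewrite ler_pXn2r ?nnegrE// ltW.
  have -> : `|x k - avg (Num.sqrt s%:R) w k| = 0 by apply/eqP; rewrite eq_le hk normr_ge0.
  by rewrite expr0n.
rewrite -mulr_suml.
have hE : c%:R ^+ 2 * h ^+ 2 = c%:R ^+ 2 * s%:R / (2 ^+ L) ^+ 2.
  by rewrite /h exprMn sqr_sqrtr// exprVn mulrA.
apply: (le_trans (ler_wpM2r _ cG)); first by rewrite mulr_ge0 ?sqr_ge0.
rewrite hE mulrA ler_pdivrMr ?exprn_gt0// mul1r.
have -> : s%:R * (c%:R ^+ 2 * s%:R) = (c%:R * s%:R) ^+ 2 :> R by ring.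
rewrite ler_pXn2r ?nnegrE ?mulr_ge0 ?exprn_ge0//.
by rewrite -natrX -natrM ler_nat.
Qed.

Variable A : K -> K -> R.

Lemma bilZl (c : R) y x : bil A (fun k => c * y k) x = c * bil A y x.
Proof.
rewrite /bil mulr_sumr; apply: eq_bigr => k _; rewrite mulr_sumr.
by apply: eq_bigr => l _; rewrite !mulrA.
Qed.

Lemma bilZr (c : R) y x : bil A y (fun k => c * x k) = c * bil A y x.
Proof.
rewrite /bil mulr_sumr; apply: eq_bigr => k _; rewrite mulr_sumr.
by apply: eq_bigr => l _; rewrite mulrCA.
Qed.

Lemma bilBl y z x : bil A (fun k => y k - z k) x = bil A y x - bil A z x.
Proof.
rewrite /bil -sumrB; apply: eq_bigr => k _; rewrite -sumrB.
by apply: eq_bigr => l _; rewrite !mulrBl.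
Qed.

Lemma bilBr y z x : bil A y (fun k => z k - x k) = bil A y z - bil A y x.
Proof.
rewrite /bil -sumrB; apply: eq_bigr => k _; rewrite -sumrB.
by apply: eq_bigr => l _; rewrite mulrBr.
Qed.

Lemma bil_le_sum y x :
  `|bil A y x| <= (\sum_k \sum_l `|A k l|) * ((\sum_k x k ^+ 2 + \sum_k y k ^+ 2) / 2).
Proof.
apply: (le_trans (ler_norm_sum _ _ _)).
rewrite mulr_suml; apply: ler_sum => k _.
apply: (le_trans (ler_norm_sum _ _ _)); rewrite mulr_suml; apply: ler_sum => l _.
rewrite !normrM mulrAC [`|y k| * _ * _]mulrC; apply: ler_wpM2l => //.
have coord_le z i : `|z i| ^+ 2 <= \sum_k z k ^+ 2.
  rewrite real_normK ?num_real// (bigD1 i)//= lerDl.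
  by apply: sumr_ge0 => ? _; exact: sqr_ge0.
have := coord_le x l; have := coord_le y k; have := sqr_ge0 (`|y k| - `|x l|); nra.
Qed.

Variables (s L : nat).
Hypotheses (s0 : (0 < s)%N) (sL : (8 * s <= 2 ^ L)%N).
Hypothesis symA : forall k l, A k l = A l k.

Lemma bil_polar y x : bil A y x =
  bil A (fun k => (x k + y k) / 2) (fun k => (x k + y k) / 2) -
  bil A (fun k => (x k - y k) / 2) (fun k => (x k - y k) / 2).
Proof.
have sw : bil A y x = bil A x y.
  rewrite /bil exchange_big; apply: eq_bigr => k _; apply: eq_bigr => l _.
  by rewrite symA; ring.
have -> : bil A y x = 2^-1 * (bil A y x + bil A x y) by rewrite -sw; field.
rewrite /bil -big_split mulr_sumr -sumrB; apply: eq_bigr => k _ /=.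
rewrite -big_split mulr_sumr -sumrB; apply: eq_bigr => l _ /=.
by field.
Qed.

Variable eps : R.
Hypothesis eps0 : 0 <= eps.
Hypothesis grid_eps : forall w : code K L, let x' := avg (Num.sqrt s%:R) w in
  \sum_k x' k ^+ 2 <= 1 -> `|bil A x' x'| <= eps.

(** The mean of the squared norms, rather than the product of the norms, fits polarization through
    the parallelogram identity. *)
Let bounded_by G (b : R) := forall x y, supp_in G x -> supp_in G y ->
  `|bil A y x| <= b * ((\sum_k x k ^+ 2 + \sum_k y k ^+ 2) / 2).

(** If z rounds x, then B(x, x) differs from B(z, z) by two terms containing x - z, each at most b /
    8 since 8 (x - z) lies in the unit ball with support in G. Homogeneity and polarization extend
    this from diagonal values. *)
Let contract G b : (#|G| <= s)%N -> 0 <= b -> bounded_by G b -> bounded_by G (eps + b / 4).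
Proof.
move=> Gs b0 hb.
have unit x : supp_in G x -> \sum_k x k ^+ 2 <= 1 -> `|bil A x x| <= eps + b / 4.
  move=> xG x1; have [w /= [zG z1 dz]] := round_to_grid s0 sL Gs xG x1.
  have := grid_eps z1; move: zG z1 dz; set z := avg _ _ => zG z1 dz ze.
  have dG : supp_in G (fun k => 8 * (x k - z k)).
    by move=> k kG; rewrite xG// zG// subrr mulr0.
  have sum1 u v : \sum_k u k ^+ 2 <= 1 -> \sum_k v k ^+ 2 <= 1 ->
      b * ((\sum_(k : K) u k ^+ 2 + \sum_(k : K) v k ^+ 2) / 2) <= b.
    by move=> u1 v1; rewrite ler_piMr//; lra.
  have h1 := le_trans (hb _ _ xG dG) (sum1 _ _ x1 dz).
  have h2 := le_trans (hb _ _ dG zG) (sum1 _ _ dz z1).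
  rewrite bilZl bilBl normrM in h1; rewrite bilZr bilBr normrM in h2.
  rewrite [`|8|]ger0_norm in h1; last exact: (ler0n R 8).
  rewrite [`|8|]ger0_norm in h2; last exact: (ler0n R 8).
  have -> : bil A x x = bil A z z + ((bil A x x - bil A z x) + (bil A z x - bil A z z)) by ring.
  have t1 := ler_normD (bil A z z) ((bil A x x - bil A z x) + (bil A z x - bil A z z)).
  have t2 := ler_normD (bil A x x - bil A z x) (bil A z x - bil A z z).
  lra.
have quadr x : supp_in G x -> `|bil A x x| <= (eps + b / 4) * \sum_k x k ^+ 2.
  move=> xG; have X0 : 0 <= \sum_k x k ^+ 2 by apply: sumr_ge0 => k _; exact: sqr_ge0.
  have [Xz|Xnz] := eqVneq (\sum_k x k ^+ 2) 0.
    have xz := sum_sqr_eq0 Xz.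
    rewrite Xz mulr0 /bil big1 ?normr0// => k _.
    by rewrite big1// => l _; rewrite xz !mul0r.
  set X := \sum_k _ in X0 Xnz *.
  have Xp : 0 < X by rewrite lt_neqAle eq_sym Xnz.
  have h : `|bil A (fun k => (Num.sqrt X)^-1 * x k) (fun k => (Num.sqrt X)^-1 * x k)| <= eps + b / 4.
    apply: unit; first by move=> k /xG ->; rewrite mulr0.
    under eq_bigr do rewrite exprMn exprVn sqr_sqrtr//.
    by rewrite -mulr_sumr mulVf.
  move: h; rewrite bilZl bilZr mulrA -expr2 exprVn sqr_sqrtr// normrM.
  by rewrite ger0_norm ?invr_ge0// mulrC ler_pdivrMr.
move=> x y xG yG.
rewrite bil_polar; apply: (le_trans (ler_normB _ _)).
have u : supp_in G (fun k => (x k + y k) / 2).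
  by move=> k kG; rewrite xG// yG// addr0 mul0r.
have v : supp_in G (fun k => (x k - y k) / 2).
  by move=> k kG; rewrite xG// yG// subr0 mul0r.
apply: (le_trans (lerD (quadr _ u) (quadr _ v))).
rewrite -mulrDr le_eqVlt; apply/orP; left; apply/eqP; congr (_ * _).
rewrite -!big_split mulr_suml; apply: eq_bigr => k _ /=.
by field.
Qed.

(** Iterating b -> eps + b / 4 from the entrywise bound [b0] brings the constant below any number
    above 2 eps. *)
Lemma bil_le G x y : (#|G| <= s)%N -> supp_in G x -> supp_in G y ->
  \sum_k x k ^+ 2 = 1 -> \sum_k y k ^+ 2 = 1 -> `|bil A y x| <= 2 * eps.
Proof.
move=> Gs xG yG x1 y1.
pose b0 := \sum_k \sum_l `|A k l|.
have b00 : 0 <= b0 by apply: sumr_ge0 => k _; apply: sumr_ge0.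
have start : bounded_by G b0.
  by move=> u v _ _; exact: bil_le_sum.
have iter k : bounded_by G (2 * eps + b0 / 4 ^+ k).
  elim: k => [|k IH].
    move=> u v uG vG; apply: (le_trans (start u v uG vG)); apply: ler_wpM2r.
      by rewrite divr_ge0// addr_ge0//; apply: sumr_ge0 => ? _; exact: sqr_ge0.
    by rewrite expr0 divr1; have := eps0; lra.
  have c0 : 0 <= b0 / 4 ^+ k by rewrite divr_ge0 ?exprn_ge0.
  have nn : 0 <= 2 * eps + b0 / 4 ^+ k by rewrite addr_ge0 ?mulr_ge0.
  move=> u v uG vG; apply: (le_trans (contract Gs nn IH uG vG)); apply: ler_wpM2r.
    by rewrite divr_ge0// addr_ge0//; apply: sumr_ge0 => ? _; exact: sqr_ge0.
  have -> : b0 / 4 ^+ k.+1 = b0 / 4 ^+ k / 4.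
    by rewrite exprS; field; rewrite expf_neq0// pnatr_eq0.
  by have := eps0; set c := b0 / _ in c0 *; lra.
rewrite leNgt; apply/negP => gt.
set e := `|bil A y x| in gt.
have g0 : 0 < e - 2 * eps by lra.
pose N := (Num.truncn (b0 / (e - 2 * eps))).+1.
have := iter N x y xG yG; rewrite -/e x1 y1.
have -> : (1 + 1) / 2 = 1 :> R by field.
rewrite mulr1 => h.
have : b0 < N%:R * (e - 2 * eps).
  rewrite -ltr_pdivrMr//.
  by have /andP[] := truncn_itv (divr_ge0 b00 (ltW g0)).
apply/negP; rewrite -leNgt.
have p4 : N%:R <= (4 : R) ^+ N by rewrite -natrX ler_nat ltnW// ltn_expl.
have : e - 2 * eps <= b0 / 4 ^+ N by lra.
rewrite ler_pdivlMr ?exprn_gt0// => h2.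
by apply: (le_trans _ h2); rewrite mulrC ler_pM2l.
Qed.

End Rounding.

(** * Measurability of the norm event *)

Section SnormMeasurable.
Context d (T : measurableType d) (K : finType) (s : nat) (delta : R).
Variable A : K -> K -> T -> R.
Hypothesis mA : forall k l, measurable_fun setT (A k l : T -> measurableTypeR R).
Hypotheses (s0 : (0 < s)%N) (delta0 : 0 < delta).

Let pt L (a : code K L) : K -> R := avg (Num.sqrt s%:R) a.

(* Grid points of all levels are dense in the unit balls, whence a countable union. *)
Let wit (L : nat) (g : {set K} * (code K L * code K L)) (w : T) : bool :=
  [&& (#|g.1| <= s)%N, [forall k, (k \notin g.1) ==> (pt g.2.1 k == 0)],
      [forall k, (k \notin g.1) ==> (pt g.2.2 k == 0)] &
      delta ^+ 2 * ((\sum_k pt g.2.1 k ^+ 2) * \sum_k pt g.2.2 k ^+ 2) <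
      bil (fun k l => A k l w) (pt g.2.2) (pt g.2.1) ^+ 2].

(** The strict inequality forces both grid points to be nonzero; normalizing them gives admissible
    vectors. *)
Let snorm_of_wit L g w : @wit L g w -> (delta%:E < snorm s (fun k l => A k l w))%E.
Proof.
case: g => G [a b] /and4P[/= Gs /forallP aG /forallP bG].
set X := \sum_k _; set Y := \sum_k _ => lt.
have X0 : 0 <= X by apply: sumr_ge0 => k _; exact: sqr_ge0.
have Y0 : 0 <= Y by apply: sumr_ge0 => k _; exact: sqr_ge0.
have bil0 : bil (fun k l => A k l w) (pt b) (pt a) != 0.
  rewrite -sqrf_eq0 gt_eqF// (le_lt_trans _ lt)// !mulr_ge0//; exact: ltW.
have Xp : 0 < X.
  rewrite lt_neqAle X0 andbT eq_sym; apply/negP => /eqP /sum_sqr_eq0 az.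
  move/eqP: bil0; apply; rewrite /bil big1// => k _; rewrite big1// => l _.
  by rewrite az mulr0.
have Yp : 0 < Y.
  rewrite lt_neqAle Y0 andbT eq_sym; apply/negP => /eqP /sum_sqr_eq0 bz.
  move/eqP: bil0; apply; rewrite /bil big1// => k _; rewrite big1// => l _.
  by rewrite bz !mul0r.
pose x k := (Num.sqrt X)^-1 * pt a k; pose y k := (Num.sqrt Y)^-1 * pt b k.
apply: (@lt_le_trans _ _ (`|bil (fun k l => A k l w) y x|)%:E); last first.
  apply: ereal_sup_ubound; exists G, x, y; split=> //.
  - split=> // k kG; have /implyP/(_ kG)/eqP := aG k; rewrite /x => ->; exact: mulr0.
  - by move=> k kG; have /implyP/(_ kG)/eqP := bG k; rewrite /y => ->; exact: mulr0.
  - under eq_bigr do rewrite exprMn exprVn sqr_sqrtr//.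
    by rewrite -mulr_sumr mulVf// gt_eqF.
  - under eq_bigr do rewrite exprMn exprVn sqr_sqrtr//.
    by rewrite -mulr_sumr mulVf// gt_eqF.
rewrite lte_fin -(@ltr_pXn2r _ 2)// ?nnegrE ?ltW// real_normK ?num_real//.
rewrite bilZl bilZr !exprMn !exprVn !sqr_sqrtr//.
rewrite mulrA -invfM mulrC ltr_pdivlMr ?mulr_gt0//.
by rewrite [Y * X]mulrC.
Qed.

Let wit_of_snorm w : (delta%:E < snorm s (fun k l => A k l w))%E ->
  exists L g, @wit L g w.
Proof.
have eq_le1 (z : R) : z = 1 -> z <= 1 by move=> ->.
move=> /ereal_sup_gt[_ [G [x [y [[Gs xG] yG x1 y1 ->]]]]]; rewrite lte_fin.
pose Aw := fun k l => A k l w.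
rewrite -/(bil Aw y x) => lt.
pose b0 := \sum_k \sum_l `|Aw k l|.
have b00 : 0 <= b0 by apply: sumr_ge0 => k _; apply: sumr_ge0.
have g0 : 0 < `|bil Aw y x| - delta by rewrite subr_gt0.
(* Rounding each argument costs at most b0 / c, so the two errors together stay below the margin. *)
pose c := (Num.truncn (2 * b0 / (`|bil Aw y x| - delta))).+1.
have cP : 2 * b0 / c%:R < `|bil Aw y x| - delta.
  rewrite ltr_pdivrMr ?ltr0n// [ltRHS]mulrC -ltr_pdivrMr//.
  by have /andP[] := truncn_itv (divr_ge0 (mulr_ge0 (ler0n R 2) b00) (ltW g0)).
have c0 : 0 < c%:R :> R by rewrite ltr0n.
have cL : (c * s <= 2 ^ (c * s))%N by rewrite ltnW// ltn_expl.
have [a /= [aG a1 da]] := round_to_grid s0 cL Gs xG (eq_le1 _ x1).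
have [b /= [bG b1 db]] := round_to_grid s0 cL Gs yG (eq_le1 _ y1).
exists (c * s)%N, (G, (a, b)); apply/and4P; split => //=.
- by apply/forallP => k; apply/implyP => kG; apply/eqP; exact: aG.
- by apply/forallP => k; apply/implyP => kG; apply/eqP; exact: bG.
have near1 (u v : K -> R) : \sum_k u k ^+ 2 <= 1 -> \sum_k v k ^+ 2 <= 1 ->
    `|bil Aw u v| <= b0.
  move=> u1 v1; apply: (le_trans (bil_le_sum _ _ _)).
  by rewrite ler_piMr//; lra.
have h1 := near1 _ _ db (eq_le1 _ x1).
have h2 := near1 _ _ b1 da.
rewrite bilZl bilBl normrM ger0_norm// in h1; rewrite bilZr bilBr normrM ger0_norm// in h2.
rewrite mulrC -ler_pdivlMr// in h1; rewrite mulrC -ler_pdivlMr// in h2.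
have t : `|bil Aw y x| <= `|bil Aw y x - bil Aw (pt b) x| +
    `|bil Aw (pt b) x - bil Aw (pt b) (pt a)| + `|bil Aw (pt b) (pt a)|.
  have -> : bil Aw y x = (bil Aw y x - bil Aw (pt b) x) +
    (bil Aw (pt b) x - bil Aw (pt b) (pt a)) + bil Aw (pt b) (pt a) by ring.
  have -> : (bil Aw y x - bil Aw (pt b) x) +
    (bil Aw (pt b) x - bil Aw (pt b) (pt a)) + bil Aw (pt b) (pt a) - bil Aw (pt b) x =
    bil Aw y x - bil Aw (pt b) x by ring.
  by apply: (le_trans (ler_normD _ _)); rewrite lerD2r; exact: ler_normD.
have gt : delta < `|bil Aw (pt b) (pt a)|.
  have e : 2 * b0 / c%:R = b0 / c%:R + b0 / c%:R by field; rewrite gt_eqF.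
  move: cP t h1 h2; rewrite e /pt; lra.
have X0 : 0 <= \sum_k pt a k ^+ 2 by apply: sumr_ge0 => k _; exact: sqr_ge0.
have Y0 : 0 <= \sum_k pt b k ^+ 2 by apply: sumr_ge0 => k _; exact: sqr_ge0.
apply: (@le_lt_trans _ _ (delta ^+ 2)).
  rewrite ler_piMr ?sqr_ge0//; apply: (@le_trans _ _ (1 * 1)); last by rewrite mulr1.
  exact: ler_pM.
by rewrite -[ltRHS]real_normK ?num_real// ltr_pXn2r ?nnegrE// ltW.
Qed.

(** Monotonicity of P requires it, and the norm is a supremum over uncountably many vectors. *)
Lemma measurable_snorm :
  measurable [set w | (delta%:E < snorm s (fun k l => A k l w))%E].
Proof.
have -> : [set w | (delta%:E < snorm s (fun k l => A k l w))%E] =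
    \bigcup_L [set w | [exists g, @wit L g w]].
  apply/seteqP; split=> [w /wit_of_snorm[L [g h]]|w [L _ /existsP[g h]]].
    by exists L => //; apply/existsP; exists g.
  exact: snorm_of_wit h.
apply: bigcupT_measurable => L; apply: measurable_exists => g.
rewrite /wit.
apply: measurable_andb_cond.
apply: measurable_andb_cond.
apply: measurable_andb_cond.
apply: measurable_set_lt => //.
apply: measurable_funX; apply: measurable_sum => k; apply: measurable_sum => l.
apply: measurable_funM; last exact: measurable_cst.
apply: measurable_funM; [exact: measurable_cst|exact: mA].
Qed.

End SnormMeasurable.

(** * Choice of the constants *)

Section Constants.
Variables (R : realType) (n m p s L : nat).
Hypotheses (n0 : (0 < n)%N) (p0 : (0 < p)%N) (nm : (n <= m)%N).
Hypotheses (s2 : (2 <= s <= n * p)%N) (Ls : (2 ^ L <= 16 * s)%N).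

Lemma expR_half_le2 : expR (2^-1) <= 2 :> R.
Proof.
have h := expR_ge1Dx (- 2^-1 : R).
rewrite -[2^-1]opprK expRN invf_ple ?posrE ?expR_gt0//.
by apply: le_trans h; rewrite le_eqVlt; apply/orP; left; apply/eqP; field.
Qed.

Lemma expR1_le4 : expR 1 <= 4 :> R.
Proof.
have -> : expR 1 = expR (2^-1) * expR (2^-1) :> R by rewrite -expRD; congr expR; field.
apply: (@le_trans _ _ (2 * 2)); last by lra.
by apply: ler_pM; rewrite ?expR_ge0// expR_half_le2.
Qed.

Let N : R := (n * p)%:R.
Let l : R := ln N.

Let N2 : 2 <= N.
Proof. by rewrite /N ler_nat; case/andP: s2; exact: leq_trans. Qed.

Let lE : expR l = N.
Proof. by rewrite lnK// posrE; have := N2; lra. Qed.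

(** This lower bound, from n p >= 2, lets lower powers of l be absorbed into higher ones. *)
Lemma half_le_ln : 2^-1 <= l.
Proof. by rewrite -ler_expR lE (le_trans expR_half_le2). Qed.

Let l_le : 1 + l <= N.
Proof. by rewrite -lE expR_ge1Dx. Qed.

Let ln_odd : ln (2 * N + 1) <= 3 * l.
Proof.
have n2 := N2; rewrite -ler_expR lnK ?posrE; last lra.
rewrite expRM_natl lE.
have : 4 * N <= N ^+ 3.
  have -> : N ^+ 3 = N ^+ 2 * N by ring.
  by apply: ler_wpM2r; [lra|nra].
by lra.
Qed.

(** exp (L / 2) <= 2^L <= 16 N <= N^5 gives L <= 10 l, and 1 <= 2 l. *)
Let L_le : L.+1%:R <= 12 * l.
Proof.
have h2 := half_le_ln; have n2 := N2.
suff h : L%:R * 2^-1 <= 5 * l by rewrite -natr1; lra.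
rewrite -ler_expR !expRM_natl lE.
apply: (@le_trans _ _ (2 ^+ L)).
  by apply: lerXn2r; rewrite ?nnegrE ?expR_ge0// expR_half_le2.
apply: (@le_trans _ _ (16 * N)).
  rewrite /N -natrX -natrM ler_nat (leq_trans Ls)// leq_mul2l.
  by case/andP: s2 => _ ->; rewrite orbT.
have -> : N ^+ 5 = N ^+ 4 * N by ring.
apply: ler_wpM2r; first lra.
have -> : (16 : R) = 2 ^+ 4 by ring.
by apply: lerXn2r; rewrite ?nnegrE; lra.
Qed.

Let th : R := Num.sqrt l.

Let l0 : 0 <= l. Proof. by have := half_le_ln; lra. Qed.

Let th2 : th ^+ 2 = l. Proof. by rewrite sqr_sqrtr. Qed.

Lemma ln_np_gt0 : 0 < l.
Proof. by apply: lt_le_trans half_le_ln; rewrite invr_gt0. Qed.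

Lemma sqrt_ln_ge : 2 <= th * (10 * th).
Proof. by have h := half_le_ln; rewrite mulrCA -expr2 th2; lra. Qed.

Lemma ln_pow6_ge : 64^-1 <= l ^+ 6.
Proof.
have h := half_le_ln; have -> : 64^-1 = (2^-1) ^+ 6 :> R by field.
by apply: lerXn2r; rewrite ?nnegrE; lra.
Qed.

(** 2406 = 800 + 4 * 400 + 6, with exp 1 <= 4; each power of N left over is at most 1 / N. *)
Lemma tail_budget :
  8 * p%:R * N * ((10 * th) ^+ 2 * expR (- (9 * th ^+ 2))) +
     4 * N ^+ 3 * ((10 * th) ^+ 2 * expR (1 - 9 * th ^+ 2)) +
     6 * (2 * N + 1) ^- 2 <= 2406 / N.
Proof.
have n2 := N2; have nz : N != 0 by rewrite gt_eqF//; lra.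
pose i := N^-1.
have i0 : 0 < i by rewrite invr_gt0; lra.
have i1 : i <= 1 by rewrite invf_le1; lra.
have Ni : N * i = 1 by rewrite mulfV.
have e9 : expR (- (9 * l)) = i ^+ 9 by rewrite expRN expRM_natl lE exprVn.
have pN : p%:R <= N by rewrite /N ler_nat leq_pmull.
have lN : l <= N by have := l_le; lra.
have small (k : nat) : i ^+ k.+1 <= i.
  by rewrite exprS ler_piMr ?exprn_ile1// ltW.
have N0 : 0 <= N by lra.
have p00 : 0 <= p%:R :> R by [].
rewrite exprMn th2 expRD e9.
have t1 : p%:R * N * l * i ^+ 9 <= i.
  apply: le_trans (small 5%N).
  have -> : i ^+ 6 = N * N * N * i ^+ 9.
    have -> : N * N * N * i ^+ 9 = (N * i) ^+ 3 * i ^+ 6 by ring.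
    by rewrite Ni expr1n mul1r.
  by apply: ler_wpM2r; [rewrite exprn_ge0// ltW|do 2! (apply: ler_pM; rewrite ?mulr_ge0//)].
have t2 : N ^+ 3 * l * i ^+ 9 <= i.
  apply: le_trans (small 4%N).
  have -> : i ^+ 5 = N ^+ 3 * N * i ^+ 9.
    have -> : N ^+ 3 * N * i ^+ 9 = (N * i) ^+ 4 * i ^+ 5 by ring.
    by rewrite Ni expr1n mul1r.
  by apply: ler_wpM2r; [rewrite exprn_ge0// ltW|apply: ler_wpM2l; rewrite ?exprn_ge0].
have t3 : (2 * N + 1) ^- 2 <= i.
  rewrite lef_pV2 ?posrE ?exprn_gt0//; [nra|lra|lra].
have e4 := expR1_le4; have e0 := expR_ge0 (1 : R).
have t2' : N ^+ 3 * l * i ^+ 9 * expR 1 <= 4 * i.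
  have q0 : 0 <= N ^+ 3 * l * i ^+ 9.
    by rewrite !mulr_ge0 ?exprn_ge0 ?l0// ltW.
  by rewrite [leRHS]mulrC; exact: ler_pM.
have -> : 8 * p%:R * N * (10 ^+ 2 * l * i ^+ 9) = 800 * (p%:R * N * l * i ^+ 9) by ring.
have -> : 4 * N ^+ 3 * (10 ^+ 2 * l * (expR 1 * i ^+ 9)) =
  400 * (N ^+ 3 * l * i ^+ 9 * expR 1) by ring.
rewrite -/i; lra.
Qed.

(** 8640 = 12^2 * 20 * 3 collects the bounds on L + 1 and ln (2 N + 1); 3434 = 200 + 2 * 1601 + 4 *
    8 and 512 = 64 * 8 come from absorbing lower powers of l. *)
Lemma level_budget (D : R) : 0 <= D -> level n m p s L th D <=
  8640 * (6272 * 200 * 3434 + 512) * (s%:R * l ^+ 6 / m%:R) * (1 + D).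
Proof.
move=> D0; have h2 := half_le_ln; have lp := l0; have n2 := N2.
have Lo0 : 0 <= ln (2 * N + 1) by apply: ln_ge0; lra.
have l1 : l <= 2 * l ^+ 2.
  have -> : 2 * l ^+ 2 = 2 * l * l by ring.
  by rewrite ler_peMl//; lra.
have l2 : 1 <= 4 * l ^+ 2 by lra.
have l3 : 1 <= 8 * l ^+ 3.
  have -> : 8 * l ^+ 3 = (2 * l) ^+ 3 by ring.
  by apply: exprn_ege1; lra.
have lD : D * l <= D * (2 * l ^+ 2) by exact: ler_wpM2l.
have qD : 0 <= D * l ^+ 2 by rewrite mulr_ge0 ?exprn_ge0.
have D1 : 1 <= 1 + D by rewrite lerDl.
rewrite /level /chaos_var exprMn th2 -/N -/l.
have -> : 2 * (10 ^+ 2 * l) = 200 * l by ring.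
set B : R := l * _ + _.
have a0 : 0 <= 200 * l :> R by exact: (mulr_ge0 (ler0n R 200) lp).
have B0 : 0 <= B.
  apply: addr_ge0.
    by apply: (mulr_ge0 lp); apply: addr_ge0 => //; exact: addr_ge0.
  by apply: (mulr_ge0 (ler0n R 8)); exact: addr_ge0.
have B1 : B <= 3434 * (l ^+ 2 * (1 + D)).
  have -> : B = D * l + (200 * l ^+ 2 + 1601 * l + 8) by rewrite /B; ring.
  have -> : 3434 * (l ^+ 2 * (1 + D)) = 3434 * (D * l ^+ 2) + 3434 * l ^+ 2 by ring.
  apply: lerD; last by lra.
  by apply: (le_trans lD); lra.
set c : R := 6272; have c0 : 0 <= c by exact: ler0n.
have X1 : 0 <= c * (200 * l) by exact: mulr_ge0.
move: X1 B1 a0; set a : R := 200; set b : R := 3434 => X1 B1 a0.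
have B2 : c * (a * l) * B + 64 <= (c * a * b + 512) * (l ^+ 3 * (1 + D)).
  have a1 : c * (a * l) * B <= c * (a * l) * (b * (l ^+ 2 * (1 + D))).
    exact: ler_wpM2l.
  have a2 : 64 <= 64 * (8 * l ^+ 3 * (1 + D)).
    rewrite ler_peMr; [by []|exact: (ler0n R 64)|].
    by apply: (le_trans D1); rewrite ler_peMl//; exact: le_trans D1.
  have -> : (c * a * b + 512) * (l ^+ 3 * (1 + D)) =
    c * (a * l) * (b * (l ^+ 2 * (1 + D))) + 64 * (8 * l ^+ 3 * (1 + D)) by ring.
  exact: lerD.
set q : R := s%:R / m%:R.
have q0 : 0 <= q by rewrite divr_ge0.
have X0 : 0 <= c * (a * l) * B + 64.
  by apply: addr_ge0; [exact: mulr_ge0|exact: (ler0n R 64)].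
set C := c * a * b + 512 in B2 *.
set X := _ + 64 in B2 X0 *.
clearbody C X.
have -> : 8640 * C * (s%:R * l ^+ 6 / m%:R) * (1 + D) =
    (12 * l) ^+ 2 * (20 * (q * (C * (l ^+ 3 * (1 + D)))) * (3 * l)).
  by rewrite /q; ring.
have qX : 0 <= 20 * (q * X) by apply: mulr_ge0; [exact: ler0n|exact: mulr_ge0].
apply: ler_pM.
- exact: sqr_ge0.
- exact: mulr_ge0.
- by apply: lerXn2r; rewrite ?nnegrE ?mulr_ge0// L_le.
by apply: ler_pM => //; apply: ler_wpM2l => //; apply: ler_wpM2l.
Qed.

End Constants.

Lemma gaussian_mgf d (T : measurableType d) (K : realType) (P : probability T K)
    (X : T -> K) (sg t : K) : sg != 0 ->
  measurable_fun setT (X : T -> measurableTypeR K) ->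
  (forall A : set K, measurable (A : set (measurableTypeR K)) ->
    P (X @^-1` A) = normal_prob 0 sg A) ->
  (\int[P]_w (expR (t * X w))%:E = (expR (t ^+ 2 * sg ^+ 2 / 2))%:E)%E.
Proof.
move=> sg0 mX law; rewrite -normal_mgf//.
have mexp : measurable_fun [set: K] (fun x : K => (expR (t * x))%:E).
  apply/measurable_EFinP; apply: measurableT_comp => //.
pose Xm : {mfun T >-> measurableTypeR K}  :=
  @mfun_Sub _ _ T (measurableTypeR K) X (mem_set mX).
transitivity (\int[distribution P Xm]_x (expR (t * x))%:E)%E.
  by rewrite ge0_integral_pushforward.
by apply: eq_measure_integral => A mA _; exact: law.
Qed.

Lemma bil_IminusGram (T : Type) (n m p : nat) (phi : 'I_p -> 'I_m -> T -> R) (w : T)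
    (x : 'I_p * 'I_n -> R) :
  bil (IminusGram phi w) x x = \sum_k x k ^+ 2 - quad (fun j => phi j.1 j.2 w) x.
Proof.
have -> : \sum_k x k ^+ 2 = \sum_k \sum_l x k * (k == l)%:R * x l.
  apply: eq_bigr => k _; under eq_bigr do rewrite mulrAC mulrC.
  by rewrite sum_pick expr2.
have -> : quad (fun j => phi j.1 j.2 w) x = \sum_k \sum_l \sum_(r < m)
    (x k * Phi_entry phi r k w) * (x l * Phi_entry phi r l w).
  under [RHS]eq_bigr do rewrite exchange_big.
  rewrite [RHS]exchange_big; apply: eq_bigr => r _.
  by rewrite expr2 {1}/meas mulr_suml; apply: eq_bigr => k _; rewrite mulr_sumr.
rewrite /bil -sumrB; apply: eq_bigr => k _; rewrite -sumrB; apply: eq_bigr => l _.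
rewrite /IminusGram mulrBr mulrBl; congr (_ - _).
by rewrite mulr_sumr mulr_suml; apply: eq_bigr => r _; ring.
Qed.

(** The factor 2 of [bil_le] is why the grid must be controlled at delta / 2. *)
Lemma snorm_sub_Dev d (T : measurableType d) (n m p s L : nat) (phi : 'I_p -> 'I_m -> T -> R) (delta : R) :
  (0 < s)%N -> (8 * s <= 2 ^ L)%N -> 0 < delta ->
  [set w | (delta%:E < snorm s (@IminusGram T n m p phi w))%E] `<=`
  @Dev d T _ n m p s L (fun j => phi j.1 j.2) (delta / 2).
Proof.
move=> s0 sL delta0 w; apply: contraPP => nDev /=.
apply/negP; rewrite -leNgt; apply: ge_ereal_sup => _ [G [x [y [[Gs xG] yG x1 y1 ->]]]].
rewrite lee_fin -/(bil (IminusGram phi w) y x).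
have -> : delta = 2 * (delta / 2) by field.
apply: (bil_le s0 sL _ _ _ Gs xG yG x1 y1).
- move=> k l; rewrite /IminusGram eq_sym; congr (_ - _).
  by apply: eq_bigr => r _; rewrite mulrC.
- by rewrite ltW// divr_gt0.
move=> a /= a1; rewrite bil_IminusGram distrC leNgt; apply/negP => h; apply: nDev.
by apply/existsP; exists a; rewrite /in_ball /dev /grid a1.
Qed.

(** The lower bound serves the rounding with c = 8, the upper one keeps L of order ln (n p). *)
Lemma dyadic_scale (s : nat) : (0 < s)%N ->
  exists L, (8 * s <= 2 ^ L)%N /\ (2 ^ L <= 16 * s)%N.
Proof.
move=> s0; exists (up_log 2 (8 * s)).
have s8 : (1 < 8 * s)%N by lia.
have /andP[h1 h2] := up_log_bounds (isT : 1 < 2)%N s8.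
split=> //; move: h1 h2; case: (up_log _ _) => [|k] /=; first by lia.
by rewrite expnS; lia.
Qed.

Theorem theorem2 :
  exists C8 C9 : R, 0 < C8 /\ 0 < C9 /\
  forall (n p m s : nat) (delta : R),
    (0 < n)%N -> (0 < p)%N -> (n <= m)%N -> (2 <= s <= n * p)%N ->
    0 < delta <= 1 ->
  forall (d : measure_display) (T : measurableType d) (P : probability T R)
         (phi : 'I_p -> 'I_m -> T -> R),
    (forall i t, measurable_fun setT (phi i t : T -> measurableTypeR R)) ->
    (forall i t (A : set R), measurable (A : set (measurableTypeR R)) ->
        P (phi i t @^-1` A) = normal_prob 0 (Num.sqrt (m%:R^-1)) A) ->
    mutually_independent P (fun k : 'I_p * 'I_m => phi k.1 k.2) ->
    C9 * delta ^- 2 * s%:R * (ln ((n * p)%:R)) ^+ 6 <= m%:R ->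
    (P [set w | delta%:E < snorm s (@IminusGram T n m p phi w)]
      <= (C8 / (n * p)%:R)%:E)%E.
Proof.
pose Cv : R := 6272 * 200 * 3434 + 512.
have pos (k : nat) : 0 < k.+1%:R :> R := ltr0Sn _ k.
have Cv0 : 0 < Cv by exact: (addr_gt0 (mulr_gt0 (mulr_gt0 (pos _) (pos _)) (pos _)) (pos _)).
have c80 : 0 < 8 * 2406 :> R by exact: (mulr_gt0 (pos _) (pos _)).
(* 44 from the descent, 4 from the square of delta / 2, the rest from [level_budget]. *)
pose Ca : R := 44 * 4 * (8640 * Cv).
(* 32 exp 3 from [fixed_dev], 16 from the square of delta / 4, 64 from l^6 >= 1/64. *)
pose Cb : R := 32 * 16 * 64 * expR 3.
have Ca0 : 0 < Ca by exact: (mulr_gt0 (mulr_gt0 (pos _) (pos _)) (mulr_gt0 (pos _) Cv0)).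
have Cb0 : 0 < Cb.
  exact: (mulr_gt0 (mulr_gt0 (mulr_gt0 (pos _) (pos _)) (pos _)) (expR_gt0 _)).
exists (8 * 2406), (Ca + Cb); split; first exact: c80.
split; first exact: addr_gt0.
move=> n p m s delta n0 p0 nm sb /andP[d0 d1] d T P phi mphi law indep hm.
have /andP[s2 snp] := sb.
have s0 : (0 < s)%N by exact: ltnW.
have m0 : 0 < m%:R :> R by rewrite ltr0n (leq_trans n0 nm).
have N0 : 0 < (n * p)%:R :> R by rewrite ltr0n muln_gt0 n0.
have mS : measurable [set w | (delta%:E < snorm s (@IminusGram T n m p phi w))%E].
  apply: (measurable_snorm (A := fun k l w => @IminusGram T n m p phi w k l)) => // k l.
  apply: measurable_funB; first exact: measurable_cst.
  by apply: measurable_sum => r; apply: measurable_funM; exact: mphi.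
(* For n p <= 8 * 2406 the claimed bound is at least 1; otherwise eta = 2406 / (n p) satisfies 8 eta
   <= 1, as the descent requires. *)
have [Nle|Ngt] := leP (n * p)%:R (8 * 2406 : R).
  apply: (le_trans (probability_le1 P mS)).
  by rewrite lee_fin ler_pdivlMr// mul1r.
pose X (j : 'I_p * 'I_m) : T -> R := phi j.1 j.2.
have mX j : measurable_fun setT (X j : T -> measurableTypeR R) by exact: mphi.
have mgf1 j t : (\int[P]_w (expR (t * X j w))%:E = (expR (t ^+ 2 * m%:R^-1 / 2))%:E)%E.
  rewrite (@gaussian_mgf _ _ _ P (X j) (Num.sqrt m%:R^-1))//.
  - by rewrite sqr_sqrtr// invr_ge0 ltW.
  - by rewrite sqrtr_eq0 -ltNge invr_gt0.
  - exact: law.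
have [L [L1 L2]] := dyadic_scale s0.
have Ls : (2 ^ L <= 16 * s ^ 2)%N.
  by apply: (leq_trans L2); rewrite leq_mul2l /= -mulnn leq_pmull.
pose l : R := ln (n * p)%:R.
pose th : R := Num.sqrt l.
have l0 : 0 < l := ln_np_gt0 _ sb.
have th0 : 0 < th by rewrite sqrtr_gt0.
have thth : 2 <= th * (10 * th) := sqrt_ln_ge _ sb.
pose N : R := (n * p)%:R.
pose eta : R := 2406 / N.
have d20 : 0 < delta / 2 by rewrite divr_gt0.
have eta8 : 8 * eta <= 1 by rewrite /eta mulrA ler_pdivrMr// mul1r ltW.
have hm' : (Ca + Cb) * (s%:R * l ^+ 6) <= delta ^+ 2 * m%:R.
  have dd : 0 < delta ^+ 2 by rewrite exprn_gt0.
  rewrite [leRHS]mulrC -ler_pdivrMr//; apply: le_trans hm.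
  rewrite le_eqVlt; apply/orP; left; apply/eqP; rewrite -/l.
  by move: (Ca + Cb) => C; field; rewrite gt_eqF.
have sl0 : 0 <= s%:R * l ^+ 6 by rewrite mulr_ge0// exprn_ge0// ltW.
have hmb : Cb * (s%:R * l ^+ 6) <= delta ^+ 2 * m%:R.
  by apply: le_trans hm'; apply: ler_wpM2r => //; rewrite lerDr ltW.
have hma : Ca * (s%:R * l ^+ 6) <= delta ^+ 2 * m%:R.
  by apply: le_trans hm'; apply: ler_wpM2r => //; rewrite lerDl ltW.
have level_le D : 0 <= D -> level n m p s L th D <= 44^-1 * (delta / 2) ^+ 2 * (1 + D).
  move=> D0; apply: (le_trans (level_budget m sb L2 D0)).
  apply: ler_wpM2r; first by rewrite addr_ge0.
  rewrite -/l -/Cv mulrA ler_pdivrMr//.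
  have -> : 44^-1 * (delta / 2) ^+ 2 * m%:R = (44 * 4)^-1 * (delta ^+ 2 * m%:R) by field.
  have -> : 8640 * Cv * (s%:R * l ^+ 6) = (44 * 4)^-1 * (Ca * (s%:R * l ^+ 6)).
    by rewrite /Ca; field.
  by apply: ler_wpM2l.
have fixed4 (x : code ('I_p * 'I_n)%type L) : in_ball R s x ->
    (P [set w | (delta / 2 / 2 < dev s X x w)%R] <= (4^-1)%:E)%E.
  move=> xX; apply: (fixed_dev n0 nm mX indep mgf1 xX); first by rewrite divr_gt0.
  have l6 : 64^-1 <= l ^+ 6 := ln_pow6_ge _ sb.
  have -> : (delta / 2 / 2) ^+ 2 * m%:R = 16^-1 * (delta ^+ 2 * m%:R) by field.
  have -> : 32 * expR 3 * s%:R = 16^-1 * (Cb * (s%:R * 64^-1)) by rewrite /Cb; field.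
  apply: ler_wpM2l; first by rewrite invr_ge0.
  apply: le_trans hmb; apply: ler_wpM2l; first exact: ltW.
  exact: ler_wpM2l.
have dev_eta : ((P \x P) [set w | deviates n s L th (X ^~ w.1) (X ^~ w.2)] <= eta%:E)%E.
  apply: (le_trans (chaos_prob n0 p0 nm s0 snp Ls mX indep mgf1 th0 thth (lexx _))).
  by rewrite lee_fin; exact: (tail_budget _ n0 sb).
have e1 : 44 * 44^-1 <= 1 :> R by rewrite divff.
have d21 : 0 < delta / 2 <= 1.
  by rewrite d20 ler_pdivrMr// mul1r (le_trans d1)// ler1n.
have := Dev_prob n0 nm mX indep mgf1 d21 e1 eta8 level_le dev_eta fixed4.
move=> h; apply: (@le_trans _ _ (P (Dev n s L X (delta / 2)))).
  apply: le_measure; rewrite ?inE//; first exact: measurable_Dev.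
  exact: snorm_sub_Dev.
apply: (le_trans h); rewrite lee_fin /eta mulrA; apply: ler_wpM2r.
  by rewrite invr_ge0 ltW.
by apply: ler_wpM2r; [exact: ler0n|rewrite ler_nat].
Qed.
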